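(* Let $m,n\geq 1$. The functor on the category of rings $$\mathcal Hom^{\mathrm{c,alg}}(\mathcal L^n,\mathcal L^m):\ A\longmapsto \mathrm{Hom}^{\mathrm{c,alg}}_A\big(\mathcal L^n(A),\mathcal L^m(A)\big)$$ is represented by the ind-affine scheme over $\mathbb Z$ $$\mathrm M^+_{m\times n}(\underline{\mathbb Z})\times\big((L^m\mathbb G_m)^0\big)^{\times n},$$ where for any ring $A$ the corresponding bijection sends $\phi\in\mathrm{Hom}^{\mathrm{c,alg}}_A(\mathcal L^n(A),\mathcal L^m(A))$ to $$\big(\Upsilon(\phi),(f_1,\ldots,f_n)\big)\in \mathrm M^+_{m\times n}(\underline{\mathbb Z}(A))\times\big((L^m\mathbb G_m)^0(A)\big)^{\times n},\qquad f_i:=\phi(t_i)\cdot t^{-\nu(\phi(t_i))},\quad 1\leq i\leq n.$$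
   Context: Rings are commutative, associative and unital. For $n\geq 1$, $\mathcal L^n(A)=A((t_1))\ldots((t_n))$ is the ring of iterated Laurent series (inductively $\mathcal L^1(A)=A((t_1))$, $\mathcal L^n(A)=\mathcal L^{n-1}(A)((t_n))$). Elements are written $f=\sum_{l\in\mathbb Z^n}a_lt^l$ with $t^l=t_1^{l_1}\cdots t_n^{l_n}$, and $\mathrm{supp}(f)=\{l: a_l\neq 0\}$. Put $\Lambda_1=\mathbb Z$, $\mathbb Z^1_\lambda=\{l\in\mathbb Z: l\geq\lambda\}$, and for $n\geq 2$ put $\Lambda_n=\mathrm{Map}(\mathbb Z,\Lambda_{n-1})\times\mathbb Z$ and $\mathbb Z^n_\lambda=\bigcup_{l_n\geq\lambda_n}\mathbb Z^{n-1}_{\lambda'(l_n)}\times\{l_n\}$ for $\lambda=(\lambda',\lambda_n)\in\Lambda_n$. A formal series lies in $\mathcal L^n(A)$ iff its support is contained in $\mathbb Z^n_\lambda$ for some $\lambda\in\Lambda_n$. Topology: $\mathcal L^n(A)$ is an additive topological group with a base of open neighborhoods of zero given by the $A$-submodules $U_\lambda=\{f:\mathrm{supp}(f)\cap(-\mathbb Z^n_\lambda)=\varnothing\}$, $\lambda\in\Lambda_n$. $\mathrm{Hom}^{\mathrm{c,alg}}_{A}(\mathcal L^n(A),\mathcal L^m(A))$ is the set of all continuous homomorphisms of $A$-algebras $\mathcal L^n(A)\to\mathcal L^m(A)$. It is functorial in $A$: for a ring homomorphism $A\to B$, $\phi$ is sent to the unique continuous $B$-algebra homomorphism $\mathcal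 L^n(B)\to\mathcal L^m(B)$ sending each $t_i$ to the image of $\phi(t_i)$ in $\mathcal L^m(B)$. $\underline{\mathbb Z}(A)$ is the ring of locally constant functions $\mathrm{Spec}(A)\to\mathbb Z$. The lexicographical order on $\mathbb Z^n$ compares the last coordinates first: $(l_1,\ldots,l_n)\leq(l_1',\ldots,l_n')$ iff $l_n<l'_n$, or $l_n=l_n'$ and $(l_1,\ldots,l_{n-1})\leq(l'_1,\ldots,l'_{n-1})$. For $f\in\mathcal L^n(A)^*$ it is known that there is a finite decomposition $A\simeq\prod_i A_i$ and elements $l_i\in\mathbb Z^n$ such that the component $\sum_l a_{i,l}t^l\in\mathcal L^n(A_i)$ of $f$ has $a_{i,l}$ nilpotent for all $l<l_i$ and $a_{i,l_i}$ invertible; then $\nu(f)\in\underline{\mathbb Z}(A)^n$ is the locally constant function with value $l_i$ on $\mathrm{Spec}(A_i)$, and $\nu:\mathcal L^n(A)^*\to\underline{\mathbb Z}(A)^n$ is a group homomorphism. Elements of $\underline{\mathbb Z}(A)^n$ are viewed as columns. For $l\in\underline{\mathbb Z}(A)^n$, the monomial $t^{l}\in\mathcal L^n(A)^*$ is defined componentwise over a finite decomposition of $A$ on whose factors $l$ is constant. $\mathrm M^+_{m\times n}(\mathbb Z)$ is the set of integral $(m\times n)$-matrices $(x_{ji})$ in column echelon form with positive leading entries: there are $1\leq p_1<\ldots<p_n\leq m$ with $x_{p_i,i}>0$ and $x_{j,i}=0$ for $j>p_i$, for all $1\leq i\leq n$. $\mathrm M^+_{m\times n}(\underline{\mathbb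 Z}(A))$ is the set of $(m\times n)$-matrices over $\underline{\mathbb Z}(A)$ that lie in $\mathrm M^+_{m\times n}(\mathbb Z)$ at every point of $\mathrm{Spec}(A)$; the functor $A\mapsto\mathrm M^+_{m\times n}(\underline{\mathbb Z}(A))$ is denoted $\mathrm M^+_{m\times n}(\underline{\mathbb Z})$ and is represented by a formal direct limit of finite disjoint unions of copies of $\mathrm{Spec}(\mathbb Z)$. $\Upsilon(\phi)$ denotes the $(m\times n)$-matrix over $\underline{\mathbb Z}(A)$ with columns $\nu(\phi(t_1)),\ldots,\nu(\phi(t_n))$. $(L^m\mathbb G_m)^0$ is the functor $A\mapsto\mathrm{Ker}\big(\nu:\mathcal L^m(A)^*\to\underline{\mathbb Z}(A)^m\big)$; it is known to be represented by an ind-affine scheme over $\mathbb Z$. An ind-affine scheme is a formal filtered direct limit of affine schemes, and a functor on rings is represented by it if it is isomorphic to the corresponding filtered colimit of representable functors. *)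

(* Defs.v *)
From HB Require Import structures.
From mathcomp Require Import all_boot all_order all_algebra.
From mathcomp Require Import all_classical.
From mathcomp Require Import topology_structure.

Set Implicit Arguments.
Unset Strict Implicit.
Unset Printing Implicit Defensive.

Import Order.TTheory GRing.Theory Num.Theory.
Local Open Scope classical_set_scope.
Local Open Scope ring_scope.

(* Rings are [comPzRingType]s: commutative, unital, the zero ring included. *)

Section Laurent.
Variable A : comPzRingType.
Implicit Types f g h : int -> A.

Definition bounded_below f := exists N : int, forall k, k < N -> f k = 0.

Definition laurent_pred : {pred int -> A} := fun f => `[< bounded_below f >].

Lemma laurent_zmod_closed : zmod_closed laurent_pred.
Proof.
split=> [|f g /asboolP[M fM] /asboolP[N gN]]; apply/asboolP; first by exists 0.
exists (Order.min M N) => k; rewrite lt_min => /andP[kM kN].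
by rewrite opprfctE addrfctE fM // gN // subr0.
Qed.
HB.instance Definition _ :=
  GRing.isZmodClosed.Build (int -> A) laurent_pred laurent_zmod_closed.

Record laurent := Laurent { lcoef :> int -> A; _ : lcoef \in laurent_pred }.
HB.instance Definition _ := [isSub for lcoef].
HB.instance Definition _ := [Choice of laurent by <:].
HB.instance Definition _ := [SubChoice_isSubZmodule of laurent by <:].

Lemma laurentP (f : laurent) : bounded_below f.
Proof. exact/asboolP/(valP f). Qed.

Lemma laurent_eqP (f g : laurent) : f =1 g -> f = g.
Proof. by move=> fg; apply: val_inj; apply: funext. Qed.

Lemma lcoefD (f g : laurent) k : (f + g) k = f k + g k.
Proof. by []. Qed.

Lemma lcoefB (f g : laurent) k : (f - g) k = f k - g k.
Proof. by []. Qed.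

Lemma fsum_seq (F : int -> A) (s : seq int) : uniq s ->
  (forall i, i \notin s -> F i = 0) ->
  \sum_(i \in [set: int]) F i = \sum_(i <- s) F i.
Proof.
move=> us Fs; rewrite -(fsbig_widen [set` s] setT) -?(fsbig_seq _ F us) //.
by move=> i [_ /= /negP /Fs].
Qed.

Lemma fsum_reindex (h : int -> int) (F : int -> A) : bijective h ->
  \sum_(i \in [set: int]) F i = \sum_(i \in [set: int]) F (h i).
Proof. exact: reindex_fsbigT. Qed.

Definition conv f g (k : int) : A := \sum_(i \in [set: int]) f i * g (k - i).

(* For a <= b these are the integers of [a, b]. *)
Definition irange (a b : int) : seq int :=
  [seq a + i%:Z | i <- iota 0 `|b - a|.+1].

Lemma irange_uniq a b : uniq (irange a b).
Proof. by rewrite map_inj_uniq ?iota_uniq // => i j /addrI []. Qed.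

Lemma mem_irange a b i : a <= i -> i <= b -> i \in irange a b.
Proof.
move=> ai ib; apply/mapP; exists `|i - a|%N; last first.
  by rewrite gez0_abs ?subr_ge0 // addrCA subrr addr0.
rewrite mem_iota /= add0n ltnS -lez_nat !gez0_abs ?subr_ge0 ?lerD2r //.
exact: le_trans ib.
Qed.

Lemma irangeN a b i : i \notin irange a b -> i < a \/ b < i.
Proof.
move=> h; case: (ltP i a) => ai; [by left | right].
by rewrite ltNge; apply: contra h => ib; apply: mem_irange.
Qed.

Lemma convE a b c d f g k : (forall i, i < a -> f i = 0) ->
  (forall i, i < b -> g i = 0) -> c <= a -> k - b <= d ->
  conv f g k = \sum_(i <- irange c d) f i * g (k - i).
Proof.
move=> fa gb ca kd; apply: fsum_seq; first exact: irange_uniq.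
move=> i /irangeN[ic|di]; first by rewrite fa ?mul0r // (lt_le_trans ic).
by rewrite gb ?mulr0 // ltrBlDl -ltrBlDr (le_lt_trans kd).
Qed.

Lemma conv_bounded a b f g : (forall i, i < a -> f i = 0) ->
  (forall i, i < b -> g i = 0) -> forall k, k < a + b -> conv f g k = 0.
Proof.
move=> fa gb k kab; rewrite (convE fa gb (lexx _) (lexx _)) big1_seq // => i _.
case: (ltP i a) => ai; first by rewrite fa ?mul0r.
by rewrite gb ?mulr0 // ltrBlDr (lt_le_trans kab) // addrC lerD2l.
Qed.

Lemma conv_laurent (f g : laurent) : conv f g \in laurent_pred.
Proof.
have [a fa] := laurentP f; have [b gb] := laurentP g.
by apply/asboolP; exists (a + b); apply: conv_bounded.
Qed.

Definition lmul (f g : laurent) : laurent := Laurent (conv_laurent f g).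

Lemma single_laurent (k : int) (c : A) :
  (fun j => if j == k then c else 0) \in laurent_pred.
Proof. by apply/asboolP; exists k => j /lt_eqF ->. Qed.

(* The series c t^k. *)
Definition single k c : laurent := Laurent (single_laurent k c).

Lemma singleE k c j : single k c j = if j == k then c else 0.
Proof. by []. Qed.

Lemma lmul_single k c (f : laurent) j : lmul (single k c) f j = c * f (j - k).
Proof.
rewrite /= /conv (@fsum_seq _ [:: k]) //= ?big_seq1 ?eqxx // => i.
by rewrite inE => /negPf ->; rewrite mul0r.
Qed.

Lemma lmulC : commutative lmul.
Proof.
move=> f g; apply: laurent_eqP => k /=; rewrite /conv.
rewrite (@fsum_reindex (fun i => k - i)) /=; last first.
  by exists (fun i => k - i) => i; rewrite subKr.
by apply: eq_fsbigr => i _; rewrite subKr mulrC.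
Qed.

Lemma lmulA : associative lmul.
Proof.
move=> f g h; apply: laurent_eqP => k.
have [a fa] := laurentP f; have [b gb] := laurentP g; have [c hc] := laurentP h.
rewrite [RHS](convE (conv_bounded fa gb) hc (lexx _) (lexx _)).
rewrite [LHS](convE fa (conv_bounded gb hc) (lexx _) (lexx _)).
have -> : \sum_(i <- irange (a + b) (k - c)) lmul f g i * h (k - i) =
  \sum_(i <- irange (a + b) (k - c))
    \sum_(j <- irange a (k - (b + c))) f j * g (i - j) * h (k - i).
  apply: eq_bigr => i _; have [ik|ki] := leP i (k - c); last first.
    rewrite hc; last by rewrite ltrBlDl -ltrBlDr.
    by rewrite mulr0 big1 // => j _; rewrite mulr0.
  rewrite /= (convE fa gb (lexx _) (_ : _ <= k - (b + c))) ?mulr_suml //.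
  by rewrite opprD addrA [k - b - c]addrAC lerD2r.
rewrite exchange_big /=; apply: eq_big_seq => j /mapP[i0 _ ji0].
have aj : a <= j by rewrite ji0 lerDl.
rewrite {1}/conv (@fsum_reindex (fun i => i - j)) /=; last first.
  by exists (fun i => i + j) => i; rewrite ?subrK ?addrK.
rewrite (@fsum_seq _ (irange (a + b) (k - c))) ?irange_uniq //.
  by rewrite mulr_sumr; apply: eq_bigr => i _; rewrite mulrA opprB addrA subrK.
move=> i /irangeN[iab|kci].
  by rewrite gb ?mul0r // ltrBlDr (lt_le_trans iab) // addrC lerD2l.
by rewrite hc ?mulr0 // opprB addrA subrK ltrBlDl -ltrBlDr.
Qed.

Lemma lmul1 : left_id (single 0 1) lmul.
Proof.
by move=> f; apply: laurent_eqP => k; rewrite lmul_single mul1r subr0.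
Qed.

Lemma lmulDl : left_distributive lmul +%R.
Proof.
move=> f g h; apply: laurent_eqP => k; rewrite lcoefD.
have [a fa] := laurentP f; have [b gb] := laurentP g; have [c hc] := laurentP h.
pose m := Order.min a b.
have fm i : i < m -> f i = 0 by rewrite lt_min => /andP[/fa].
have gm i : i < m -> g i = 0 by rewrite lt_min => /andP[_ /gb].
have fgm i : i < m -> (f + g) i = 0 by move=> im; rewrite lcoefD fm ?gm ?addr0.
rewrite [LHS](convE fgm hc (lexx _) (lexx _)).
rewrite /= (convE fm hc (lexx _) (lexx _)) (convE gm hc (lexx _) (lexx _)).
by rewrite -big_split; apply: eq_bigr => i _; exact: mulrDl.
Qed.

HB.instance Definition _ :=
  GRing.Zmodule_isComPzRing.Build laurent lmulA lmulC lmul1 lmulDl.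

End Laurent.

Section LaurentMap.
Variables (A B : comPzRingType) (u : {rmorphism A -> B}).

Lemma laurent_map_subproof (f : laurent A) :
  (fun k => u (f k)) \in @laurent_pred B.
Proof.
have [N fN] := laurentP f; apply/asboolP.
by exists N => k /fN ->; rewrite rmorph0.
Qed.

Definition laurent_map (f : laurent A) : laurent B :=
  Laurent (laurent_map_subproof f).

Lemma laurent_map_zmod : zmod_morphism laurent_map.
Proof. by move=> f g; apply: laurent_eqP => k; rewrite /= rmorphB. Qed.

Lemma laurent_map_monoid : monoid_morphism laurent_map.
Proof.
split=> [|f g]; apply: laurent_eqP => k.
  by rewrite /=; case: eqP; rewrite ?rmorph1 ?rmorph0.
have [a fa] := laurentP f; have [b gb] := laurentP g.
rewrite [LHS]/= (convE fa gb (lexx _) (lexx _)) rmorph_sum.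
rewrite [RHS](@convE _ a b a (k - b)) //.
- by apply: eq_bigr => i _; rewrite rmorphM.
- by move=> i /fa /= ->; rewrite rmorph0.
- by move=> i /gb /= ->; rewrite rmorph0.
Qed.

HB.instance Definition _ :=
  GRing.isZmodMorphism.Build (laurent A) (laurent B) laurent_map laurent_map_zmod.
HB.instance Definition _ :=
  GRing.isMonoidMorphism.Build (laurent A) (laurent B) laurent_map
    laurent_map_monoid.
End LaurentMap.

Fixpoint iterR (n : nat) (A : comPzRingType) : comPzRingType :=
  if n is k.+1 then laurent (iterR k A) else A.

(* Exponents are column vectors; the variable t_i is indexed by i - 1, so that
   the exponent of the outermost variable of [iterR n.+1 A] is at [ord_max],
   and [row' ord_max l] forgets it. *)
Fixpoint coefR (n : nat) (A : comPzRingType) : iterR n A -> 'cV[int]_n -> A :=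
  if n is k.+1
  then fun f l => @coefR k A (lcoef f (l ord_max 0)) (row' ord_max l)
  else fun f _ => f.

Fixpoint termR (n : nat) (A : comPzRingType) (c : A) : 'cV[int]_n -> iterR n A :=
  if n is k.+1 return 'cV[int]_n -> iterR n A
  then fun l => single (l ord_max 0) (@termR k A c (row' ord_max l))
  else fun _ => c.

Fixpoint iterR_map (n : nat) (A B : comPzRingType) (u : {rmorphism A -> B}) :
    {rmorphism iterR n A -> iterR n B} :=
  if n is k.+1 return {rmorphism iterR n A -> iterR n B}
  then laurent_map (@iterR_map k A B u) else u.

(* The carrier of [iterR n A], under a name to which a topology is attached. *)
Definition iterL (n : nat) (A : comPzRingType) : Type := iterR n A.
HB.instance Definition _ n A := GRing.ComPzRing.copy (iterL n A) (iterR n A).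

Definition coef n A (f : iterL n A) (l : 'cV[int]_n) : A := coefR f l.

(* The series c t^l. *)
Definition term n (A : comPzRingType) (c : A) (l : 'cV[int]_n) : iterL n A :=
  termR c l.

Definition iterL_map n (A B : comPzRingType) (u : {rmorphism A -> B}) :
  {rmorphism iterL n A -> iterL n B} := iterR_map n u.

Definition const n (A : comPzRingType) (c : A) : iterL n A := term c 0.

Definition mono n (A : comPzRingType) (l : 'cV[int]_n) : iterL n A := term 1 l.

Definition tvar n (A : comPzRingType) (i : 'I_n) : iterL n A :=
  mono A (delta_mx i 0).

Lemma coef_map n (A B : comPzRingType) (u : {rmorphism A -> B}) (f : iterL n A) l :
  coef (iterL_map n u f) l = u (coef f l).
Proof. by rewrite /coef; elim: n f l => [|n IHn] f l //=; rewrite -IHn. Qed.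

Lemma coef_inj n A (f g : iterL n A) : coef f =1 coef g -> f = g.
Proof.
rewrite /coef; elim: n f g => [|n IHn] f g fg; first exact: (fg 0).
apply: laurent_eqP => k; apply: IHn => l.
pose l' : 'cV[int]_n.+1 :=
  \col_i (if unlift ord_max i is Some j then l j 0 else k).
have := fg l'; rewrite /= mxE unlift_none.
suff -> : row' ord_max l' = l by [].
by apply/colP => j; rewrite !mxE liftK.
Qed.

Lemma coefB n A (f g : iterL n A) l : coef (f - g) l = coef f l - coef g l.
Proof. by rewrite /coef; elim: n f g l => [|n IHn] f g l //=; rewrite -IHn. Qed.

(* Lambda_0 is a point, so Lambda_1 is [(int -> unit) * int], that is, Z. *)
Fixpoint Lam (n : nat) : Type :=
  if n is k.+1 then ((int -> Lam k) * int)%type else unit.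

Fixpoint inZ (n : nat) : Lam n -> 'cV[int]_n -> Prop :=
  if n is k.+1
  then fun lam l => lam.2 <= l ord_max 0 /\
                    @inZ k (lam.1 (l ord_max 0)) (row' ord_max l)
  else fun _ _ => True.

Definition U (n : nat) (A : comPzRingType) (lam : Lam n) : set (iterL n A) :=
  [set f | forall l, inZ lam (- l) -> coef f l = 0].

Lemma U0 n (A : comPzRingType) (lam : Lam n) : U lam (0 : iterL n A).
Proof. by move=> l _; rewrite -[0]subr0 coefB subrr. Qed.

Lemma UB n (A : comPzRingType) (lam : Lam n) (f g : iterL n A) :
  U lam f -> U lam g -> U lam (f - g).
Proof. by move=> Uf Ug l lamN; rewrite coefB Uf // Ug // subr0. Qed.

Fixpoint Lam0 (n : nat) : Lam n :=
  if n is k.+1 then (fun _ => @Lam0 k, 0) else tt.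

Fixpoint LamI (n : nat) : Lam n -> Lam n -> Lam n :=
  if n is k.+1
  then fun lam mu => (fun i => @LamI k (lam.1 i) (mu.1 i), Order.min lam.2 mu.2)
  else fun _ _ => tt.

Lemma inZ_LamI n (lam mu : Lam n) l :
  inZ lam l \/ inZ mu l -> inZ (LamI lam mu) l.
Proof.
elim: n lam mu l => [|n IHn] //= lam mu l [] [le_l Zl];
  (split; [by rewrite ge_min le_l ?orbT | by apply: IHn; auto]).
Qed.

Lemma U_LamI n (A : comPzRingType) (lam mu : Lam n) :
  U (LamI lam mu) `<=` (U lam `&` U mu : set (iterL n A)).
Proof. by move=> f Uf; split=> l Zl; apply/Uf/inZ_LamI; auto. Qed.

Section IterLTopology.
Variables (n : nat) (A : comPzRingType).

Definition iterL_nbhs (x : iterL n A) : set_system (iterL n A) :=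
  filter_from [set: Lam n] (fun lam => [set y | U lam (y - x)]).

HB.instance Definition _ := hasNbhs.Build (iterL n A) iterL_nbhs.

Lemma iterL_nbhs_filter (x : iterL n A) : ProperFilter (nbhs x).
Proof.
apply: filter_from_proper => [|lam _]; last by exists x; rewrite /= subrr; apply: U0.
apply: filter_from_filter => [|lam mu _ _]; first by exists (Lam0 n).
by exists (LamI lam mu) => // y /U_LamI.
Qed.

Lemma iterL_nbhs_singleton (x : iterL n A) (S : set (iterL n A)) :
  nbhs x S -> S x.
Proof. by case=> lam _; apply; rewrite /= subrr; apply: U0. Qed.

Lemma iterL_nbhs_nbhs (x : iterL n A) (S : set (iterL n A)) :
  nbhs x S -> nbhs x (nbhs^~ S).
Proof.
case=> lam _ US; exists lam => // y Uyx; exists lam => // z Uzy.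
apply: US => /=; rewrite -[z](subrK y) -addrA -[y - x]opprK.
by apply: UB => //; rewrite -[- _]sub0r; apply: UB => //; apply: U0.
Qed.

HB.instance Definition _ := Nbhs_isNbhsTopological.Build (iterL n A)
  iterL_nbhs_filter iterL_nbhs_singleton iterL_nbhs_nbhs.

End IterLTopology.

(* [A]-linearity of a ring homomorphism is compatibility with the structure
   maps; the library's algebras exclude the zero ring. *)
Record calgHom (n m : nat) (A : comPzRingType) := CAlgHom {
  calg_fun :> iterL n A -> iterL m A;
  calg_zmod : zmod_morphism calg_fun;
  calg_monoid : monoid_morphism calg_fun;
  calg_const : forall c : A, calg_fun (const n c) = const m c;
  calg_continuous : continuous calg_fun
}.

Definition prime_ideal (A : comPzRingType) (P : set A) : Prop :=
  [/\ P 0, (forall x y, P x -> P y -> P (x + y)),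
      (forall a x, P x -> P (a * x)), ~ P 1
    & forall x y, P (x * y) -> P x \/ P y].

Record Spec (A : comPzRingType) :=
  MkSpec { spec_set :> set A; specP : prime_ideal spec_set }.
HB.instance Definition _ A := gen_eqMixin (Spec A).
HB.instance Definition _ A := gen_choiceMixin (Spec A).

Section Zariski.
Variable A : comPzRingType.

Definition zariski_open : set_system (Spec A) :=
  [set O | exists E : set A, O = [set p : Spec A | ~ (E `<=` p)]].

Lemma zariski_openT : zariski_open setT.
Proof.
exists [set 1]; apply/seteqP; split=> // p _ /(_ 1 erefl).
by case: (specP p).
Qed.

Lemma zariski_openI : setI_closed zariski_open.
Proof.
move=> _ _ [E ->] [F ->]; exists [set x * y | x in E & y in F].
apply/seteqP; split=> p /=.
  move=> [/existsNP[x /not_implyP[Ex px]] /existsNP[y /not_implyP[Fy py]]] EFp.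
  have [_ _ _ _ /(_ x y)] := specP p; case=> //.
  by apply: EFp; exists x => //; exists y.
have [_ _ pM _ _] := specP p => EFp.
split=> sub; apply: EFp => _ [x Ex [y Fy <-]]; last exact/pM/sub.
by rewrite mulrC; exact/pM/sub.
Qed.

Lemma zariski_open_bigU (I : Type) (f : I -> set (Spec A)) :
  (forall i, zariski_open (f i)) -> zariski_open (\bigcup_i f i).
Proof.
move=> /choice[E fE]; exists (\bigcup_i E i); apply/seteqP; split=> p /=.
  by case=> i _; rewrite fE /= => nE sub; apply: nE => x Ex; apply: sub; exists i.
move=> /existsNP[x /not_implyP[[i _ Eix] px]].
by exists i => //; rewrite fE /= => /(_ _ Eix).
Qed.

HB.instance Definition _ := isOpenTopological.Build (Spec A)
  zariski_openT zariski_openI zariski_open_bigU.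

End Zariski.

Section SpecMap.
Variables (A B : comPzRingType) (u : {rmorphism A -> B}).

Lemma Spec_map_subproof (q : Spec B) : prime_ideal (u @^-1` q).
Proof.
have [q0 qD qM q1 qp] := specP q; split=> [|x y|a x||x y] /=.
- by rewrite rmorph0.
- by rewrite rmorphD; apply: qD.
- by rewrite rmorphM; apply: qM.
- by rewrite rmorph1.
- by rewrite rmorphM; apply: qp.
Qed.

Definition Spec_map (q : Spec B) : Spec A := MkSpec (Spec_map_subproof q).

Lemma Spec_map_continuous : continuous Spec_map.
Proof.
apply/continuousP => _ [E ->]; exists (u @` E); apply/seteqP; split=> q /= nE sub.
  by apply: nE => x Ex; apply: sub; exists x.
by apply: nE => _ [x Ex <-]; apply: sub.
Qed.
End SpecMap.

Section LocallyConstant.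
Variable A : comPzRingType.

Definition loc_const (x : Spec A -> int) : Prop :=
  forall p, \forall q \near p, x q = x p.

Definition loc_const_pred : {pred Spec A -> int} := fun x => `[< loc_const x >].

Lemma loc_const_subring : subring_closed loc_const_pred.
Proof.
split=> [|x y /asboolP xl /asboolP yl|x y /asboolP xl /asboolP yl];
  apply/asboolP => p; first exact: filterE.
- move: (xl p) (yl p); apply: filterS2 => q xq yq.
  by rewrite opprfctE addrfctE xq yq.
- move: (xl p) (yl p); apply: filterS2 => q xq yq.
  by rewrite mulrfctE xq yq.
Qed.

Record uZ := UZ { uZ_fun :> Spec A -> int; _ : uZ_fun \in loc_const_pred }.
HB.instance Definition _ := [isSub for uZ_fun].
HB.instance Definition _ := [Choice of uZ by <:].
HB.instance Definition _ :=
  GRing.SubChoice_isSubComPzRing.Build (Spec A -> int) loc_const_pred uZ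
    loc_const_subring.
End LocallyConstant.

Section UZMap.
Variables (A B : comPzRingType) (u : {rmorphism A -> B}).

Lemma uZ_map_subproof (x : uZ A) :
  (fun q => x (Spec_map u q)) \in @loc_const_pred B.
Proof.
have /asboolP xl := valP x.
by apply/asboolP => q; exact: (Spec_map_continuous (xl (Spec_map u q))).
Qed.

Definition uZ_map (x : uZ A) : uZ B := UZ (uZ_map_subproof x).
End UZMap.

Definition mx_at (A : comPzRingType) m n (X : 'M[uZ A]_(m, n)) (p : Spec A) :
  'M[int]_(m, n) := map_mx (fun x : uZ A => x p) X.















Fixpoint lexle (n : nat) : 'cV[int]_n -> 'cV[int]_n -> Prop :=
  if n is k.+1
  then fun l l' => l ord_max 0 < l' ord_max 0 \/
    (l ord_max 0 = l' ord_max 0 /\ @lexle k (row' ord_max l) (row' ord_max l'))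
  else fun _ _ => True.

Definition lexlt n (l l' : 'cV[int]_n) : Prop := lexle l l' /\ l <> l'.

Definition nilpotent (A : comPzRingType) (a : A) : Prop := exists k, a ^+ k = 0.

Definition invertible (A : comPzRingType) (a : A) : Prop := exists b, b * a = 1.

Record decomposition (A : comPzRingType) := Decomposition {
  dec_size : nat;
  dec_ring : 'I_dec_size -> comPzRingType;
  dec_proj : forall i, {rmorphism A -> dec_ring i};
  dec_bij : bijective (fun a i => dec_proj i a)
}.
Arguments dec_ring {A} D i : rename.
Arguments dec_proj {A} D i : rename.

Definition has_nu n (A : comPzRingType) (f : iterL n A) (v : 'cV[uZ A]_n) :=
  exists (D : decomposition A) (l : 'I_(dec_size D) -> 'cV[int]_n), forall i,
    let fi := iterL_map n (dec_proj D i) f in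
    [/\ forall l', lexlt l' (l i) -> nilpotent (coef fi l'),
        invertible (coef fi (l i))
      & forall q, mx_at v (Spec_map (dec_proj D i) q) = l i].

(* For invertible f there is exactly one v as in [has_nu], so that the default
   value 0 is irrelevant; uniqueness is [has_nu_uniq] below. *)
Definition nu n (A : comPzRingType) (f : iterL n A) : 'cV[uZ A]_n :=
  xget 0 [set v | has_nu f v].

Definition is_monoZ n (A : comPzRingType) (v : 'cV[uZ A]_n) (g : iterL n A) :=
  exists (D : decomposition A) (l : 'I_(dec_size D) -> 'cV[int]_n), forall i,
    iterL_map n (dec_proj D i) g = mono _ (l i) /\
    forall q, mx_at v (Spec_map (dec_proj D i) q) = l i.

(* The monomial t^v. Its defining property determines it, and it exists because
   v is constant on the factors of some decomposition of A. *)
Definition monoZ n (A : comPzRingType) (v : 'cV[uZ A]_n) : iterL n A :=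
  xget 0 [set g | is_monoZ v g].

Section DecIdempotents.
Variables (A : comPzRingType) (D : decomposition A).

Lemma dec_inj (a b : A) : (forall i, dec_proj D i a = dec_proj D i b) -> a = b.
Proof. by move=> ab; apply: (bij_inj (dec_bij D)); apply: functional_extensionality_dep. Qed.

Lemma dec_lift_subproof i (x : dec_ring D i) : exists a : A,
  dec_proj D i a = x /\ forall j, j != i -> dec_proj D j a = 0.
Proof.
have [g _ gK] := dec_bij D.
pose z := eqtype.dfwith (fun j => 0 : dec_ring D j) x.
have zE j : dec_proj D j (g z) = z j by rewrite -[in RHS](gK z).
exists (g z); split=> [|j ji]; rewrite zE /z; first by rewrite dfwith_in.
by rewrite dfwith_out // eq_sym.
Qed.

Definition dec_lift i (x : dec_ring D i) : A :=
  proj1_sig (cid (dec_lift_subproof x)).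

Lemma dec_liftK i (x : dec_ring D i) : dec_proj D i (dec_lift x) = x.
Proof. by case: (proj2_sig (cid (dec_lift_subproof x))). Qed.

Lemma dec_lift0 i (x : dec_ring D i) j : j != i -> dec_proj D j (dec_lift x) = 0.
Proof. by move=> ji; case: (proj2_sig (cid (dec_lift_subproof x))) => _; apply. Qed.

Lemma dec_liftP i (x : dec_ring D i) a : dec_proj D i a = x ->
  (forall j, j != i -> dec_proj D j a = 0) -> a = dec_lift x.
Proof.
move=> ax a0; apply: dec_inj => j; have [->|ji] := eqVneq j i.
  by rewrite dec_liftK.
by rewrite a0 ?dec_lift0.
Qed.

Lemma dec_liftB i : {morph @dec_lift i : x y / x - y}.
Proof.
move=> x y; symmetry; apply: dec_liftP => [|j ji]; rewrite rmorphB ?dec_liftK //.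
by rewrite !dec_lift0 ?subr0.
Qed.

Lemma dec_liftD i : {morph @dec_lift i : x y / x + y}.
Proof.
move=> x y; symmetry; apply: dec_liftP => [|j ji]; rewrite rmorphD ?dec_liftK //.
by rewrite !dec_lift0 ?addr0.
Qed.

Lemma dec_liftM i : {morph @dec_lift i : x y / x * y}.
Proof.
move=> x y; symmetry; apply: dec_liftP => [|j ji]; rewrite rmorphM ?dec_liftK //.
by rewrite !dec_lift0 ?mul0r.
Qed.

Definition dec_idem i : A := dec_lift (1 : dec_ring D i).

Lemma dec_idemK i : dec_idem i * dec_idem i = dec_idem i.
Proof. by rewrite -dec_liftM mulr1. Qed.

Lemma dec_idem_lift i (a : A) :
  a * dec_idem i = dec_lift (dec_proj D i a).
Proof.
apply: dec_liftP => [|j ji]; rewrite rmorphM ?dec_liftK ?mulr1 //.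
by rewrite dec_lift0 ?mulr0.
Qed.

Lemma dec_idem_orth i j : i != j -> dec_idem i * dec_idem j = 0.
Proof.
move=> ij; rewrite dec_idem_lift /dec_idem dec_lift0 1?eq_sym //.
by symmetry; apply: dec_liftP => [|k _]; rewrite rmorph0.
Qed.

Lemma dec_idem_sum : \sum_i dec_idem i = 1.
Proof.
apply: dec_inj => i; rewrite rmorph_sum rmorph1 (bigD1 i) //= dec_liftK.
by rewrite big1 ?addr0 // => j ji; rewrite dec_lift0 // eq_sym.
Qed.
End DecIdempotents.
Arguments dec_idem {A} D i.

(* [corner ee] is the ring e B, with unit e. *)
Section Corner.
Variables (B : comPzRingType) (e : B).

Definition corner_pred (_ : e * e = e) : {pred B} := fun b => b * e == b.

Hypothesis ee : e * e = e.

Lemma corner_zmod_closed : zmod_closed (corner_pred ee).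
Proof.
split=> [|x y /eqP xe /eqP ye]; apply/eqP; first by rewrite mul0r.
by rewrite mulrBl xe ye.
Qed.
HB.instance Definition _ :=
  GRing.isZmodClosed.Build B (corner_pred ee) corner_zmod_closed.

Record corner := Corner { corner_val : B; _ : corner_val \in corner_pred ee }.
HB.instance Definition _ := [isSub for corner_val].
HB.instance Definition _ := [Choice of corner by <:].
HB.instance Definition _ := [SubChoice_isSubZmodule of corner by <:].

Lemma corner_valP (x : corner) : corner_val x * e = corner_val x.
Proof. exact/eqP/(valP x). Qed.

Lemma corner_inj : injective corner_val.
Proof. exact: val_inj. Qed.

Lemma corner_mulP (b : B) : b * e \in corner_pred ee.
Proof. by apply/eqP; rewrite -mulrA ee. Qed.

Definition corner_of (b : B) : corner := Corner (corner_mulP b).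
Definition corner_mul (x y : corner) := corner_of (corner_val x * corner_val y).

Lemma corner_mulE x y :
  corner_val (corner_mul x y) = corner_val x * corner_val y.
Proof. by rewrite /= -mulrA corner_valP. Qed.

Lemma corner_mulA : associative corner_mul.
Proof. by move=> x y z; apply: corner_inj; rewrite !corner_mulE mulrA. Qed.
Lemma corner_mulC : commutative corner_mul.
Proof. by move=> x y; apply: corner_inj; rewrite !corner_mulE mulrC. Qed.
Lemma corner_mul1 : left_id (corner_of 1) corner_mul.
Proof.
by move=> x; apply: corner_inj; rewrite corner_mulE /= mul1r mulrC corner_valP.
Qed.
Lemma corner_mulDl : left_distributive corner_mul +%R.
Proof. by move=> x y z; apply: corner_inj; rewrite /= mulrDl mulrDl. Qed.
HB.instance Definition _ := GRing.Zmodule_isComPzRing.Build corner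
  corner_mulA corner_mulC corner_mul1 corner_mulDl.

Lemma corner_of_zmod : zmod_morphism corner_of.
Proof. by move=> x y; apply: corner_inj; rewrite /= mulrBl. Qed.
Lemma corner_of_monoid : monoid_morphism corner_of.
Proof.
split=> [|x y]; apply: corner_inj => //=.
by rewrite [x * e * _]mulrACA ee -(mulrA (x * y) e) ee.
Qed.
HB.instance Definition _ :=
  GRing.isZmodMorphism.Build B corner corner_of corner_of_zmod.
HB.instance Definition _ :=
  GRing.isMonoidMorphism.Build B corner corner_of corner_of_monoid.
End Corner.

Section DecBaseChange.
Variables (A B : comPzRingType) (u : {rmorphism A -> B}) (D : decomposition A).

Let e i : B := u (dec_idem D i).

Lemma dec_bc_idem i : e i * e i = e i.
Proof. by rewrite /e -rmorphM dec_idemK. Qed.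

Let R i : comPzRingType := corner (dec_bc_idem i).
Let pr i : {rmorphism B -> R i} := corner_of (dec_bc_idem i).

Lemma dec_bc_bij : bijective (fun b i => pr i b).
Proof.
exists (fun x => \sum_i corner_val (x i)) => [b|x].
  by rewrite -mulr_sumr -rmorph_sum dec_idem_sum rmorph1 mulr1.
apply: functional_extensionality_dep => i; apply: corner_inj => /=.
rewrite mulr_suml (bigD1 i) //= corner_valP big1 ?addr0 // => j ji.
by rewrite -[X in X * _]corner_valP -mulrA -rmorphM dec_idem_orth // rmorph0 mulr0.
Qed.

Definition dec_bc : decomposition B := Decomposition dec_bc_bij.

Definition dec_bc_map i (x : dec_ring D i) : R i := pr i (u (dec_lift x)).

Lemma dec_bc_map_zmod i : zmod_morphism (@dec_bc_map i).
Proof. by move=> x y; rewrite /dec_bc_map dec_liftB !rmorphB. Qed.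
Lemma dec_bc_map_monoid i : monoid_morphism (@dec_bc_map i).
Proof.
split=> [|x y]; rewrite /dec_bc_map ?dec_liftM ?rmorphM //.
by apply: corner_inj; rewrite /= mul1r -/(dec_idem D i) dec_bc_idem.
Qed.
HB.instance Definition _ i := GRing.isZmodMorphism.Build (dec_ring D i) (R i)
  (@dec_bc_map i) (@dec_bc_map_zmod i).
HB.instance Definition _ i := GRing.isMonoidMorphism.Build (dec_ring D i) (R i)
  (@dec_bc_map i) (@dec_bc_map_monoid i).

Lemma dec_bcE i (a : A) :
  dec_proj dec_bc i (u a) = dec_bc_map (dec_proj D i a).
Proof.
apply: corner_inj; rewrite /= -dec_idem_lift rmorphM.
by rewrite -mulrA dec_bc_idem.
Qed.
End DecBaseChange.

Lemma Spec_eqP (A : comPzRingType) (p q : Spec A) : p = q :> set A -> p = q.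
Proof.
case: p q => P hP [Q hQ] /= PQ; case: Q / PQ hQ => hQ.
by congr MkSpec; exact: Prop_irrelevance.
Qed.

Lemma has_nu_map n (A B : comPzRingType) (u : {rmorphism A -> B})
    (f : iterL n A) (v : 'cV[uZ A]_n) :
  has_nu f v -> has_nu (iterL_map n u f) (map_mx (uZ_map u) v).
Proof.
case=> D [l fl]; exists (dec_bc u D), l => i /=; have [fnil finv fv] := fl i.
have cE l' : coef (iterL_map n (dec_proj (dec_bc u D) i) (iterL_map n u f)) l' =
    dec_bc_map u (coef (iterL_map n (dec_proj D i) f) l').
  by rewrite !coef_map dec_bcE.
split=> [l' /fnil[k fk]||q].
- by exists k; rewrite cE -rmorphXn fk rmorph0.
- have [b bf] := finv; exists (dec_bc_map u b).
  by rewrite cE -rmorphM bf rmorph1.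
rewrite -(fv (Spec_map (dec_bc_map u (i := i)) q)).
apply/matrixP => j k; rewrite !mxE /=; congr (v j k _).
apply: Spec_eqP; apply/seteqP.
by split=> a /=; rewrite -/(dec_proj (dec_bc u D) i) dec_bcE.
Qed.

Section SpecDec.
Variables (A : comPzRingType) (D : decomposition A) (p : Spec A).

Lemma dec_idemNp : exists i, ~ spec_set p (dec_idem D i).
Proof.
have [p0 pD _ p1 _] := specP p; apply/existsNP => pe; apply: p1.
by rewrite -(dec_idem_sum D); elim/big_ind: _ => // i _.
Qed.

Lemma Spec_dec : exists i q, Spec_map (dec_proj D i) q = p.
Proof.
have [i pe] := dec_idemNp; have [p0 pD pM p1 pp] := specP p.
suff qp : prime_ideal [set x : dec_ring D i | spec_set p (dec_lift x)].
  exists i, (MkSpec qp); apply: Spec_eqP; apply/seteqP.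
  split=> a /=; rewrite -dec_idem_lift; first by case/pp.
  by rewrite mulrC; apply: pM.
split=> [|x y|a x||x y] //=.
- by rewrite -[0]subr0 dec_liftB subrr.
- by rewrite dec_liftD; apply: pD.
- by rewrite dec_liftM; apply: pM.
- by rewrite dec_liftM; apply: pp.
Qed.
End SpecDec.

Lemma has_nu_at n (A : comPzRingType) (f : iterL n A) (v : 'cV[uZ A]_n) p :
  has_nu f v -> ~ spec_set p (coef f (mx_at v p)) /\
  forall l, lexlt l (mx_at v p) -> spec_set p (coef f l).
Proof.
case=> D [l fl]; have [i [q <-]] := Spec_dec D p.
have [fnil [b bf] ->] := fl i; have [q0 qD qM q1 qp] := specP q.
split=> [|l' /fnil[k ck]] /=; rewrite -coef_map.
  by move=> /(qM b); rewrite bf.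
have : spec_set q (coef (iterL_map n (dec_proj D i) f) l' ^+ k) by rewrite ck.
elim: {ck} k => [|k IHk]; first by rewrite expr0 => /q1.
by rewrite exprS => /qp[].
Qed.

Lemma lexle_total n (l l' : 'cV[int]_n) : lexle l l' \/ lexle l' l.
Proof.
elim: n l l' => [|n IHn] l l' /=; first by left.
case: (ltgtP (l ord_max 0) (l' ord_max 0)) => [|| e]; [by auto | by auto |].
by case: (IHn (row' ord_max l) (row' ord_max l')) => h; [left | right]; right.
Qed.

Lemma has_nu_uniq n (A : comPzRingType) (f : iterL n A) (v w : 'cV[uZ A]_n) :
  has_nu f v -> has_nu f w -> v = w.
Proof.
move=> fv fw; suff vw p : mx_at v p = mx_at w p.
  apply/matrixP => j k; apply: val_inj; apply: funext => p.
  by have /matrixP/(_ j k) := vw p; rewrite !mxE.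
have [vN vlt] := has_nu_at p fv; have [wN wlt] := has_nu_at p fw.
apply: contrapT => vw; case: (lexle_total (mx_at v p) (mx_at w p)) => le.
  by apply/vN/wlt; split.
by apply/wN/vlt; split=> // wv; apply: vw.
Qed.

Record functor_on (F : comPzRingType -> Type) := FunctorOn {
  fmap : forall A B : comPzRingType, {rmorphism A -> B} -> F A -> F B;
  fmap_id : forall A (x : F A), fmap (idfun : {rmorphism A -> A}) x = x;
  fmap_comp : forall (A B C : comPzRingType) (u : {rmorphism A -> B}) (w : {rmorphism B -> C}) x,
    fmap (w \o u : {rmorphism A -> C}) x = fmap w (fmap u x)
}.

Record ring_functor := RingFunctor {
  fobj :> comPzRingType -> Type;
  fstr : functor_on fobj
}.

Definition natural (F G : ring_functor) (eta : forall A, F A -> G A) : Prop :=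
  forall (A B : comPzRingType) (u : {rmorphism A -> B}) (x : F A),
    eta B (fmap (fstr F) u x) = fmap (fstr G) u (eta A x).

Definition nat_iso (F G : ring_functor) (eta : forall A, F A -> G A) : Prop :=
  natural eta /\ forall A, bijective (eta A).

Definition prodF_on (F G : ring_functor) : functor_on (fun A => F A * G A)%type.
Proof.
exists (fun A B u x => (fmap (fstr F) u x.1, fmap (fstr G) u x.2)).
- by move=> A [x y]; rewrite !fmap_id.
- by move=> A B C u w [x y]; rewrite !fmap_comp.
Defined.
Definition prodF (F G : ring_functor) := RingFunctor (prodF_on F G).

Definition powF_on (n : nat) (F : ring_functor) : functor_on (fun A => 'I_n -> F A).
Proof.
exists (fun A B u x i => fmap (fstr F) u (x i)).
- by move=> A x; apply: funext => i; rewrite fmap_id.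
- by move=> A B C u w x; apply: funext => i; rewrite fmap_comp.
Defined.
Definition powF (n : nat) (F : ring_functor) := RingFunctor (powF_on n F).

(* A formal filtered direct limit of the affine schemes Spec (ind_ring i),
   indexed by a directed preorder. *)
Record indAffine := IndAffine {
  ind_idx : Type;
  ind_le : ind_idx -> ind_idx -> Prop;
  ind_refl : forall i, ind_le i i;
  ind_trans : forall i j k, ind_le i j -> ind_le j k -> ind_le i k;
  ind_inhabited : inhabited ind_idx;
  ind_directed : forall i j, exists k, ind_le i k /\ ind_le j k;
  ind_ring : ind_idx -> comPzRingType;
  ind_tr : forall i j, ind_le i j -> {rmorphism ind_ring j -> ind_ring i};
  ind_tr_id : forall i (h : ind_le i i) r, ind_tr h r = r;
  ind_tr_comp : forall i j k (hij : ind_le i j) (hjk : ind_le j k)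
    (hik : ind_le i k) r, ind_tr hij (ind_tr hjk r) = ind_tr hik r
}.
Arguments ind_tr X {i j} h : rename.

Section IndPoints.
Variable X : indAffine.

Definition pre_pt (A : comPzRingType) := {i : ind_idx X & {rmorphism ind_ring i -> A}}.

Definition pt_eq (A : comPzRingType) (x y : pre_pt A) : Prop :=
  exists k (hx : ind_le (tag x) k) (hy : ind_le (tag y) k),
    forall r, tagged x (ind_tr X hx r) = tagged y (ind_tr X hy r).

Lemma pt_eq_refl A (x : pre_pt A) : pt_eq x x.
Proof. by exists (tag x), (ind_refl _), (ind_refl _). Qed.

Lemma pt_eq_sym A (x y : pre_pt A) : pt_eq x y -> pt_eq y x.
Proof. by case=> k [hx [hy xy]]; exists k, hy, hx => r; rewrite xy. Qed.

Lemma pt_eq_trans A (x y z : pre_pt A) : pt_eq x y -> pt_eq y z -> pt_eq x z.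
Proof.
case=> k [hx [hy xy]] [k' [hy' [hz yz]]].
have [m [km k'm]] := ind_directed k k'.
have xm := ind_trans hx km; have zm := ind_trans hz k'm.
exists m, xm, zm => r.
rewrite -(ind_tr_comp hx km xm) -(ind_tr_comp hz k'm zm) xy -yz.
by rewrite !(ind_tr_comp _ _ (ind_trans hy km)).
Qed.

(* The filtered colimit of the sets Hom (ind_ring i, A), as the set of
   equivalence classes of [pt_eq]. *)
Record pts (A : comPzRingType) := Pts {
  pts_class : set (pre_pt A);
  pts_classP : exists x, pts_class = pt_eq x
}.

Lemma pts_eqP A (x y : pts A) : pts_class x = pts_class y -> x = y.
Proof.
case: x y => c hc [d hd] /= cd; case: d / cd hd => hd.
by congr Pts; exact: Prop_irrelevance.
Qed.

Definition pre_pt_map (A B : comPzRingType) (u : {rmorphism A -> B})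
    (x : pre_pt A) : pre_pt B :=
  Tagged (fun i => {rmorphism ind_ring i -> B}) (u \o tagged x : {rmorphism _ -> _}).

Lemma pts_map_subproof (A B : comPzRingType) (u : {rmorphism A -> B}) (c : pts A) :
  exists x, [set y | exists2 z, pts_class c z & pt_eq (pre_pt_map u z) y] = pt_eq x.
Proof.
have [x ->] := pts_classP c; exists (pre_pt_map u x); apply/seteqP; split=> y /=.
  case=> z [k [hx [hz xz]]]; apply: pt_eq_trans.
  by exists k, hx, hz => r; rewrite /= xz.
by move=> xy; exists x => //; apply: pt_eq_refl.
Qed.

Definition pts_map (A B : comPzRingType) (u : {rmorphism A -> B}) (c : pts A) :=
  Pts (pts_map_subproof u c).

Definition pts_on : functor_on pts.
Proof.
exists pts_map.
- move=> A [c hc]; apply: pts_eqP; case: hc => x /= ->.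
  apply/seteqP; split=> y /=.
    by case=> z xz zy; apply: pt_eq_trans xz _; case: zy => k [hz [hy zy]]; exists k, hz, hy.
  by move=> xy; exists x; [exact: pt_eq_refl | case: xy => k [hx [hy xy]]; exists k, hx, hy].
- move=> A B C u w [c hc]; apply: pts_eqP => /=; apply/seteqP; split=> y /=.
    case=> z cz zy; exists (pre_pt_map u z); first by exists z => //; apply: pt_eq_refl.
    by case: zy => k [hz [hy zy]]; exists k, hz, hy.
  case=> z' [z cz [k [hz [hz' zz']]]] zy; exists z => //.
  apply: pt_eq_trans zy; exists k, hz, hz' => r.
  by have /= := zz' r; move=> ->.
Defined.

Definition pts_functor := RingFunctor pts_on.
End IndPoints.

Definition represents (X : indAffine) (F : ring_functor) : Prop :=
  exists eta : forall A, pts X A -> F A, @nat_iso (pts_functor X) F eta.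

Definition echelon m n (X : 'M[int]_(m, n)) : Prop :=
  exists p : 'I_n -> 'I_m, (forall i i' : 'I_n, (i < i')%N -> (p i < p i')%N) /\
    forall i, 0 < X (p i) i /\ forall j : 'I_m, (p i < j)%N -> X j i = 0.

Record Mplus m n (A : comPzRingType) := MkMplus {
  Mplus_mx : 'M[uZ A]_(m, n);
  MplusP : forall p, echelon (mx_at Mplus_mx p)
}.

Lemma Mplus_eqP m n A (X Y : Mplus m n A) : Mplus_mx X = Mplus_mx Y -> X = Y.
Proof.
case: X Y => X hX [Y hY] /= XY; case: Y / XY hY => hY.
by congr MkMplus; exact: Prop_irrelevance.
Qed.

Lemma Mplus_map_subproof m n (A B : comPzRingType) (u : {rmorphism A -> B})
  (X : Mplus m n A) q : echelon (mx_at (map_mx (uZ_map u) (Mplus_mx X)) q).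
Proof.
suff -> : mx_at (map_mx (uZ_map u) (Mplus_mx X)) q = mx_at (Mplus_mx X) (Spec_map u q) by apply: MplusP.
by apply/matrixP => i j; rewrite !mxE.
Qed.

Definition Mplus_on m n : functor_on (Mplus m n).
Proof.
exists (fun A B u X => MkMplus (Mplus_map_subproof u X)).
- move=> A X; apply/Mplus_eqP/matrixP => i j; rewrite mxE; apply: val_inj.
  by apply: funext => p /=; congr (Mplus_mx X i j _); apply: Spec_eqP.
- move=> A B C u w X; apply/Mplus_eqP/matrixP => i j; rewrite !mxE; apply: val_inj.
  by apply: funext => p /=; congr (Mplus_mx X i j _); apply: Spec_eqP.
Defined.
Definition MplusF m n := RingFunctor (Mplus_on m n).

(* The kernel of nu on invertible series: by [has_nu_uniq], [has_nu f 0] says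
   that nu is defined at f with value 0. *)
Record LGm0 m (A : comPzRingType) := MkLGm0 {
  LGm0_val : iterL m A;
  LGm0_inv : invertible LGm0_val;
  LGm0_nu : has_nu LGm0_val 0
}.

Lemma LGm0_eqP m A (f g : LGm0 m A) : LGm0_val f = LGm0_val g -> f = g.
Proof.
case: f g => f f1 f2 [g g1 g2] /= fg; case: g / fg g1 g2 => g1 g2.
by congr MkLGm0; exact: Prop_irrelevance.
Qed.

Lemma LGm0_map_inv m (A B : comPzRingType) (u : {rmorphism A -> B}) (f : LGm0 m A) :
  invertible (iterL_map m u (LGm0_val f)).
Proof.
by have [g gf] := LGm0_inv f; exists (iterL_map m u g); rewrite -rmorphM gf rmorph1.
Qed.

Lemma LGm0_map_nu m (A B : comPzRingType) (u : {rmorphism A -> B}) (f : LGm0 m A) :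
  has_nu (iterL_map m u (LGm0_val f)) 0.
Proof.
have := has_nu_map u (LGm0_nu f); congr has_nu.
by apply/matrixP => i j; rewrite !mxE; apply: val_inj.
Qed.

Definition LGm0_on m : functor_on (LGm0 m).
Proof.
exists (fun A B u f => MkLGm0 (LGm0_map_inv u f) (LGm0_map_nu u f)).
- by move=> A f; apply/LGm0_eqP/coef_inj => l; rewrite coef_map.
- by move=> A B C u w f; apply/LGm0_eqP/coef_inj => l; rewrite !coef_map.
Defined.
Definition LGm0F m := RingFunctor (LGm0_on m).

Definition Upsilon m n A (phi : calgHom n m A) : 'M[uZ A]_(m, n) :=
  \matrix_(j, i) nu (phi (tvar A i)) j 0.

Definition angular m n A (phi : calgHom n m A) (i : 'I_n) : iterL m A :=
  phi (tvar A i) * monoZ (- nu (phi (tvar A i))).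

Definition base_change m n (A B : comPzRingType) (u : {rmorphism A -> B})
    (phi : calgHom n m A) (psi : calgHom n m B) : Prop :=
  forall i, psi (tvar B i) = iterL_map m u (phi (tvar A i)).

Definition targetF m n : ring_functor :=
  prodF (MplusF m n) (powF n (LGm0F m)).

(* Main.v *)
From HB Require Import structures.
From mathcomp Require Import all_boot all_order all_algebra.
From mathcomp Require Import all_classical.
From mathcomp Require Import topology_structure.
From mathcomp Require Import zify ring.
Require Import Defs.

Set Implicit Arguments.
Unset Strict Implicit.
Unset Printing Implicit Defensive.

Import Order.TTheory GRing.Theory Num.Theory.
Local Open Scope classical_set_scope.
Local Open Scope ring_scope.

(* A continuous homomorphism phi from L^n to L^m is determined by the phi(t_i),
   because Laurent polynomials are dense.  Powers of a monomial t^e with e > 0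
   tend to 0, and so do those of phi(t^e); at each prime of A the leading
   exponents of the phi(t_i) therefore define a strictly increasing map of
   lexicographically ordered groups, which is the echelon condition.

   Conversely let f_1, ..., f_n be invertible with echelon nu.  The substitution
   t_i := f_i makes sense once the monomials f^l tend to 0 and have controlled
   supports.  After splitting A this is proved by induction on m: if no leading
   exponent involves t_m, then f_i is its coefficient at t_m^0 times a factor
   whose powers stay in a set on which multiplication is uniformly continuous;
   otherwise only f_n involves t_m, its powers tend to infinity in t_m, and n
   decreases.  Multiplicativity of the substitution follows by density, since
   multiplication in L^m is separately continuous.

   For an invertible f, the leading exponent at a prime p is locally constant in
   p, because f g = 1 forces a_l b_(-l) = 1 modulo p for the leading l; quasi-
   compactness of the spectrum then yields the decomposition of A. *)

(** * Primes, idempotents and decompositions *)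

(** The induction on m passes from A to the ring L^(m-1)(A), whose primes are not controlled by
    those of A and in which a series with nilpotent coefficients need not be nilpotent. Facts known
    at the primes of A have to be lifted there; the bridge is that idempotents of L^n(A) are
    constants, so that every decomposition of L^n(A) comes from A.

    The bounds in Lambda_n depend arbitrarily on the outermost exponent, and only finitely many of
    them can be merged. Each estimate therefore arranges that a given degree sees finitely many
    outermost exponents.

    For the representing ind-scheme no explicit rings are written down. A point of the target is
    coded by a family of ring elements; once the matrices, the supports and the nilpotency exponents
    are bounded, the remaining conditions are equations. Their universal solution lives in the ring
    of formal ring terms modulo agreement at all solutions, and the limit is taken over the
    bounds. *)

Section Primes.
Variable A : comPzRingType.
Implicit Types (I : set A) (p : Spec A).

Definition ideal I : Prop :=
  [/\ I 0, forall x y, I x -> I y -> I (x + y) & forall a x, I x -> I (a * x)].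

Lemma ideal_sum I (T : Type) (s : seq T) (P : pred T) (F : T -> A) : ideal I ->
  (forall i, P i -> I (F i)) -> I (\sum_(i <- s | P i) F i).
Proof. by case=> I0 ID _ IF; elim/big_ind: _. Qed.

Lemma idealB I x y : ideal I -> I x -> I y -> I (x - y).
Proof. by case=> _ ID IM Ix Iy; apply: ID => //; rewrite -mulN1r; apply: IM. Qed.

Lemma ideal_spec p : ideal p.
Proof. by case: (specP p). Qed.

Lemma spec_exp p x k : spec_set p (x ^+ k) -> spec_set p x.
Proof.
have [_ _ _ p1 pp] := specP p.
by elim: k => [|k IHk]; rewrite ?expr0 // exprS => /pp[].
Qed.

(** An ideal that is maximal among those containing [I] and missing all powers of [a] is prime.
    Zorn's lemma is applied to the sets whose union with [I] is such an ideal, so that the empty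
    chain is bounded by [I] itself. *)
Lemma prime_avoiding I (a : A) : ideal I -> (forall k, ~ I (a ^+ k)) ->
  exists p, I `<=` p /\ forall k, ~ spec_set p (a ^+ k).
Proof.
move=> idI aI; pose good (J : set A) := ideal J /\ forall k, ~ J (a ^+ k).
have [F FP Ftot|M [[idM aM] Mmax]] := @Zorn_bigcup A [set B | good (I `|` B)].
  have [F0|/set0P[B0 FB0]] := eqVneq F set0.
    by rewrite F0 bigcup_set0 /= setU0.
  have cover (x : A) : (I `|` \bigcup_(X in F) X) x -> exists2 B, F B & (I `|` B) x.
    by case=> [Ix|[B FB Bx]]; [exists B0 => //; left | exists B => //; right].
  have in_cover (B : set A) : F B -> I `|` B `<=` I `|` \bigcup_(X in F) X.
    by move=> FB x [Ix|Bx]; [left | right; exists B].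
  split; last by move=> k /cover[B /FP[_ aB] /aB].
  have [I0 _ _] := idI; split=> [|x y|b x]; first by left.
    move=> /cover[B FB Bx] /cover[C FC Cy].
    have [BC|CB] := Ftot _ _ FB FC.
      have [[_ CD _] _] := FP _ FC; apply: (in_cover _ FC); apply: CD => //.
      by case: Bx => [Ix|/BC Cx]; [left | right].
    have [[_ BD _] _] := FP _ FB; apply: (in_cover _ FB); apply: BD => //.
    by case: Cy => [Iy|/CB By]; [left | right].
  move=> /cover[B FB Bx]; have [[_ _ BM] _] := FP _ FB.
  exact/(in_cover _ FB)/BM.
pose N := I `|` M; have [N0 ND NM] := idM.
(* By maximality, [N] and an element outside it generate an ideal that meets the powers of [a]; the
   product of two such relations contradicts [aM]. *)
have adjoin x : ~ N x -> exists k m b, N m /\ a ^+ k = m + b * x.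
  move=> Nx; apply: contrapT => no.
  pose M' := [set y | exists m b, N m /\ y = m + b * x].
  have NM' : N `<=` M' by move=> y Ny; exists y, 0; rewrite mul0r addr0.
  apply: (Mmax M').
    split=> [y My|M'M]; first by apply: NM'; right.
    by apply: Nx; right; apply: M'M; exists 0, 1; rewrite add0r mul1r.
  suff : good M'.
    suff {1}-> : M' = I `|` M' by [].
    by rewrite setUidr // => y Iy; apply: NM'; left.
  split; last by move=> k [m [b [Nm ak]]]; apply: no; exists k, m, b.
  split=> [|y z [m [b [Nm ->]]] [m' [b' [Nm' ->]]]|c y [m [b [Nm ->]]]].
  - exact/NM'.
  - by exists (m + m'), (b + b'); split; [exact: ND | rewrite mulrDl addrACA].
  - by exists (c * m), (c * b); split; [exact: NM | rewrite mulrDr mulrA].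
have pN : prime_ideal N.
  split=> // [N1|x y Nxy]; first by apply: (aM 0); rewrite expr0.
  apply: contrapT => /not_orP[/adjoin[k [m [b [Nm ak]]]] /adjoin[k' [m' [b' [Nm' ak']]]]].
  apply: (aM (k + k')); rewrite exprD ak ak' mulrDl; apply: (ND).
    by rewrite mulrC; apply: NM.
  rewrite mulrDr; apply: ND; first exact: NM.
  by rewrite mulrACA; apply: NM.
by exists (MkSpec pN); split=> // x Ix; left.
Qed.

Lemma prime_containing I : ideal I -> ~ I 1 -> exists p, I `<=` p.
Proof.
move=> idI I1; have [|p [Ip _]] := @prime_avoiding I 1 idI; last by exists p.
by move=> k; rewrite expr1n.
Qed.

Lemma nilpotentP (a : A) : nilpotent a <-> forall p, spec_set p a.
Proof.
split=> [[k ak] p|pa].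
  by apply: (@spec_exp p a k); rewrite ak; case: (specP p).
apply: contrapT => na; have [||p [_ /(_ 1)]] := @prime_avoiding [set 0] a.
- by split=> [//|x y -> ->|b x ->]; rewrite /= ?addr0 ?mulr0.
- by move=> k ak; apply: na; exists k.
- by rewrite expr1; apply; apply: pa.
Qed.

Lemma invertibleP (a : A) : invertible a <-> forall p, ~ spec_set p a.
Proof.
split=> [[b ba] p pa|pa].
  by have [_ _ pM p1 _] := specP p; apply: p1; rewrite -ba; apply: pM.
apply: contrapT => na; have [||p pI] := @prime_containing [set y | exists b, y = b * a].
- split=> [|x y [b ->] [c ->]|b x [c ->]]; first by exists 0; rewrite mul0r.
    by exists (b + c); rewrite mulrDl.
  by exists (b * c); rewrite mulrA.
- by move=> [b ba]; apply: na; exists b.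
- by apply: (pa p); apply: pI; exists 1; rewrite mul1r.
Qed.

Lemma no_prime_trivial : (forall p : Spec A, False) -> forall x y : A, x = y.
Proof.
move=> no x y; have [k] : nilpotent (1 : A) by apply/nilpotentP => p; case: (no p).
by rewrite expr1n => A1; rewrite -[x]mul1r A1 -[y]mul1r A1 !mul0r.
Qed.

Lemma nilpotent_idem (e : A) : e * e = e -> nilpotent e -> e = 0.
Proof.
move=> ee [k]; suff -> : e ^+ k = if k is 0 then 1 else e.
  by case: k => [A1|//]; rewrite -[e]mul1r A1 mul0r.
by elim: k => [|[|k] IHk]; rewrite ?expr0 ?expr1 // exprS IHk.
Qed.

Lemma comaximal_exp N (y : 'I_N -> A) K : \sum_i y i = 1 ->
  exists c : 'I_N -> A, \sum_i c i * y i ^+ K = 1.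
Proof.
move=> y1; pose I := [set z | exists c : 'I_N -> A, z = \sum_i c i * y i ^+ K].
apply: contrapT => no; have [||p pI] := @prime_containing I.
- split=> [|_ _ [c ->] [d ->]|a _ [c ->]].
  + by exists (fun=> 0); rewrite big1 // => i _; rewrite mul0r.
  + by exists (fun i => c i + d i); rewrite -big_split; apply: eq_bigr => i _; rewrite mulrDl.
  + by exists (fun i => a * c i); rewrite mulr_sumr; apply: eq_bigr => i _; rewrite mulrA.
- by move=> [c c1]; apply: no; exists c.
have [_ _ _ p1 _] := specP p; apply: p1; rewrite -y1.
apply: ideal_sum (ideal_spec p) _ => i _; apply: (@spec_exp p _ K); apply: pI.
exists (fun j => (j == i)%:R); rewrite (bigD1 i) //= eqxx mul1r big1 ?addr0 //.
by move=> j /negPf->; rewrite mul0r.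
Qed.

Lemma nilpotent_bound (T : finType) (y : T -> A) : (forall i, nilpotent (y i)) ->
  exists K, forall i, y i ^+ K = 0.
Proof.
move=> /choice[k yk]; exists (\max_i k i)%N => i.
have /subnK <- : (k i <= \max_i k i)%N by exact: leq_bigmax.
by rewrite exprD yk mulr0.
Qed.

(** High powers of the [y i] annihilate one another and still generate the unit ideal. The terms of
    a relation expressing 1 by them are orthogonal with sum 1, and multiplying that sum by one term
    shows the term to be idempotent. *)
Lemma orthogonal_idempotents N (y : 'I_N -> A) : \sum_i y i = 1 ->
  (forall i j, i != j -> nilpotent (y i * y j)) ->
  exists e : 'I_N -> A, [/\ \sum_i e i = 1,
    forall i j, i != j -> e i * e j = 0, forall i, e i * e i = e i
    & forall i (p : Spec A), ~ spec_set p (e i) -> ~ spec_set p (y i)].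
Proof.
move=> y1 ynil.
(* The diagonal, on which no nilpotency is known, is set to 0. The exponent below is a successor so
   that [y i] divides [e i]. *)
pose z (ij : 'I_N * 'I_N) := if ij.1 != ij.2 then y ij.1 * y ij.2 else 0.
have [K zK] : exists K, forall ij, z ij ^+ K.+1 = 0.
  have [|K zK] := @nilpotent_bound _ z; last first.
    by exists K => ij; rewrite exprS zK mulr0.
  move=> [i j]; rewrite /z /=; case: ifP => [/ynil//|_].
  by exists 1%N; rewrite expr1.
have [c c1] := comaximal_exp K.+1 y1; pose e i := c i * y i ^+ K.+1.
have eo i j : i != j -> e i * e j = 0.
  by move=> ij; have := zK (i, j); rewrite /z /= ij /e mulrACA -exprMn => ->; rewrite mulr0.
exists e; split=> // [i|i p pe py].
  rewrite -[RHS]mulr1 -c1 (bigD1 i) //= mulrDr mulr_sumr big1 ?addr0 // => j ji.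
  by apply: eo; rewrite eq_sym.
apply: pe; have [_ _ pM _ _] := specP p; apply: (pM).
by rewrite exprSr; apply: pM.
Qed.

End Primes.

Section IdempotentDecomposition.
Variables (A : comPzRingType) (N : nat) (e : 'I_N -> A).
Hypotheses (ee : forall i, e i * e i = e i) (e1 : \sum_i e i = 1).
Hypothesis eo : forall i j, i != j -> e i * e j = 0.

Lemma idem_dec_bij :
  bijective (fun a i => (corner_of (ee i) : {rmorphism A -> corner (ee i)}) a).
Proof.
exists (fun x => \sum_i corner_val (x i)) => [b|x].
  by rewrite -mulr_sumr e1 mulr1.
apply: functional_extensionality_dep => i; apply: corner_inj => /=.
rewrite mulr_suml (bigD1 i) //= corner_valP big1 ?addr0 // => j ji.
by rewrite -[X in X * _]corner_valP -mulrA eo ?mulr0.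
Qed.

Definition idem_dec : decomposition A := Decomposition idem_dec_bij.

Lemma idem_dec_prime i (q : Spec (dec_ring idem_dec i)) :
  ~ spec_set (Spec_map (dec_proj idem_dec i) q) (e i).
Proof.
have [_ _ _ q1 _] := specP q; rewrite /= => qe; apply: q1.
suff <- : corner_of (ee i) (e i) = 1 by [].
by apply: corner_inj; rewrite /= mul1r ee.
Qed.

End IdempotentDecomposition.

(** Local constancy tested on principal open sets, for values in any type; [loc_constP] compares it
    with the Zariski topology. *)
Definition spec_loc_const (A : comPzRingType) (T : Type) (F : Spec A -> T) :=
  forall p, exists2 x, ~ spec_set p x & forall q : Spec A, ~ spec_set q x -> F q = F p.

(** Quasi-compactness expresses 1 by finitely many [x p]. The terms are grouped by the value of [F];
    no prime avoids two different groups, so their products are nilpotent and the groups can be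
    replaced by orthogonal idempotents. *)
Lemma loc_const_dec (A : comPzRingType) (T : choiceType) (F : Spec A -> T) :
  spec_loc_const F -> exists (D : decomposition A) (l : 'I_(dec_size D) -> T),
    forall i q, F (Spec_map (dec_proj D i) q) = l i.
Proof.
move=> Floc; have /choice[x xP] : forall p, exists x, ~ spec_set p x /\
    forall q : Spec A, ~ spec_set q x -> F q = F p.
  by move=> p; have [x px Fx] := Floc p; exists x.
have px p : ~ spec_set p (x p) by case: (xP p).
have Fx p q : ~ spec_set q (x p) -> F q = F p by case: (xP p) => _; apply.
pose I := [set z | exists s : seq (A * Spec A), z = \sum_(j <- s) j.1 * x j.2].
have [s s1] : I 1.
  (* A prime [p] containing [I] would contain its own [x p]. *)
  apply: contrapT => I1; have [||p pI] := @prime_containing _ I.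
  - split=> [|_ _ [s ->] [t ->]|a _ [s ->]].
    + by exists [::]; rewrite big_nil.
    + by exists (s ++ t); rewrite big_cat.
    + exists [seq (a * j.1, j.2) | j <- s]; rewrite big_map mulr_sumr.
      by apply: eq_bigr => j _; rewrite mulrA.
  - by [].
  - by apply: (px p); apply: pI; exists [:: (1, p)]; rewrite big_seq1 mul1r.
pose vs := undup [seq F j.2 | j <- s].
pose v (i : 'I_(size vs)) := tnth (in_tuple vs) i.
pose y i := \sum_(j <- s | F j.2 == v i) j.1 * x j.2.
have vI i i' : v i = v i' -> i = i'.
  move=> vv; apply/val_inj/eqP.
  rewrite -(nth_uniq (v i) _ _ (undup_uniq [seq F j.2 | j <- s])) ?ltn_ord //.
  by rewrite -!(tnth_nth _ (in_tuple vs)) -/(v i) -/(v i') -vv.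
have y1 : \sum_i y i = 1.
  rewrite s1 /y (exchange_big_dep xpredT) //=; apply: eq_big_seq => j js.
  have : F j.2 \in vs by rewrite mem_undup; apply/map_f.
  case/(nthP (F j.2)) => k ks Fk.
  have Fv : v (Ordinal ks) = F j.2 by rewrite /v (tnth_nth (F j.2)).
  rewrite (eq_bigl (pred1 (Ordinal ks))) ?big_pred1_eq // => i /=.
  by apply/eqP/eqP => [|->//]; rewrite -Fv => /vI.
have yF i q : ~ spec_set q (y i) -> F q = v i.
  move=> qy; apply: contrapT => Fq; apply: qy; apply: ideal_sum (ideal_spec q) _ => j /eqP Fj.
  have [_ _ qM _ _] := specP q; apply: (qM); apply: contrapT => /Fx.
  by rewrite Fj.
have [|e [e1 eo ee ey]] := orthogonal_idempotents y1.
  move=> i j ij; apply/nilpotentP => q; apply: contrapT => qij.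
  have [_ _ qM _ _] := specP q; suff ij' : i = j by rewrite ij' eqxx in ij.
  apply: vI; rewrite -(yF i q) -?(yF j q) // => qy; apply: qij; first by apply: qM.
  by rewrite mulrC; apply: qM.
by exists (idem_dec ee e1 eo), v => i q; apply/yF/ey/idem_dec_prime.
Qed.

(** * Leading exponents and existence of nu *)

Section LocallyConstantMatrices.
Variables (A : comPzRingType) (m n : nat).

Lemma loc_constP (x : Spec A -> int) : loc_const x <-> spec_loc_const x.
Proof.
split=> xl p.
  have : nbhs p [set q | x q = x p] := xl p; rewrite nbhsE => -[O [[E ->] pO] sub].
  move: pO => /= /existsNP[y /not_implyP[Ey py]].
  by exists y => // q qy; apply: sub => /= /(_ y Ey).
have [y py yx] := xl p; suff : nbhs p [set q | x q = x p] by [].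
rewrite nbhsE; exists [set q : Spec A | ~ ([set y] `<=` q)].
  by split; [exists [set y] | move=> /(_ y erefl)].
by move=> q /= qy; apply: yx => qy'; apply: qy => _ ->.
Qed.

Lemma spec_loc_const_all (I : finType) (T : Type) (F : I -> Spec A -> T) :
  (forall i, spec_loc_const (F i)) ->
  forall p, exists2 x, ~ spec_set p x &
    forall q : Spec A, ~ spec_set q x -> forall i, F i q = F i p.
Proof.
move=> Fl p; have /choice[x xP] : forall i, exists x, ~ spec_set p x /\
    forall q : Spec A, ~ spec_set q x -> F i q = F i p.
  by move=> i; have [x px Fx] := Fl i p; exists x.
exists (\prod_i x i) => [|q qx i].
  have [_ _ pM p1 pp] := specP p; elim/big_ind: _ => // [y z py pz /pp[]//|i _].
  by case: (xP i).
have [_] := xP i; apply=> qi; apply: qx; rewrite (bigD1 i) //= mulrC.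
by have [_ _ qM _ _] := specP q; apply: qM.
Qed.

Lemma mx_at_loc_const (X : 'M[uZ A]_(m, n)) : spec_loc_const (mx_at X).
Proof.
move=> p; have [|x px xX] := @spec_loc_const_all _ _
    (fun (ij : 'I_m * 'I_n) p => X ij.1 ij.2 p) _ p.
  by move=> ij; apply/loc_constP/asboolP/(valP (X ij.1 ij.2)).
by exists x => // q /xX XE; apply/matrixP => i j; rewrite !mxE (XE (i, j)).
Qed.

Lemma uZ_matrix (F : Spec A -> 'M[int]_(m, n)) : spec_loc_const F ->
  exists X : 'M[uZ A]_(m, n), forall p, mx_at X p = F p.
Proof.
move=> Fl; have entry i j : (fun p => F p i j) \in @loc_const_pred A.
  apply/asboolP/loc_constP => p; have [x px xF] := Fl p.
  by exists x => // q /xF->.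
by exists (\matrix_(i, j) UZ (entry i j)) => p; apply/matrixP => i j; rewrite !mxE.
Qed.

Lemma mx_at_inj (X Y : 'M[uZ A]_(m, n)) : (forall p, mx_at X p = mx_at Y p) -> X = Y.
Proof.
move=> XY; apply/matrixP => i j; apply: val_inj; apply: funext => p.
by have /matrixP/(_ i j) := XY p; rewrite !mxE.
Qed.

End LocallyConstantMatrices.

(** * Exponent vectors and the lexicographic order *)

Definition vcons n (l : 'cV[int]_n) (k : int) : 'cV[int]_n.+1 :=
  \col_i (if unlift ord_max i is Some j then l j 0 else k).

Lemma vcons_max n (l : 'cV[int]_n) k : vcons l k ord_max 0 = k.
Proof. by rewrite mxE unlift_none. Qed.

Lemma row'_vcons n (l : 'cV[int]_n) k : row' ord_max (vcons l k) = l.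
Proof. by apply/colP => j; rewrite !mxE liftK. Qed.

Lemma vcons_eta n (l : 'cV[int]_n.+1) : vcons (row' ord_max l) (l ord_max 0) = l.
Proof.
apply/colP => i; rewrite mxE; case: unliftP => [j ->|->] //; by rewrite mxE.
Qed.

Lemma vcons_eq n (l l' : 'cV[int]_n.+1) : l ord_max 0 = l' ord_max 0 ->
  row' ord_max l = row' ord_max l' -> l = l'.
Proof. by move=> lk ll; rewrite -[l]vcons_eta lk ll vcons_eta. Qed.

Lemma row'N n (l : 'cV[int]_n.+1) : row' ord_max (- l) = - row' ord_max l.
Proof. by apply/colP => j; rewrite !mxE. Qed.

Lemma row'D n (l l' : 'cV[int]_n.+1) :
  row' ord_max (l + l') = row' ord_max l + row' ord_max l'.
Proof. by apply/colP => j; rewrite !mxE. Qed.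

Lemma row'0 n : row' ord_max (0 : 'cV[int]_n.+1) = 0.
Proof. by apply/colP => j; rewrite !mxE. Qed.

Section LexOrder.
Implicit Types n : nat.

Lemma lexltS n (l l' : 'cV[int]_n.+1) : lexlt l l' <->
  l ord_max 0 < l' ord_max 0 \/
  l ord_max 0 = l' ord_max 0 /\ lexlt (row' ord_max l) (row' ord_max l').
Proof.
split=> [[/= [lt|[e le]] ne]|[lt|[e [le ne]]]].
- by left.
- by right; split=> //; split=> // re; apply: ne; apply: vcons_eq.
- by split; [left | move=> e; rewrite e ltxx in lt].
- by split; [right | move=> ll; apply: ne; rewrite ll].
Qed.

Lemma lexlt_trichotomy n (l l' : 'cV[int]_n) : [\/ lexlt l l', l = l' | lexlt l' l].
Proof.
case: (pselect (l = l')) => [->|ne]; first by constructor 2.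
by case: (lexle_total l l') => le; [constructor 1 | constructor 3]; split=> // /esym.
Qed.

Lemma lexlt_asym n (l l' : 'cV[int]_n) : lexlt l l' -> ~ lexlt l' l.
Proof.
elim: n l l' => [|n IHn] l l'; first by case=> _ []; apply/matrixP => -[].
move=> /lexltS ll /lexltS l'l; case: ll => [lt|[e lt]]; case: l'l => [lt'|[e' lt']].
- by have := lt_trans lt lt'; rewrite ltxx.
- by rewrite e' ltxx in lt.
- by rewrite e ltxx in lt'.
- exact: IHn lt lt'.
Qed.

Lemma lexltN n (l l' : 'cV[int]_n) : lexlt l l' -> lexlt (- l') (- l).
Proof.
elim: n l l' => [|n IHn] l l'; first by case=> _ []; apply/matrixP => -[].
move=> /lexltS ll; apply/lexltS; rewrite !row'N !mxE ltrN2.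
by case: ll => [lt|[-> lt]]; [left | right; split=> //; apply: IHn].
Qed.

End LexOrder.

(** * Coefficients and leading terms modulo an ideal *)

Section CoefLemmas.
Variable A : comPzRingType.
Implicit Types n : nat.

Definition outer n (f : iterR n.+1 A) (k : int) : iterR n A := lcoef f k.

Lemma coefRS n (f : iterR n.+1 A) l :
  coefR f l = coefR (outer f (l ord_max 0)) (row' ord_max l).
Proof. by []. Qed.

Lemma coefR_vcons n (f : iterR n.+1 A) l k : coefR f (vcons l k) = coefR (outer f k) l.
Proof. by rewrite coefRS vcons_max row'_vcons. Qed.

Lemma outer_eq n (f g : iterR n.+1 A) : outer f =1 outer g -> f = g.
Proof. exact: laurent_eqP. Qed.

Lemma outer0 n k : outer (0 : iterR n.+1 A) k = 0. Proof. by []. Qed.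

Lemma outerD n (f g : iterR n.+1 A) k : outer (f + g) k = outer f k + outer g k.
Proof. by []. Qed.

Lemma outerB n (f g : iterR n.+1 A) k : outer (f - g) k = outer f k - outer g k.
Proof. by []. Qed.

Lemma outer1 n k : outer (1 : iterR n.+1 A) k = if k == 0 then 1 else 0.
Proof. by []. Qed.

Lemma outer_bounded n (f : iterR n.+1 A) : exists N, forall k, k < N -> outer f k = 0.
Proof. exact: laurentP. Qed.

Lemma outer_sum n (T : Type) (s : seq T) (F : T -> iterR n.+1 A) k :
  outer (\sum_(i <- s) F i) k = \sum_(i <- s) outer (F i) k.
Proof. exact: (big_morph _ (fun f g => outerD f g k) (outer0 n k)). Qed.

(** The list can be made to contain any given index [i0], so that a leading term can be split off in
    [below_mul]. *)
Lemma outerM n (f g : iterR n.+1 A) (k i0 : int) :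
  exists s : seq int, [/\ uniq s, i0 \in s &
    outer (f * g) k = \sum_(i <- s) outer f i * outer g (k - i)].
Proof.
have [a fa] := laurentP f; have [b gb] := laurentP g.
exists (irange (Order.min a i0) (Order.max (k - b) i0)); split.
- exact: irange_uniq.
- by apply: mem_irange; rewrite ?ge_min ?le_max lexx orbT.
- by apply: convE fa gb _ _; rewrite ?ge_min ?le_max lexx.
Qed.

Lemma outerM_range n (f g : iterR n.+1 A) a b c d k :
  (forall i, i < a -> outer f i = 0) -> (forall i, i < b -> outer g i = 0) ->
  c <= a -> k - b <= d ->
  outer (f * g) k = \sum_(i <- irange c d) outer f i * outer g (k - i).
Proof. exact: convE. Qed.

Lemma coefR0 n l : coefR (0 : iterR n A) l = 0.
Proof. by elim: n l => [|n IHn] l //=; rewrite IHn. Qed.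

Lemma coefRD n (f g : iterR n A) l : coefR (f + g) l = coefR f l + coefR g l.
Proof. by elim: n f g l => [|n IHn] f g l //=; rewrite -IHn. Qed.

Lemma coefRN n (f : iterR n A) l : coefR (- f) l = - coefR f l.
Proof. by elim: n f l => [|n IHn] f l //=; rewrite -IHn. Qed.

Lemma coefRB n (f g : iterR n A) l : coefR (f - g) l = coefR f l - coefR g l.
Proof. by rewrite coefRD coefRN. Qed.

Lemma coefR_sum n (T : Type) (s : seq T) (F : T -> iterR n A) l :
  coefR (\sum_(i <- s) F i) l = \sum_(i <- s) coefR (F i) l.
Proof. exact: (big_morph _ (fun f g => coefRD f g l) (coefR0 l)). Qed.

Lemma coefR_term n (c : A) k l : coefR (termR c k : iterR n A) l = if l == k then c else 0.
Proof.
elim: n k l => [|n IHn] k l /=.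
  by rewrite [l]flatmx0 [k]flatmx0 eqxx.
case: eqP => [e|ne].
  rewrite IHn; congr (if _ then _ else _).
  by apply/eqP/eqP => [|->//]; apply: vcons_eq.
by rewrite coefR0; case: eqP => // lk; case: ne; rewrite lk.
Qed.

Lemma termR1 n : termR (1 : A) 0 = 1 :> iterR n A.
Proof. by elim: n => [|n IHn] //=; rewrite row'0 IHn mxE. Qed.

Lemma coefR1 n l : coefR (1 : iterR n A) l = if l == 0 then 1 else 0.
Proof. by rewrite -termR1 coefR_term. Qed.

Definition in_coefs (I : set A) n (f : iterR n A) := forall l, I (coefR f l).

Lemma in_coefsS I n (f : iterR n.+1 A) :
  in_coefs I f <-> forall k, in_coefs I (outer f k).
Proof.
split=> [If k l|If l]; last exact: If.
by have := If (vcons l k); rewrite coefR_vcons.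
Qed.

Lemma in_coefs_sum I n (T : eqType) (s : seq T) (F : T -> iterR n A) : ideal I ->
  (forall i, i \in s -> in_coefs I (F i)) -> in_coefs I (\sum_(i <- s) F i).
Proof.
move=> idI IF l; rewrite coefR_sum big_seq_cond; apply: (ideal_sum _ idI) => i /andP[/IF Fi _].
exact: Fi.
Qed.

Lemma in_coefsM I n (f g : iterR n A) : ideal I -> in_coefs I f -> in_coefs I (f * g).
Proof.
move=> idI; elim: n f g => [|n IHn] f g If.
  by move=> l; rewrite /= mulrC; have [_ _ IM] := idI; apply: IM; apply: (If 0).
apply/in_coefsS => k; have [s [_ _ ->]] := outerM f g k 0.
by apply: in_coefs_sum => // i _; apply: IHn; have /in_coefsS := If.
Qed.

Lemma in_coefsMr I n (f g : iterR n A) : ideal I -> in_coefs I g -> in_coefs I (f * g).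
Proof. by move=> idI Ig; rewrite mulrC; apply: in_coefsM. Qed.

Definition below (I : set A) n (f : iterR n A) l := forall l', lexlt l' l -> I (coefR f l').

Lemma belowS I n (f : iterR n.+1 A) l : below I f l <->
  (forall k, k < l ord_max 0 -> in_coefs I (outer f k)) /\
  below I (outer f (l ord_max 0)) (row' ord_max l).
Proof.
split=> [fl|[fk fl] l' /lexltS[lt|[e lt]]]; last 2 first.
- exact: fk.
- by rewrite coefRS e; apply: fl.
split=> [k kl l'|l' ll].
  have := fl (vcons l' k); rewrite coefR_vcons; apply.
  by apply/lexltS; left; rewrite vcons_max.
have := fl (vcons l' (l ord_max 0)); rewrite coefR_vcons; apply.
by apply/lexltS; right; rewrite vcons_max row'_vcons.
Qed.

Lemma below_mul I n (f g : iterR n A) l k : ideal I -> below I f l -> below I g k ->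
  below I (f * g) (l + k) /\ I (coefR (f * g) (l + k) - coefR f l * coefR g k).
Proof.
move=> idI; elim: n f g l k => [|n IHn] f g l k.
  move=> _ _; split; last by rewrite /= subrr; case: idI.
  by move=> l' [_ []]; rewrite [l']flatmx0 [l + k]flatmx0.
move=> /belowS[fl0 fl] /belowS[gk0 gk].
set a := l ord_max 0 in fl0 fl *; set b := k ord_max 0 in gk0 gk *.
have ab : (l + k) ord_max 0 = a + b by rewrite mxE.
have low s : s < a + b -> in_coefs I (outer (f * g) s).
  move=> sab; have [r [_ _ ->]] := outerM f g s 0.
  apply: in_coefs_sum => // i _; have [ia|ai] := ltP i a.
    by apply: in_coefsM => //; apply: fl0.
  by apply: in_coefsMr => //; apply: gk0; rewrite ltrBlDr (lt_le_trans sab) // addrC lerD2l.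
have top : in_coefs I (outer (f * g) (a + b) - outer f a * outer g b).
  have [r [ur ar ->]] := outerM f g (a + b) a.
  rewrite (bigD1_seq a) //= [a + b - a]addrAC subrr add0r [X in X - _]addrC addrK.
  rewrite -big_filter; apply: in_coefs_sum => // i; rewrite mem_filter => /andP[ia _].
  have [lt|le] := ltP i a; first by apply: in_coefsM => //; apply: fl0.
  apply: in_coefsMr => //; apply: gk0.
  by rewrite ltrBlDr addrC ltrD2l lt_neqAle le eq_sym ia.
have [fg0 fg1] := IHn _ _ _ _ fl gk.
have shift l' : I (coefR (outer f a * outer g b) l') -> I (coefR (outer (f * g) (a + b)) l').
  move=> Il; have [_ ID _] := idI.
  rewrite -[outer _ _](subrK (outer f a * outer g b)) coefRD; exact: ID.
split.
  apply/belowS; rewrite ab row'D; split=> // l' /fg0; exact: shift.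
rewrite !coefRS ab row'D; have [_ ID _] := idI.
rewrite -[outer (f * g) _](subrK (outer f a * outer g b)) coefRD -addrA.
exact: ID.
Qed.

End CoefLemmas.

Lemma int_least (P : int -> Prop) (N : int) : (forall k, k < N -> ~ P k) ->
  (exists k, P k) -> exists k, P k /\ forall j, j < k -> ~ P j.
Proof.
move=> PN [k Pk].
have ex : exists i : nat, `[< P (N + i%:Z) >].
  have Nk : N <= k by rewrite leNgt; apply/negP => /PN.
  by exists `|k - N|%N; apply/asboolP; rewrite gez0_abs ?subr_ge0 // addrCA subrr addr0.
exists (N + (ex_minn ex)%:Z); case: ex_minnP => i /asboolP Pi imin; split=> // j ji Pj.
have Nj : N <= j by rewrite leNgt; apply/negP => /PN.
have /imin : `[< P (N + `|j - N|%N%:Z) >].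
  by apply/asboolP; rewrite gez0_abs ?subr_ge0 // addrCA subrr addr0.
lia.
Qed.

Section Leading.
Variable A : comPzRingType.
Implicit Types (n : nat) (p : Spec A).

Definition has_lead p n (f : iterR n A) l := ~ spec_set p (coefR f l) /\ below p f l.

(** The lexicographic order is not a well-order; a least exponent exists because the outermost one
    is bounded below on the series, and the others are found in the slice it selects. *)
Lemma has_leadE p n (f : iterR n A) :
  ~ in_coefs p f -> exists l, has_lead p f l.
Proof.
elim: n f => [|n IHn] f.
  move=> pf; exists 0; split=> [|l' [_ []]]; last by rewrite [l']flatmx0.
  by move=> pf0; apply: pf.
move=> pf; have [N fN] := outer_bounded f.
have [||k [fk kmin]] := @int_least (fun k => ~ in_coefs p (outer f k)) N.
- move=> k /fN fk []; rewrite fk => l; rewrite coefR0; by case: (specP p).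
- by apply: contrapT => no; apply/pf/in_coefsS => k; apply: contrapT => fk; apply: no; exists k.
have [l [fl bl]] := IHn _ fk; exists (vcons l k).
split; first by rewrite coefR_vcons.
apply/belowS; rewrite vcons_max row'_vcons; split=> // j /kmin; exact: contrapT.
Qed.

Lemma has_lead_uniq p n (f : iterR n A) l l' : has_lead p f l -> has_lead p f l' -> l = l'.
Proof.
by move=> [fl bl] [fl' bl']; case: (lexlt_trichotomy l l') => // [/bl'|/bl].
Qed.

Lemma has_leadM p n (f g : iterR n A) l k :
  has_lead p f l -> has_lead p g k -> has_lead p (f * g) (l + k).
Proof.
move=> [fl bl] [gk bk]; have [b fg] := below_mul (ideal_spec p) bl bk; split=> // pfg.
have [_ _ _ _ pp] := specP p; case: (pp (coefR f l) (coefR g k)) => //.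
rewrite -[X in spec_set p X](subKr (coefR (f * g) (l + k))).
exact: idealB (ideal_spec p) pfg fg.
Qed.

Lemma has_lead_term p n l : has_lead p (termR 1 l : iterR n A) l.
Proof.
have [p0 _ _ p1 _] := specP p; split=> [|l' ll]; rewrite coefR_term ?eqxx //.
by case: eqP => // e; case: (lexlt_asym ll); rewrite e in ll *.
Qed.

Lemma invertible_lead p n (f g : iterR n A) : f * g = 1 ->
  exists l, has_lead p f l /\ has_lead p g (- l).
Proof.
move=> fg; have idp := ideal_spec p; have [_ _ _ p1 _] := specP p.
have nz (h h' : iterR n A) : h * h' = 1 -> ~ in_coefs p h.
  by move=> hh ph; apply: p1; have := @in_coefsM _ _ _ h h' idp ph 0; rewrite hh coefR1 eqxx.
have [l fl] := has_leadE (nz _ _ fg).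
have [k gk] := has_leadE (nz g f (etrans (mulrC g f) fg)).
suff lk : l + k = 0 by exists l; split=> //; rewrite (_ : - l = k) // -[LHS]add0r -lk addrAC subrr add0r.
have := has_leadM fl gk; rewrite fg => /has_lead_uniq; apply.
by rewrite -termR1; apply: has_lead_term.
Qed.

End Leading.

Section NuExistence.
Variables (n : nat) (A : comPzRingType).
Implicit Types (f g : iterL n A) (v w : 'cV[uZ A]_n) (p : Spec A).

Lemma invertible_loc_const f : invertible f -> exists v : 'cV[uZ A]_n,
  forall p, has_lead p f (mx_at v p).
Proof.
move=> [g gf]; have fg : (f : iterR n A) * g = 1 by rewrite mulrC.
have /choice[F FP] p : exists l, has_lead p f l /\ has_lead p (g : iterR n A) (- l).
  exact: invertible_lead fg.
have [v vF] : exists v : 'cV[uZ A]_n, forall p, mx_at v p = F p.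
  apply: uZ_matrix => p; exists (coefR f (F p) * coefR (g : iterR n A) (- F p)).
    have [[pf _] [pg _]] := FP p; have [_ _ _ _ pp] := specP p.
    by move=> /pp[].
  (* With l = [F p], a smaller [F q] would put the coefficient of [g] at -l into [q], a larger one
     that of [f] at l. *)
  move=> q qfg; have [[qf bf] [qg bg]] := FP q; have [_ _ qM _ _] := specP q.
  case: (lexlt_trichotomy (F q) (F p)) => // lt; case: qfg.
    by apply: qM; apply: bg; apply: lexltN.
  by rewrite mulrC; apply: qM; apply: bf.
by exists v => p; rewrite vF; case: (FP p).
Qed.

(** This frees later arguments from decompositions: [nu] can be checked one prime at a time, because
    nilpotency and invertibility on a factor are detected by its primes. *)
Lemma has_nuP f v : has_nu f v <-> forall p, has_lead p f (mx_at v p).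
Proof.
split=> [fv p|fv]; first exact: has_nu_at.
have [D [l vl]] := loc_const_dec (mx_at_loc_const v); exists D, l => i /=.
split=> // [l' ll|].
  apply/nilpotentP => q; rewrite Defs.coef_map.
  by have [_ b] := fv (Spec_map (dec_proj D i) q); apply: b; rewrite vl.
apply/invertibleP => q; rewrite Defs.coef_map.
by have [fq _] := fv (Spec_map (dec_proj D i) q); rewrite vl in fq.
Qed.

Lemma nuE f v : has_nu f v -> nu f = v.
Proof. by move=> fv; apply: has_nu_uniq (fv); exact: (xgetPex 0 (ex_intro _ v fv)). Qed.

Lemma nu_lead f p : invertible f -> has_lead p f (mx_at (nu f) p).
Proof.
move=> fi; have [v fv] := invertible_loc_const fi.
by rewrite (nuE (proj2 (has_nuP f v) fv)).
Qed.

Lemma has_nu_nu f : invertible f -> has_nu f (nu f).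
Proof. by move=> fi; apply/has_nuP => p; apply: nu_lead. Qed.

Lemma nu_unique f v : invertible f -> (forall p, has_lead p f (mx_at v p)) -> nu f = v.
Proof. by move=> fi fv; apply/nuE/has_nuP. Qed.

Lemma invertibleM f g : invertible f -> invertible g -> invertible (f * g).
Proof. by move=> [f' ff] [g' gg]; exists (f' * g'); rewrite mulrACA ff gg mulr1. Qed.

Lemma nuM f g : invertible f -> invertible g -> nu (f * g) = nu f + nu g.
Proof.
move=> fi gi; apply: nu_unique => [|p]; first exact: invertibleM.
suff -> : mx_at (nu f + nu g) p = mx_at (nu f) p + mx_at (nu g) p.
  by apply: has_leadM; apply: nu_lead.
by apply/matrixP => i j; rewrite !mxE.
Qed.

End NuExistence.

(** * The outermost variable *)

Section Outer.
Variables (n : nat) (A : comPzRingType).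
Implicit Types f g : iterR n.+1 A.

Definition ord_ge f (N : int) := forall k, k < N -> outer f k = 0.

Lemma ord_geW f M N : M <= N -> ord_ge f N -> ord_ge f M.
Proof. by move=> MN fN k kM; apply: fN; apply: lt_le_trans MN. Qed.

Lemma ord_ge0 N : ord_ge 0 N. Proof. by []. Qed.

Lemma ord_geD f g N : ord_ge f N -> ord_ge g N -> ord_ge (f + g) N.
Proof. by move=> fN gN k kN; rewrite outerD fN // gN // addr0. Qed.

Lemma ord_geMn f N k : ord_ge f N -> ord_ge (f *+ k) N.
Proof.
by move=> fN; elim: k => [|k IHk]; rewrite ?mulr0n // mulrS; apply: ord_geD.
Qed.

Lemma ord_geM f g M N : ord_ge f M -> ord_ge g N -> ord_ge (f * g) (M + N).
Proof. exact: conv_bounded. Qed.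

Lemma ord_ge_sum (T : Type) (s : seq T) (F : T -> iterR n.+1 A) N :
  (forall i, ord_ge (F i) N) -> ord_ge (\sum_(i <- s) F i) N.
Proof.
by move=> FN; elim/big_ind: _ => // f g; exact: ord_geD.
Qed.

Lemma ord_geX f N k : ord_ge f N -> ord_ge (f ^+ k) (N * k%:Z).
Proof.
move=> fN; elim: k => [|k IHk].
  by rewrite expr0 mulr0 => j j0; rewrite outer1 lt_eqF.
by rewrite exprS -[k.+1%:Z]/(1 + k%:Z) mulrDr mulr1; apply: ord_geM.
Qed.

Lemma ord_ge_eq0 f : (forall N, ord_ge f N) -> f = 0.
Proof. by move=> fN; apply: outer_eq => k; apply: (fN (k + 1)); lia. Qed.

Definition inner (b : iterR n A) : iterR n.+1 A := single 0 b.

Lemma outer_inner b k : outer (inner b) k = if k == 0 then b else 0.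
Proof. by []. Qed.

Lemma outer_innerM b f k : outer (inner b * f) k = b * outer f k.
Proof. by rewrite [LHS](lmul_single 0 b f k) subr0. Qed.

Lemma inner1 : inner 1 = 1. Proof. by []. Qed.

Lemma innerM b c : inner (b * c) = inner b * inner c.
Proof.
apply: outer_eq => k; rewrite outer_innerM !outer_inner; by case: eqP => // _; rewrite mulr0.
Qed.

Lemma innerX b k : inner (b ^+ k) = inner b ^+ k.
Proof. by elim: k => [|k IHk]; rewrite ?expr0 ?inner1 // !exprS innerM IHk. Qed.

Lemma outer_single_inner s b k :
  outer ((single s 1 : iterR n.+1 A) * inner b) k = if k == s then b else 0.
Proof.
by rewrite [LHS](lmul_single s 1 (inner b) k) mul1r singleE subr_eq0.
Qed.

(** Only finitely many coefficients below degree [c] are nonzero, so that part of the series is a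
    finite sum of nilpotents and itself nilpotent. *)
Lemma split_nilpotent f (c : int) : (forall s, s < c -> nilpotent (outer f s)) ->
  exists a b, [/\ f = a + b, nilpotent a & ord_ge b c].
Proof.
move=> fnil; have [N fN] := outer_bounded f.
pose a : iterR n.+1 A := \sum_(s <- irange (Order.min N c) c | s < c)
  (single s 1 : iterR n.+1 A) * inner (outer f s).
have aE k : outer a k = if k < c then outer f k else 0.
  rewrite /a -big_filter outer_sum.
  under eq_bigr do rewrite outer_single_inner.
  rewrite -big_mkcond (eq_bigl (pred1 k)) => [|s]; last exact: eq_sym.
  case: (ltP k c) => kc; last first.
    rewrite big1_seq // => s /andP[/eqP ->]; rewrite mem_filter => /andP[].
    by rewrite ltNge kc.
  have [kN|Nk] := ltP k N.
    rewrite fN // big1_seq // => s /andP[/eqP -> _]; exact: fN.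
  rewrite big_mkcond (bigD1_seq k) ?filter_uniq ?irange_uniq //.
    by rewrite /= eqxx big1 ?addr0 // => i /negPf->.
  by rewrite mem_filter kc mem_irange ?ge_min ?Nk ?orbT // ltW.
exists a, (f - a); split; first by rewrite addrC subrK.
  apply/nilpotentP => p; apply: ideal_sum (ideal_spec p) _ => s /fnil[k fk].
  have [p0 _ pM _ _] := specP p; apply: pM; apply: (@spec_exp _ p _ k).
  by rewrite -innerX fk; have -> : inner 0 = 0 by apply: outer_eq => j; rewrite outer_inner if_same.
by move=> k kc; rewrite outerB aE kc subrr.
Qed.

Lemma ord_ge_powers f (c : int) : (forall s, s < c -> nilpotent (outer f s)) ->
  exists a : int, forall k : nat, ord_ge (f ^+ k) (c * k%:Z - a).
Proof.
move=> /split_nilpotent[x [y [-> [J xJ] yc]]].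
have [N xN] := outer_bounded x.
(* In the binomial expansion each factor [x] lowers the order by at most [M] compared with [c], and
   fewer than [J] such factors occur in a nonzero term; hence the loss [M * J]. *)
pose M := (`|N| + `|c|)%N; have xM : ord_ge x (- M%:Z + c) by apply: ord_geW xN; lia.
exists ((M * J)%N%:Z) => k; rewrite exprDn; apply: ord_ge_sum => i; apply: ord_geMn.
have ik : (i <= k)%N by rewrite -ltnS.
have [Jki|kiJ] := leqP J (k - i); first by rewrite -(subnK Jki) exprD xJ mulr0 mul0r; exact: ord_ge0.
have := ord_geM (ord_geX (k := (k - i)%N) xM) (ord_geX (k := i) yc); apply: ord_geW.
have -> : ((k - i)%N%:Z = k%:Z - i%:Z) by rewrite subzn.
nia.
Qed.

End Outer.

Section Terms.
Variable A : comPzRingType.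

Lemma outer_term n (c : A) l k : outer (termR c l : iterR n.+1 A) k =
  if k == l ord_max 0 then termR c (row' ord_max l) else 0.
Proof. by []. Qed.

Lemma termRM n (c d : A) l k :
  (termR c l : iterR n A) * termR d k = termR (c * d) (l + k).
Proof.
elim: n l k => [|n IHn] l k //; apply: outer_eq => j.
transitivity (termR c (row' ord_max l) * outer (termR d k) (j - l ord_max 0)).
  exact: lmul_single.
rewrite !outer_term row'D -IHn mxE subr_eq addrC.
by case: eqP => // _; rewrite mulr0.
Qed.

End Terms.

(** * Idempotent series and leading coefficients in the outermost variable *)

Lemma nilpotent_coefs_idem_eq0 (B : comPzRingType) (e : iterR 1 B) : e * e = e ->
  (forall s, nilpotent (outer e s)) -> e = 0.
Proof.
move=> ee enil; apply: ord_ge_eq0 => N.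
(* All coefficients being nilpotent, the bound applies with [c = 1]: the order of e^k tends to
   infinity, while e^k = e. *)
have [a ea] := ord_ge_powers (fun s (_ : s < 1) => enil s).
have eX k : e ^+ k.+1 = e by elim: k => [|k IHk]; rewrite ?expr1 // exprS IHk.
rewrite -(eX (absz (N + a))); apply: ord_geW (ea _); lia.
Qed.

Lemma coefR_outer1 (B : comPzRingType) (f : iterR 1 B) l : coefR f l = outer f (l 0 0).
Proof. by rewrite coefRS (_ : ord_max = 0) //; apply/val_inj. Qed.

Lemma in_coefs1 (B : comPzRingType) I (f : iterR 1 B) :
  in_coefs I f <-> forall s, I (outer f s).
Proof.
by split=> If s; [have := If (const_mx s); rewrite coefR_outer1 mxE | rewrite coefR_outer1].
Qed.

Lemma has_lead1 (B : comPzRingType) (P : Spec B) (f : iterR 1 B) l :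
  has_lead P f l <->
  ~ spec_set P (outer f (l 0 0)) /\ forall s, s < l 0 0 -> spec_set P (outer f s).
Proof.
rewrite /has_lead coefR_outer1; split=> -[fl bl]; (split; first by []); [move=> s sl|move=> l' /lexltS].
  have := bl (const_mx s); rewrite coefR_outer1 mxE; apply.
  by apply/lexltS; left; rewrite mxE (_ : ord_max = 0) //; apply/val_inj.
rewrite (_ : ord_max = 0 :> 'I_1); last exact/val_inj.
case=> [lt|[_ [_ []]]]; first by rewrite coefR_outer1; apply: bl.
by apply/matrixP => -[].
Qed.

(* Modulo each prime, e is 0 or 1; on a factor where it is always the same, e or
   1 - e has nilpotent coefficients and is equal to powers of arbitrarily large
   order. *)
Lemma outer_idem (B : comPzRingType) (e : iterR 1 B) s : e * e = e -> s != 0 -> outer e s = 0.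
Proof.
move=> ee s0; have e'e : e * (1 - e) = 0 by rewrite mulrBr mulr1 ee subrr.
have dich (P : Spec B) : in_coefs P e \/ in_coefs P (1 - e).
  apply: contrapT => /not_orP[/has_leadE[l el] /has_leadE[l' e'l]].
  have [+ _] := has_leadM el e'l; rewrite e'e coefR0; apply; by case: (specP P).
have e0 (P : Spec B) : in_coefs P (1 - e) -> ~ spec_set P (outer e 0).
  move=> /in_coefs1/(_ 0); rewrite outerB outer1 eqxx => p1 p0.
  have [_ pD _ pn1 _] := specP P; apply: pn1.
  by rewrite -[1](subrK (outer e 0)); apply: pD.
have e1 (P : Spec B) : in_coefs P e -> ~ spec_set P (1 - outer e 0).
  move=> /in_coefs1/(_ 0) p0 p1; have [_ pD _ pn1 _] := specP P; apply: pn1.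
  by rewrite -[1](subrK (outer e 0)); apply: pD.
(* The locus where [e] vanishes is open and closed: it is where [1 - outer e 0] avoids the prime,
   and its complement is where [outer e 0] does. *)
have [|D [l Dl]] := @loc_const_dec B bool (fun P => `[< in_coefs P e >]).
  move=> P; have [Pe|nPe] := pselect (in_coefs P e).
    exists (1 - outer e 0) => [|Q Qe]; first exact: e1.
    apply/asboolP/asboolP => // _; case: (dich Q) => // /in_coefs1/(_ 0).
    by rewrite outerB outer1 eqxx.
  exists (outer e 0) => [|Q Qe]; first by apply: e0; case: (dich P).
  apply/asboolP/asboolP => // Qe'; case: Qe; by move/in_coefs1: Qe'.
apply: (@Defs.dec_inj B D (outer e s) 0) => i; rewrite rmorph0.
pose e' := iterR_map 1 (dec_proj D i) e.
have e'E k : outer e' k = dec_proj D i (outer e k) by [].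
have e'i : e' * e' = e' by rewrite /e' -rmorphM ee.
have [li|nli] := boolP (l i).
  rewrite -e'E [e']nilpotent_coefs_idem_eq0 // => k; apply/nilpotentP => q.
  have /asboolP/in_coefs1/(_ k) : `[< in_coefs (Spec_map (dec_proj D i) q) e >] by rewrite Dl.
  by rewrite e'E.
suff e'1 : 1 - e' = 0.
  by rewrite -e'E -[e'](subKr 1) e'1 subr0 outer1 (negPf s0).
apply: nilpotent_coefs_idem_eq0 => [|k].
  by rewrite mulrBr mulr1 mulrBl e'i mul1r subrr subr0.
apply/nilpotentP => q.
have /asboolP Ne : ~~ `[< in_coefs (Spec_map (dec_proj D i) q) e >] by rewrite Dl.
have [//|/in_coefs1/(_ k)] := dich (Spec_map (dec_proj D i) q).
suff -> : outer (1 - e') k = dec_proj D i (outer (1 - e) k) by [].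
rewrite !outerB rmorphB -e'E; congr (_ - _).
by rewrite !outer1; case: eqP; rewrite ?rmorph1 ?rmorph0.
Qed.

(** [outer_idem], applied over the ring of series in the remaining variables, strips off one
    variable at a time. *)
Lemma idem_termR n (A : comPzRingType) (e : iterR n A) : e * e = e ->
  e = termR (coefR e 0) 0.
Proof.
elim: n e => [|n IHn] e ee //.
have e0 s : s != 0 -> outer e s = 0 by move=> s0; apply: (@outer_idem (iterR n A)).
have ei : e = inner (outer e 0).
  by apply: outer_eq => s; rewrite outer_inner; case: eqP => [->|/eqP/e0].
have ee0 : outer e 0 * outer e 0 = outer e 0 by rewrite -outer_innerM -ei ee.
by rewrite {1}ei (IHn _ ee0) coefRS /= !mxE row'0.
Qed.

Section ConstantNu.
Variable A : comPzRingType.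

Definition const_nu n (f : iterR n A) l := invertible f /\ forall p : Spec A, has_lead p f l.

Lemma nilpotent_coefs_idem n (e : iterR n A) : e * e = e ->
  (forall p : Spec A, in_coefs p e) -> e = 0.
Proof.
move=> ee ep; have eE := idem_termR ee.
have c2 : coefR e 0 * coefR e 0 = coefR e 0.
  have := congr1 (fun f => coefR f 0) ee.
  by rewrite {1 2}eE termRM addr0 coefR_term eqxx.
rewrite eE (nilpotent_idem c2); last by apply/nilpotentP => p; apply: ep.
by apply: (@coef_inj n A) => l; rewrite /coef coefR_term if_same coefR0.
Qed.

(* For n > 0 a series with nilpotent coefficients need not be nilpotent.  What
   helps is that the decomposition attached to f over [iterR n A] is given by
   idempotents, which are constants. *)
Lemma const_nu_lead_outer n (f : iterR n.+1 A) l : const_nu f l ->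
  forall P : Spec (iterR n A), has_lead P (f : iterR 1 (iterR n A)) (const_mx (l ord_max 0)).
Proof.
set B := iterR n A; move=> [fi fl] P.
have [v fv] := @invertible_loc_const 1 B f fi.
have [D [k vk]] := loc_const_dec (mx_at_loc_const v).
have [i [q qP]] := Spec_dec D P; rewrite -qP.
have lead_k (q' : Spec (dec_ring D i)) :
    has_lead (Spec_map (dec_proj D i) q') (f : iterR 1 B) (k i).
  by rewrite -(vk i q'); apply: fv.
suff kl : k i 0 0 = l ord_max 0.
  have -> : const_mx (l ord_max 0) = k i by apply/colP => j; rewrite mxE -kl [j]ord1.
  exact: lead_k.
(* Otherwise the idempotent of this factor has its coefficients in every prime of [A] and is 0,
   although the factor has the prime [q]. *)
apply: contrapT => /eqP kl; have [_ _ _ q1 _] := specP q; apply: q1.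
suff e0 : dec_idem D i = 0 by rewrite -(dec_liftK (1 : dec_ring D i)) -/(dec_idem D i) e0 rmorph0; case: (specP q).
apply: nilpotent_coefs_idem => [|p]; first exact: dec_idemK.
have /belowS[flow ftop] := (fl p).2; have [ftopN _] := fl p.
case: (ltgtP (k i 0 0) (l ord_max 0)) kl => // kl _.
  (* If [k i] is too small, the coefficient there is invertible on the factor, so the idempotent is
     a multiple of a series with coefficients in [p]. *)
  have [b bf] : invertible (dec_proj D i (outer f (k i 0 0))).
    by apply/invertibleP => q'; have /has_lead1[] := lead_k q'.
  have -> : dec_idem D i = outer f (k i 0 0) * (dec_lift b * dec_idem D i).
    rewrite mulrA dec_idem_lift rmorphM dec_liftK mulrC bf; exact: esym.
  by apply: in_coefsM; [exact: ideal_spec | exact: flow].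
(* If [k i] is too large, the coefficient at the true degree is nilpotent on the factor. It is
   nonzero modulo [p], so a power of it can annihilate the idempotent only if the latter vanishes
   modulo [p]. *)
have [N fN] : nilpotent (dec_proj D i (outer f (l ord_max 0))).
  by apply/nilpotentP => q'; have /has_lead1[_] := lead_k q'; apply.
have f0 : outer f (l ord_max 0) ^+ N * dec_idem D i = 0.
  rewrite dec_idem_lift rmorphXn fN; apply/esym/dec_liftP => [|j _]; exact: rmorph0.
apply: contrapT => /has_leadE[l' el'].
have lead_pow : exists l'', has_lead p (outer f (l ord_max 0) ^+ N) l''.
  elim: (N) => [|N' [l'' IHN]]; first by exists 0; rewrite expr0 -termR1; apply: has_lead_term.
  by exists (row' ord_max l + l''); rewrite exprS; apply: has_leadM.
have [l'' fl''] := lead_pow.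
have [+ _] := has_leadM fl'' el'; rewrite f0 coefR0; apply; by case: (specP p).
Qed.

(** The lower coefficients are nilpotent as series, not merely coefficientwise, as [ord_ge_powers]
    requires; the leading one satisfies the same hypotheses with one variable less. *)
Lemma const_nu_outer n (f : iterR n.+1 A) l : const_nu f l ->
  (forall s, s < l ord_max 0 -> nilpotent (outer f s)) /\
  const_nu (outer f (l ord_max 0)) (row' ord_max l).
Proof.
move=> fl; have lead := const_nu_lead_outer fl; split=> [s sl|].
  by apply/nilpotentP => P; have /has_lead1[_] := lead P; rewrite mxE; apply.
split; first by apply/invertibleP => P; have /has_lead1[] := lead P; rewrite mxE.
by move=> p; have [_ flp] := fl; have [f1 /belowS[_ f2]] := flp p.
Qed.

End ConstantNu.

(** * Supports and bounded sets *)

Section Supports.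
Variable A : comPzRingType.
Implicit Types n : nat.

Definition Lam_le n (lam mu : Lam n) := forall l, inZ lam l -> inZ mu l.

Lemma Lam_leI n (lam mu : Lam n) : Lam_le lam (LamI lam mu) /\ Lam_le mu (LamI lam mu).
Proof. by split=> l Zl; apply: inZ_LamI; [left | right]. Qed.

Lemma Lam_collect n (T : eqType) (s : seq T) (P : T -> Lam n -> Prop) :
  (forall t lam mu, Lam_le lam mu -> P t lam -> P t mu) ->
  (forall t, t \in s -> exists lam, P t lam) -> exists mu, forall t, t \in s -> P t mu.
Proof.
move=> Pmono; elim: s => [|t s IHs] Ps; first by exists (Lam0 n).
have [lam Pt] := Ps t (mem_head _ _).
have [|mu Pmu] := IHs; first by move=> t' ts; apply: Ps; rewrite inE ts orbT.
have [le1 le2] := Lam_leI lam mu; exists (LamI lam mu) => t'.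
by rewrite inE => /orP[/eqP->|/Pmu]; [exact: Pmono le1 Pt | exact: Pmono le2].
Qed.

Definition supp_in n (lam : Lam n) (f : iterR n A) := forall l, ~ inZ lam l -> coefR f l = 0.

(* Convertible to membership in [U lam]. *)
Definition vanish n (lam : Lam n) (f : iterR n A) := forall l, inZ lam (- l) -> coefR f l = 0.

Lemma supp_in_le n (lam mu : Lam n) f : Lam_le lam mu -> supp_in lam f -> supp_in mu f.
Proof. by move=> le_lm lf l Zl; apply: lf => /le_lm. Qed.

Lemma vanish_le n (lam mu : Lam n) f : Lam_le lam mu -> vanish mu f -> vanish lam f.
Proof. by move=> le_lm lf l /le_lm; apply: lf. Qed.

Lemma supp_in0 n (lam : Lam n) : supp_in lam 0.
Proof. by move=> l _; rewrite coefR0. Qed.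

Lemma vanish0 n (lam : Lam n) : vanish lam 0.
Proof. by move=> l _; rewrite coefR0. Qed.

Lemma supp_in_sum n (lam : Lam n) (T : eqType) (s : seq T) (F : T -> iterR n A) :
  (forall i, i \in s -> supp_in lam (F i)) -> supp_in lam (\sum_(i <- s) F i).
Proof.
by move=> Fs l Zl; rewrite coefR_sum big1_seq // => i /andP[_ /Fs]; apply.
Qed.

Lemma vanish_sum n (lam : Lam n) (T : eqType) (s : seq T) (F : T -> iterR n A) :
  (forall i, i \in s -> vanish lam (F i)) -> vanish lam (\sum_(i <- s) F i).
Proof.
by move=> Fs l Zl; rewrite coefR_sum big1_seq // => i /andP[_ /Fs]; apply.
Qed.

Lemma supp_inS n (lam : Lam n.+1) (f : iterR n.+1 A) : supp_in lam f <->
  ord_ge f lam.2 /\ forall k, supp_in (lam.1 k) (outer f k).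
Proof.
split=> [lf|[f0 f1] l].
  split=> [k klam|k l Zl]; last by rewrite -coefR_vcons lf //= vcons_max row'_vcons => -[].
  apply: (@coef_inj n A) => l; rewrite /coef -coefR_vcons coefR0.
  by apply: lf => /=; rewrite vcons_max leNgt klam => -[].
rewrite coefRS; have [lt|le] := ltP (l ord_max 0) lam.2; first by rewrite f0 // coefR0.
by move=> Zl; apply: f1 => Zl'; apply: Zl.
Qed.

Lemma vanishS n (lam : Lam n.+1) (f : iterR n.+1 A) : vanish lam f <->
  forall k, lam.2 <= - k -> vanish (lam.1 (- k)) (outer f k).
Proof.
split=> [lf k kl l Zl|lf l [le Zl]].
  by rewrite -coefR_vcons; apply: lf; split; rewrite /= ?row'N mxE vcons_max ?row'_vcons.
rewrite coefRS; move: le Zl; rewrite row'N !mxE => le; exact: lf.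
Qed.

Lemma supp_exists n (f : iterR n A) : exists lam, supp_in lam f.
Proof.
elim: n f => [|n IHn] f; first by exists tt => l [].
have [N fN] := outer_bounded f; have /choice[F FP] k := IHn (outer f k).
by exists (F, N); apply/supp_inS.
Qed.

Lemma coef_exists n (lam : Lam n) (c : 'cV[int]_n -> A) :
  (forall l, ~ inZ lam l -> c l = 0) -> exists f : iterR n A, coefR f =1 c.
Proof.
elim: n lam c => [|n IHn] lam c cl.
  by exists (c 0) => l; rewrite [l]flatmx0.
have /choice[F FP] k : exists f : iterR n A, coefR f =1 fun l => c (vcons l k).
  apply: (IHn (lam.1 k)) => l Zl; apply: cl => /=.
  by rewrite vcons_max row'_vcons => -[].
have Fb : F \in @laurent_pred (iterR n A).
  apply/asboolP; exists lam.2 => k klam; apply: (@coef_inj n A) => l.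
  by rewrite /coef FP coefR0 cl //= vcons_max leNgt klam => -[].
by exists (Laurent Fb) => l; rewrite [LHS]FP vcons_eta.
Qed.

Lemma inZ_term n (l : 'cV[int]_n) : exists lam : Lam n, inZ lam l.
Proof.
elim: n l => [|n IHn] l; first by exists tt.
by have [lam lamP] := IHn (row' ord_max l); exists (fun=> lam, l ord_max 0) => /=.
Qed.

(* Multiplication is not jointly continuous for n > 1; on these sets it is
   continuous uniformly in the second factor. *)
Definition bounded_set n (W : set (iterR n A)) :=
  (forall mu, exists nu, forall h w, supp_in mu h -> W w -> supp_in nu (h * w)) /\
  (forall mu, exists nu, forall h w, vanish nu h -> W w -> vanish mu (h * w)).

Lemma bounded_setS n (W W' : set (iterR n A)) : W `<=` W' -> bounded_set W' -> bounded_set W.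
Proof.
move=> WW [b1 b2]; split=> mu.
  by have [nu nuP] := b1 mu; exists nu => h w hmu /WW; apply: nuP.
by have [nu nuP] := b2 mu; exists nu => h w hmu /WW; apply: nuP.
Qed.

Lemma bounded_setM n (W W' : set (iterR n A)) : bounded_set W -> bounded_set W' ->
  bounded_set [set w * w' | w in W & w' in W'].
Proof.
move=> [b1 b2] [b1' b2']; split=> mu.
  have [nu nuP] := b1 mu; have [nu' nuP'] := b1' nu.
  exists nu' => h _ hmu [w Ww [w' Ww' <-]]; rewrite mulrA.
  by apply: nuP' => //; apply: nuP.
have [nu' nuP'] := b2' mu; have [nu nuP] := b2 nu'.
exists nu => h _ hmu [w Ww [w' Ww' <-]]; rewrite mulrA.
by apply: nuP' => //; apply: nuP.
Qed.

Lemma bounded_setU n (W W' : set (iterR n A)) : bounded_set W -> bounded_set W' ->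
  bounded_set (W `|` W').
Proof.
move=> [b1 b2] [b1' b2']; split=> mu.
  have [nu nuP] := b1 mu; have [nu' nuP'] := b1' mu.
  have [le1 le2] := Lam_leI nu nu'; exists (LamI nu nu') => h w hmu [Ww|Ww].
    by apply: supp_in_le le1 _; apply: nuP.
  by apply: supp_in_le le2 _; apply: nuP'.
have [nu nuP] := b2 mu; have [nu' nuP'] := b2' mu.
have [le1 le2] := Lam_leI nu nu'; exists (LamI nu nu') => h w hmu [Ww|Ww].
  by apply: nuP => //; apply: vanish_le hmu.
by apply: nuP' => //; apply: vanish_le hmu.
Qed.

(** Repetitions are allowed because binomial multiples have to be covered in [bounded_powers]. *)
Definition in_span (B : comPzRingType) (F : seq B) (x : B) :=
  exists r : seq B, {subset r <= F} /\ x = \sum_(b <- r) b.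

Lemma in_span0 (B : comPzRingType) (F : seq B) : in_span F 0.
Proof. by exists [::]; rewrite big_nil. Qed.

Lemma in_spanD (B : comPzRingType) (F : seq B) x y : in_span F x -> in_span F y -> in_span F (x + y).
Proof.
move=> [r [rF ->]] [t [tF ->]]; exists (r ++ t); rewrite big_cat; split=> // z.
by rewrite mem_cat => /orP[/rF|/tF].
Qed.

Lemma in_spanMn (B : comPzRingType) (F : seq B) x k : in_span F x -> in_span F (x *+ k).
Proof.
move=> Fx; elim: k => [|k IHk]; first exact: in_span0.
by rewrite mulrS; apply: in_spanD.
Qed.

Lemma in_span_mem (B : comPzRingType) (F : seq B) x : x \in F -> in_span F x.
Proof.
by move=> xF; exists [:: x]; rewrite big_seq1; split=> // y; rewrite inE => /eqP->.
Qed.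

(** In a given degree the products involve one factor from a finite list, and the lower bound [M]
    leaves finitely many of them to consider; the corresponding bounds can then be merged. *)
Lemma bounded_span n (F : int -> seq (iterR n A)) (M : int) :
  (forall b : iterR n A, bounded_set [set b]) ->
  bounded_set [set w : iterR n.+1 A | ord_ge w M /\ forall s, in_span (F s) (outer w s)].
Proof.
move=> bd; set W := [set w | _].
have bd1 s i mu : exists nu, forall h w, supp_in mu (outer h i) -> W w ->
    supp_in nu (outer h i * outer w (s - i)).
  have [||nu nuP] := @Lam_collect n _ (F (s - i))
      (fun b nu => forall h : iterR n A, supp_in mu h -> supp_in nu (h * b)).
  - by move=> b lam nu le_ln H h /H; apply: supp_in_le.
  - move=> b _; have [/(_ mu)[nu nuP] _] := bd b; exists nu => h hmu; exact: nuP.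
  exists nu => h w hmu [_ /(_ (s - i))[r [rF ->]]]; rewrite mulr_sumr.
  by apply: supp_in_sum => b /rF bF; apply: nuP.
have bd2 s i mu : exists nu, forall h w, vanish nu (outer h i) -> W w ->
    vanish mu (outer h i * outer w (s - i)).
  have [||nu nuP] := @Lam_collect n _ (F (s - i))
      (fun b nu => forall h : iterR n A, vanish nu h -> vanish mu (h * b)).
  - by move=> b lam nu le_ln H h hnu; apply: H; apply: vanish_le hnu.
  - move=> b _; have [_ /(_ mu)[nu nuP]] := bd b; exists nu => h hmu; exact: nuP.
  exists nu => h w hmu [_ /(_ (s - i))[r [rF ->]]]; rewrite mulr_sumr.
  by apply: vanish_sum => b /rF bF; apply: nuP.
split=> mu.
  have /choice[nu nuP] s : exists nu, forall h w, supp_in mu h -> W w ->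
      supp_in nu (outer (h * w) s).
    have [||nu nuP] := @Lam_collect n _ (irange mu.2 (s - M)) (fun i nu => forall h w,
      supp_in mu h -> W w -> supp_in nu (outer h i * outer w (s - i))).
    - by move=> i lam nu le_ln H h w hmu Ww; apply: supp_in_le (H _ _ hmu Ww).
    - move=> i _; have [nu nuP] := bd1 s i (mu.1 i); exists nu => h w /supp_inS[_ hmu] Ww.
      exact: nuP.
    exists nu => h w hmu Ww; have [h0 _] := proj1 (supp_inS _ _) hmu; have [w0 _] := Ww.
    rewrite (outerM_range h0 w0 (lexx _) (lexx _)).
    by apply: supp_in_sum => i ir; apply: nuP.
  exists (nu, mu.2 + M) => h w hmu Ww; apply/supp_inS; split=> [|k]; last exact: nuP.
  by have [h0 _] := proj1 (supp_inS _ _) hmu; have [w0 _] := Ww; apply: ord_geM.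
(* For a fixed degree [- k] of [h], only the output degrees from [- k + M] to [- mu.2] matter: above
   them nothing is asked, below them the factor of [w] is 0. *)
have /choice[nu nuP] k : exists nu, forall s, s \in irange (- k + M) (- mu.2) ->
    forall h w, vanish nu (outer h (- k)) -> W w ->
      vanish (mu.1 (- s)) (outer h (- k) * outer w (s - (- k))).
  apply: Lam_collect => [s lam nu le_ln H h w hnu Ww|s _].
    by apply: H => //; apply: vanish_le hnu.
  exact: bd2.
exists (nu, mu.2 + M) => h w /vanishS /= hnu Ww; apply/vanishS => s smu.
have [r [_ _ ->]] := outerM h w s 0; apply: vanish_sum => i _.
have [w0 _] := Ww; have [siM|Msi] := ltP (s - i) M.
  by rewrite w0 // mulr0; apply: vanish0.
have := nuP (- i) s _ h w; rewrite !opprK; apply=> //; first by apply: mem_irange; lia.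
by have := hnu i; apply; lia.
Qed.

(** This is separate continuity of multiplication. In [bounded_span] the finite list for degree s
    consists of one coefficient of [b]. *)
Lemma bounded_set1 n (b : iterR n A) : bounded_set [set b].
Proof.
elim: n b => [|n IHn] b.
  split=> -[]; exists tt => h w; [by move=> _ _ l /(_ I)|move=> h0 _ l _].
  have hE : h = 0 by exact: (h0 0).
  by rewrite hE mul0r.
have [M bM] := outer_bounded b.
apply: bounded_setS (@bounded_span n (fun s => [:: outer b s]) M IHn) => _ ->.
by split=> // s; apply: in_span_mem; rewrite mem_head.
Qed.

Definition unipotent n (u : iterR n.+1 A) :=
  nilpotent (outer u 0 - 1) /\ forall s, s < 0 -> nilpotent (outer u s).

(** Write u = 1 + eps. The coefficients of [eps] in degrees at most 0 are nilpotent, so eps^j has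
    order at least j - a. In degree s only the powers with j at most s + a enter the binomial
    expansion of u^k: a finite list independent of k. *)
Lemma bounded_powers n (u : iterR n.+1 A) : unipotent u ->
  exists M, bounded_set [set u ^+ k | k in [set: nat]] /\ forall k, ord_ge (u ^+ k) M.
Proof.
move=> [u0 unil]; pose eps := u - 1.
have [s s1|a epsa] := @ord_ge_powers n A eps 1.
  have [->|s0] := eqVneq s 0; first by rewrite outerB outer1 eqxx.
  by rewrite outerB outer1 (negPf s0) subr0; apply: unil; lia.
have uE k : u ^+ k = \sum_(i < k.+1) eps ^+ i *+ 'C(k, i).
  rewrite -[u in LHS](subrK 1) addrC exprDn; apply: eq_bigr => i _.
  by rewrite expr1n mul1r.
have uM k : ord_ge (u ^+ k) (- a).
  rewrite uE; apply: ord_ge_sum => i; apply: ord_geMn; apply: ord_geW (epsa _); lia.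
exists (- a); split=> //.
pose F s := [seq outer (eps ^+ j) s | j <- iota 0 `|s + a|.+1].
apply: bounded_setS (@bounded_span n F (- a) (@bounded_set1 n)) => _ [k _ <-].
split=> // s; rewrite uE outer_sum; elim/big_ind: _ => [|x y|i _].
- exact: in_span0.
- exact: in_spanD.
have outerMn (g : iterR n.+1 A) j : outer (g *+ j) s = outer g s *+ j.
  by elim: j => [|j IHj]; rewrite ?mulr0n // !mulrS outerD IHj.
rewrite outerMn; apply: in_spanMn; have [lt|le] := ltP s (i%:Z - a).
  by rewrite epsa ?mul1r //; exact: in_span0.
apply: in_span_mem; apply/mapP; exists (i : nat) => //; rewrite mem_iota /= add0n; lia.
Qed.

End Supports.

(** * Summability of monomials *)

Section Monomials.
Implicit Types R : comPzRingType.

(* [g] is meant to be the inverse of [f]; general commutative rings carry no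
   inverse operation here. *)
Definition zpow R (f g : R) (k : int) : R :=
  if k is Negz b then g ^+ b.+1 else f ^+ `|k|%N.

Lemma zpowS R (f g : R) k : f * g = 1 -> zpow f g (k + 1) = zpow f g k * f.
Proof.
move=> fg; case: k => [a|[|b]].
- by rewrite -PoszD addn1 /= exprSr.
- by rewrite /= expr0 expr1 mulrC.
- have -> : Negz b.+1 + 1 = Negz b by lia.
  by rewrite /= [g ^+ b.+2]exprSr -mulrA [g * f]mulrC fg mulr1.
Qed.

Lemma zpowD R (f g : R) a b : f * g = 1 -> zpow f g (a + b) = zpow f g a * zpow f g b.
Proof.
move=> fg; elim: b => [|b IHb|b IHb]; first by rewrite addr0 mulr1.
  by rewrite -addn1 PoszD addrA !zpowS // IHb mulrA.
have cancel x y : x * f = y * f -> x = y.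
  by move=> xy; rewrite -[x]mulr1 -fg mulrA xy -mulrA fg mulr1.
apply: cancel; rewrite -mulrA -!zpowS // -addrA.
have -> : - (b.+1)%:Z + 1 = - b%:Z by lia.
exact: IHb.
Qed.

Lemma zpow1 R (f g : R) : zpow f g 1 = f. Proof. exact: expr1. Qed.

Lemma zpow0 R (f g : R) : zpow f g 0 = 1. Proof. by []. Qed.

Lemma zpowM R (f g f' g' : R) k : zpow (f * f') (g * g') k = zpow f g k * zpow f' g' k.
Proof. by case: k => k; rewrite /= exprMn. Qed.

Lemma zpow_map R R' (u : {rmorphism R -> R'}) f g k :
  u (zpow f g k) = zpow (u f) (u g) k.
Proof. by case: k => k; rewrite /= rmorphXn. Qed.

Fixpoint monom n R : ('I_n -> R) -> ('I_n -> R) -> 'cV[int]_n -> R :=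
  if n is k.+1 then fun f g l =>
    @monom k R (f \o lift ord_max) (g \o lift ord_max) (row' ord_max l)
      * zpow (f ord_max) (g ord_max) (l ord_max 0)
  else fun _ _ _ => 1.

Lemma monomD n R (f g : 'I_n -> R) l l' : (forall i, f i * g i = 1) ->
  monom f g (l + l') = monom f g l * monom f g l'.
Proof.
elim: n f g l l' => [|n IHn] f g l l' fg /=; first by rewrite mulr1.
rewrite row'D IHn; last by move=> i; apply: fg.
by rewrite mxE (zpowD _ _ (fg ord_max)); apply: mulrACA.
Qed.

Lemma monom0 n R (f g : 'I_n -> R) : monom f g 0 = 1.
Proof. by elim: n f g => [|n IHn] f g //=; rewrite row'0 IHn mxE mul1r. Qed.

Lemma monom_delta n R (f g : 'I_n -> R) i : monom f g (delta_mx i 0) = f i.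
Proof.
elim: n f g i => [|n IHn] f g i; first by case: i.
rewrite /= mxE eqxx andbT; case: (unliftP ord_max i) => [j ->|->].
  rewrite (negPf (neq_lift _ _)) zpow0 mulr1 -[RHS](IHn (f \o lift ord_max) (g \o lift ord_max)).
  by congr monom; apply/colP => k; rewrite !mxE (inj_eq lift_inj).
rewrite eqxx zpow1 -[RHS]mul1r; congr (_ * _); rewrite -[RHS](monom0 (f \o lift ord_max) (g \o lift ord_max)).
by congr monom; apply/colP => k; rewrite !mxE eq_sym (negPf (neq_lift _ _)).
Qed.

Lemma monomM n R (f g f' g' : 'I_n -> R) l :
  monom (fun i => f i * f' i) (fun i => g i * g' i) l = monom f g l * monom f' g' l.
Proof.
elim: n f g f' g' l => [|n IHn] f g f' g' l /=; first by rewrite mulr1.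
by rewrite zpowM mulrACA -IHn.
Qed.

Lemma monom_map n R R' (u : {rmorphism R -> R'}) (f g : 'I_n -> R) l :
  u (monom f g l) = monom (u \o f) (u \o g) l.
Proof.
elim: n f g l => [|n IHn] f g l /=; first exact: rmorph1.
by rewrite rmorphM IHn zpow_map.
Qed.

Lemma monom_ext n R (f g f' g' : 'I_n -> R) l : f =1 f' -> g =1 g' ->
  monom f g l = monom f' g' l.
Proof. by move=> /funext-> /funext->. Qed.

Lemma monom_inner n m (A : comPzRingType) (f g : 'I_n -> iterR m A) l :
  inner (monom f g l) = monom (fun i => inner (f i)) (fun i => inner (g i)) l.
Proof.
elim: n f g l => [|n IHn] f g l; first exact: inner1.
rewrite [in LHS]/= innerM IHn; congr (_ * _).
by case: (l ord_max 0) => k; rewrite [in LHS]/= innerX.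
Qed.

End Monomials.

Section Estimates.
Variable A : comPzRingType.

(** What substitution into arbitrary series needs. The first half bounds the support of a sum of c_l
    f^l with l in Z_lam; the second puts f^l into U_mu unless -l lies in Z_lam, which makes the sums
    finite at each exponent and the substitution continuous. *)
Definition summable m n (f g : 'I_n -> iterR m A) :=
  (forall lam, exists mu, forall l, inZ lam l -> supp_in mu (monom f g l)) /\
  (forall mu, exists lam, forall l, ~ inZ lam (- l) -> vanish mu (monom f g l)).

(** At each prime of the ring of coefficients in the outermost variable, [u] has leading term 1,
    hence so has its inverse; nilpotency is read off from all these primes. *)
Lemma unipotent_inv m (u v : iterR m.+1 A) : u * v = 1 -> unipotent u -> unipotent v.
Proof.
set B := iterR m A; move=> uv [u0 unil].
have lead (P : Spec B) : has_lead P (u : iterR 1 B) 0.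
  apply/has_lead1; rewrite mxE; split=> [p0|s /unil /nilpotentP//].
  have [_ _ _ p1 _] := specP P; apply: p1.
  rewrite -[1](subKr (outer u 0)); apply: idealB => //; first exact: ideal_spec.
  by move/nilpotentP: u0.
have leadv (P : Spec B) : has_lead P (v : iterR 1 B) 0.
  have [l [ul]] := @invertible_lead B P 1 u v uv.
  by rewrite -(has_lead_uniq (lead P) ul) oppr0.
split; last first.
  by move=> s s0; apply/nilpotentP => P; have /has_lead1[_] := leadv P; apply; rewrite mxE.
apply/nilpotentP => P; have [_ bu] := lead P; have [_ bv] := leadv P.
have [_] := @below_mul B P 1 u v 0 0 (ideal_spec P) bu bv.
rewrite -[u * v]/((u : iterR 1 B) * v) uv !coefR_outer1 !mxE addr0 outer1 eqxx => P1.
have P0 : spec_set P (outer u 0 - 1) by move/nilpotentP: u0.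
have [_ pD pM _ _] := specP P.
have -> : outer v 0 - 1 = - 1 * (1 - outer u 0 * outer v 0) + - outer v 0 * (outer u 0 - 1).
  by ring.
by apply: (pD); apply: pM.
Qed.

Lemma bounded_zpow m (u v : iterR m.+1 A) : u * v = 1 -> unipotent u ->
  exists M, bounded_set [set zpow u v k | k in [set: int]] /\ forall k, ord_ge (zpow u v k) M.
Proof.
move=> uv uu; have [M [bu uM]] := bounded_powers uu.
have [M' [bv vM]] := bounded_powers (unipotent_inv uv uu).
exists (Order.min M M'); split.
  apply: bounded_setS (bounded_setU bu bv) => _ [[k|k] _ <-]; [left|right].
    by exists k.
  by exists k.+1.
by case=> k; [apply: ord_geW (uM _) | apply: ord_geW (vM _)]; rewrite ge_min lexx ?orbT.
Qed.

Lemma bounded_monom m n (u v : 'I_n -> iterR m.+1 A) :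
  (forall i, u i * v i = 1) -> (forall i, unipotent (u i)) ->
  exists M, bounded_set [set monom u v l | l in [set: 'cV[int]_n]] /\
    forall l, ord_ge (monom u v l) M.
Proof.
elim: n u v => [|n IHn] u v uv uu.
  exists 0; split; last by move=> l k k0; rewrite outer1 lt_eqF.
  by apply: bounded_setS (bounded_set1 1) => _ [l _ <-].
have [||M [b1 M1]] := IHn (u \o lift ord_max) (v \o lift ord_max).
- by move=> i; apply: uv.
- by move=> i; apply: uu.
have [M' [b2 M2]] := bounded_zpow (uv ord_max) (uu ord_max).
exists (M + M'); split; last by move=> l; apply: ord_geM.
apply: bounded_setS (bounded_setM b1 b2) => _ [l _ <-].
by exists (monom (u \o lift ord_max) (v \o lift ord_max) (row' ord_max l)); [exists (row' ord_max l)|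
  exists (zpow (u ord_max) (v ord_max) (l ord_max 0)); [exists (l ord_max 0)|]].
Qed.

(* The leading coefficients in the outermost variable are split off: the
   remaining factors have uniformly bounded powers. *)
Lemma summable_inner m n (f g : 'I_n -> iterR m.+1 A) (X : 'M[int]_(m.+1, n)) :
  (forall i, f i * g i = 1) -> (forall i p, has_lead p (f i) (col i X)) ->
  (forall i, X ord_max i = 0) ->
  (forall f0 g0 : 'I_n -> iterR m A, (forall i, f0 i * g0 i = 1) ->
     (forall i p, has_lead p (f0 i) (col i (row' ord_max X))) -> summable f0 g0) ->
  summable f g /\ exists M, forall l, ord_ge (monom f g l) M.
Proof.
move=> fg fX X0 IH.
have cf i : const_nu (f i) (col i X) by split=> //; exists (g i); rewrite mulrC.
pose f0 i := outer (f i) 0.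
have f0P i : (forall s, s < 0 -> nilpotent (outer (f i) s)) /\
    const_nu (f0 i) (row' ord_max (col i X)).
  by have := const_nu_outer (cf i); rewrite mxE X0.
have /choice[g0 g0f0] i : exists g0, g0 * f0 i = 1 by have [_ []] := f0P i.
have fg0 i : f0 i * g0 i = 1 by rewrite mulrC.
have [|B0 C0] := IH f0 g0 fg0.
  move=> i p; have [_ [_ lead]] := f0P i; have := lead p; congr has_lead.
  by apply/colP => j; rewrite !mxE.
pose u i := f i * inner (g0 i); pose v i := g i * inner (f0 i).
have uv i : u i * v i = 1 by rewrite mulrACA fg mul1r -innerM g0f0 inner1.
have uu i : unipotent (u i).
  have uE s : outer (u i) s = g0 i * outer (f i) s by rewrite /u mulrC outer_innerM.
  split; first by exists 1%N; rewrite expr1 uE g0f0 subrr.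
  move=> s /(proj1 (f0P i))[k fk]; exists k.
  by rewrite uE exprMn fk mulr0.
have [M [bd Mle]] := bounded_monom uv uu.
have E l : monom f g l = inner (monom f0 g0 l) * monom u v l.
  rewrite monom_inner -monomM; apply: monom_ext => i.
    by rewrite /u mulrCA -innerM fg0 inner1 mulr1.
  by rewrite /v mulrCA -innerM g0f0 inner1 mulr1.
split; last first.
  exists M => l; rewrite E => k kM; rewrite outer_innerM Mle ?mulr0 //.
have [bd1 bd2] := bd; split=> [lam|mu].
  have [mu0 B0'] := B0 lam; have [nu nuP] := bd1 (fun=> mu0, 0).
  exists nu => l lamP; rewrite E; apply: nuP; last by exists l.
  apply/supp_inS; split=> [k k0|k]; first by rewrite outer_inner lt_eqF.
  by rewrite outer_inner; case: eqP => _; [exact: B0' | exact: supp_in0].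
have [nu nuP] := bd2 mu; have [lam lamP] := C0 (nu.1 (- 0)).
exists lam => l lamN; rewrite E; apply: nuP; last by exists l.
apply/vanishS => k _; rewrite outer_inner; case: eqP => [->|_]; last exact: vanish0.
exact: lamP.
Qed.

Lemma summable_const m n (f g : 'I_n -> iterR m A) (X : 'M[int]_(m, n)) :
  (forall i, f i * g i = 1) -> (forall i p, has_lead p (f i) (col i X)) ->
  echelon X -> summable f g.
Proof.
elim: m n f g X => [|m IHm] n f g X fg fX [p [pinc pX]].
  case: n f g X fg fX p pinc pX => [|n] f g X fg fX p pinc pX; last by case: (p ord0).
  split=> mu; last by exists tt => l [].
  by have [nu nuP] := supp_exists (1 : iterR 0 A); exists nu.
(* The number of columns is left free: this serves all of [f] if the last row is 0, and all but the
   last series otherwise. *)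
have inner_case k (f' g' : 'I_k -> iterR m.+1 A) (X' : 'M[int]_(m.+1, k)) :
    (forall i, f' i * g' i = 1) -> (forall i q, has_lead q (f' i) (col i X')) ->
    (forall i, X' ord_max i = 0) -> echelon X' ->
    summable f' g' /\ exists M, forall l, ord_ge (monom f' g' l) M.
  move=> fg' fX' X'0 [p' [p'inc p'X]]; apply: (summable_inner fg' fX' X'0) => f0 g0 fg0 f0X.
  apply: (IHm _ _ _ (row' ord_max X')) => //.
  have /choice[r rp] i : exists r, p' i = lift ord_max r.
    case: (unliftP ord_max (p' i)) => [r ->|e]; first by exists r.
    by have [] := p'X i; rewrite e X'0 ltxx.
  exists r; split=> [i j /p'inc|i].
    by rewrite !rp !lift_max.
  have [Xp Xj] := p'X i; rewrite !mxE -rp; split=> // j rj; rewrite mxE; apply: Xj.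
  by rewrite rp !lift_max.
have [X0|Xn0] := pselect (forall i, X ord_max i = 0).
  have [] := inner_case n f g X fg fX X0 => //; by exists p.
case: n f g X fg fX p pinc pX Xn0 => [|n] f g X fg fX p pinc pX Xn0.
  by case: Xn0 => -[].
(* A nonzero entry in the last row forces the pivot into that row, and pivots increase, so only the
   last column can have one. *)
have pmax i : X ord_max i != 0 -> p i = ord_max.
  have [_ Xj] := pX i => Xi; apply/val_inj/eqP; rewrite eqn_leq -ltnS ltn_ord /=.
  by rewrite leqNgt; apply: contra Xi => pm; rewrite (Xj ord_max pm).
have X0 (i : 'I_n) : X ord_max (lift ord_max i) = 0.
  apply/eqP/negP => /negP/pmax pi.
  have /pinc : (lift ord_max i < @ord_max n)%N by rewrite lift_max.
  by rewrite pi ltnNge -ltnS ltn_ord.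
have Xc : 0 < X ord_max ord_max.
  have [Xp _] := pX ord_max; rewrite pmax // in Xp.
  apply/eqP => Xm; case: Xn0 => i; case: (unliftP ord_max i) => [j ->|->] //; exact: X0.
set c := X ord_max ord_max in Xc.
have [||||[B C] [M Mle]] := inner_case n (f \o lift ord_max) (g \o lift ord_max) (col' ord_max X).
- by move=> i; apply: fg.
- move=> i q; have := fX (lift ord_max i) q; congr has_lead; by apply/colP => j; rewrite !mxE.
- by move=> i; rewrite mxE X0.
- exists (p \o lift ord_max); split=> [i j ij|i].
    by apply: pinc; rewrite !lift_max.
  by have [Xp Xj] := pX (lift ord_max i); rewrite mxE; split=> // j /Xj; rewrite mxE.
have cf : const_nu (f ord_max) (col ord_max X).
  by split=> //; exists (g ord_max); rewrite mulrC.
have [fnil _] := const_nu_outer cf; rewrite mxE -/c in fnil.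
have [a fa] := ord_ge_powers fnil.
set f' := f \o lift ord_max in B C Mle; set g' := g \o lift ord_max in B C Mle.
pose z k := zpow (f ord_max) (g ord_max) k.
have E l : monom f g l = monom f' g' (row' ord_max l) * z (l ord_max 0) by [].
(* The integer [c] is at least 1, so a nonnegative power k of the last series has order at least k -
   a. *)
have ordE (l : 'cV[int]_n.+1) : 0 <= l ord_max 0 -> ord_ge (monom f g l) (M + (l ord_max 0 - a)).
  rewrite E; case: (l ord_max 0) => // k _; apply: ord_geM => //.
  by apply: ord_geW (fa k); nia.
split=> [lam|mu].
  have /choice[mu muP] k : exists mu, forall l : 'cV[int]_n.+1, l ord_max 0 = k ->
      inZ (lam.1 k) (row' ord_max l) -> supp_in mu (monom f g l).
    have [mu0 mu0P] := B (lam.1 k); have [/(_ mu0)[mu muP] _] := bounded_set1 (z k).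
    by exists mu => l lk Zl; rewrite E lk; apply: muP => //; apply: mu0P.
  (* For the order of the monomials, [kap] covers the finitely many last exponents from [lam.2] to
     0, and [ordE] the positive ones. *)
  have [kap kapP] : exists kap, forall k, k \in irange lam.2 0 -> Lam_le (mu k) kap.
    apply: Lam_collect => [k k1 k2 le12 H l /H/le12//|k _]; by exists (mu k).
  (* A monomial whose last exponent exceeds this bound has no term in degree s, by [ordE], so
     finitely many last exponents remain. *)
  have /choice[nu nuP] s : exists nu, forall k,
      k \in irange lam.2 (`|s| + `|a| + `|M|) -> Lam_le ((mu k).1 s) nu.
    apply: Lam_collect => [k k1 k2 le12 H l /H/le12//|k _]; by exists ((mu k).1 s).
  exists (nu, Order.min kap.2 (M - a)) => l [lam2 Zl]; have sl := muP _ l erefl Zl.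
  have [_ sl1] := proj1 (supp_inS _ _) sl; apply/supp_inS; split=> [|s].
    have [l0|l0] := leP (l ord_max 0) 0; last first.
      by apply: ord_geW (ordE l (ltW l0)); rewrite /= ge_min; lia.
    have le_kap := kapP _ (mem_irange lam2 l0).
    have [ord _] := proj1 (supp_inS _ _) (supp_in_le le_kap sl).
    by apply: ord_geW ord; rewrite /= ge_min lexx.
  have [lK|Kl] := leP (l ord_max 0) (`|s| + `|a| + `|M|).
    exact: supp_in_le (nuP _ _ (mem_irange lam2 lK)) (sl1 s).
  have -> : outer (monom f g l) s = 0 by apply: ordE; lia.
  exact: supp_in0.
have /choice[lam lamP] k : exists lam, forall l : 'cV[int]_n.+1, l ord_max 0 = - k ->
    ~ inZ lam (- row' ord_max l) -> vanish mu (monom f g l).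
  have [_ /(_ mu)[kap kapP]] := bounded_set1 (z (- k)); have [lam lamP] := C kap.
  by exists lam => l lk Zl; rewrite E lk; apply: kapP => //; apply: lamP.
have [K KE] : exists K : int, mu.2 = K by exists mu.2.
(* Beyond this bound the order exceeds [- K], so nothing is left in the degrees that [vanish mu]
   inspects; for smaller last exponents [lam] was chosen one exponent at a time. *)
exists (lam, - (`|K| + `|a| + `|M|)) => l /= Zl.
have [lK|Kl] := leP (l ord_max 0) (`|K| + `|a| + `|M|).
  apply: (lamP (- l ord_max 0)); first by rewrite opprK.
  by move=> Zl'; apply: Zl; rewrite row'N mxE; split; first by lia.
apply/vanishS => s mus; rewrite KE in mus.
have arith (x y : int) : `|K| + `|a| + `|M| < x -> K <= - y -> 0 <= x /\ y < M + (x - a).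
  by lia.
have [l0 sl] := arith _ _ Kl mus.
have -> : outer (monom f g l) s = 0 by apply: ordE.
exact: vanish0.
Qed.

End Estimates.

Lemma has_lead_map n (A B : comPzRingType) (u : {rmorphism A -> B}) (q : Spec B)
    (f : iterR n A) l :
  has_lead (Spec_map u q) f l -> has_lead q (iterR_map n u f) l.
Proof.
move=> [fl bl]; split=> [|l' /bl]; by rewrite -[coefR (iterR_map n u f) _]/(coef (iterL_map n u f) _) Defs.coef_map.
Qed.

Lemma summable_dec m n (A : comPzRingType) (f g : 'I_n -> iterR m A) (D : decomposition A) :
  (forall i, summable (iterR_map m (dec_proj D i) \o f) (iterR_map m (dec_proj D i) \o g)) ->
  summable f g.
Proof.
move=> sD.
have cE i l k : coefR (monom (iterR_map m (dec_proj D i) \o f) (iterR_map m (dec_proj D i) \o g) l) k =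
    dec_proj D i (coefR (monom f g l) k).
  by rewrite -monom_map; apply: Defs.coef_map.
split=> [lam|mu].
  have [||mu muP] := @Lam_collect m _ (enum 'I_(dec_size D)) (fun i mu => forall l, inZ lam l ->
    supp_in mu (monom (iterR_map m (dec_proj D i) \o f) (iterR_map m (dec_proj D i) \o g) l)).
  - by move=> i k1 k2 le12 H l /H; apply: supp_in_le.
  - by move=> i _; have [/(_ lam)] := sD i.
  exists mu => l Zl k Zk; apply: (@Defs.dec_inj A D) => i.
  by rewrite rmorph0 -cE; apply: (muP i) => //; rewrite mem_enum.
have [||lam lamP] := @Lam_collect n _ (enum 'I_(dec_size D)) (fun i lam => forall l, ~ inZ lam (- l) ->
    vanish mu (monom (iterR_map m (dec_proj D i) \o f) (iterR_map m (dec_proj D i) \o g) l)).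
- by move=> i k1 k2 le12 H l Zl; apply: H => /le12.
- by move=> i _; have [_ /(_ mu)] := sD i.
exists lam => l Zl k Zk; apply: (@Defs.dec_inj A D) => i.
by rewrite rmorph0 -cE; apply: (lamP i) => //; rewrite mem_enum.
Qed.

Lemma summable_echelon m n (A : comPzRingType) (f g : 'I_n -> iterR m A) (X : 'M[uZ A]_(m, n)) :
  (forall i, f i * g i = 1) -> (forall i p, has_lead p (f i) (mx_at (col i X) p)) ->
  (forall p, echelon (mx_at X p)) -> summable f g.
Proof.
move=> fg fX eX; have [D [Y YX]] := loc_const_dec (mx_at_loc_const X).
apply: (@summable_dec _ _ _ _ _ D) => i.
(* On a factor without primes nothing is known about [Y i], but that factor is the zero ring. *)
have [[q]|noq] := pselect (inhabited (Spec (dec_ring D i))); last first.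
  have triv := @no_prime_trivial (dec_ring D i) (fun q => noq (inhabits q)).
  by split=> lam; [exists (Lam0 m)|exists (Lam0 n)] => l _ k _; apply: triv.
apply: (@summable_const _ _ _ _ _ (Y i)) => [j|j q'|].
- by rewrite /= -rmorphM fg rmorph1.
- apply: has_lead_map; have := fX j (Spec_map (dec_proj D i) q'); congr has_lead.
  by rewrite -(YX i q'); apply/colP => k; rewrite !mxE.
- by rewrite -(YX i q).
Qed.

(** * Substitution homomorphisms *)

(** Applied to the images of the monomials t^l under a homomorphism, which are thus determined by
    the images of the variables and of their inverses. *)
Lemma monom_char n (R : comPzRingType) (chi : 'cV[int]_n -> R) :
  chi 0 = 1 -> (forall l l', chi (l + l') = chi l * chi l') ->
  forall l, chi l = monom (fun i => chi (delta_mx i 0)) (fun i => chi (- delta_mx i 0)) l.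
Proof.
elim: n chi => [|n IHn] chi chi0 chiD l; first by rewrite [l]flatmx0.
have inv d : chi d * chi (- d) = 1 by rewrite -chiD subrr.
have zchi d k : zpow (chi d) (chi (- d)) k = chi (d *~ k).
  elim: k => [|k IHk|k IHk]; first by rewrite mulr0z.
    have -> : k.+1%:Z = k%:Z + 1 by lia.
    by rewrite zpowS // IHk -chiD mulrzDr mulr1z.
  have cancel x y : x * chi d = y * chi d -> x = y.
    by move=> xy; rewrite -[x]mulr1 -(inv d) mulrA xy -mulrA inv mulr1.
  have k1 : - k.+1%:Z + 1 = - k%:Z by lia.
  apply: cancel; rewrite -zpowS // k1 IHk -chiD; congr chi.
  by rewrite -[X in _ = _ + X]mulr1z -mulrzDr k1.
have vconsD (a b : 'cV[int]_n) : vcons (a + b) 0 = vcons a 0 + vcons b 0.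
  by apply/colP => i; rewrite !mxE; case: unlift => [j|]; rewrite ?mxE ?addr0.
rewrite [RHS]/= zchi.
have -> : monom ((fun i => chi (delta_mx i 0)) \o lift ord_max)
    ((fun i => chi (- delta_mx i 0)) \o lift ord_max) (row' ord_max l) =
    chi (vcons (row' ord_max l) 0).
  rewrite [RHS](IHn (fun l => chi (vcons l 0))) => [||a b]; last by rewrite vconsD chiD.
    apply: monom_ext => i /=; congr chi; apply/colP => j; rewrite !mxE;
      case: unliftP => [k ->|->]; rewrite ?mxE ?(inj_eq lift_inj) ?eqxx ?andbT //.
    - by rewrite (negPf (neq_lift _ _)).
    - by rewrite (negPf (neq_lift _ _)) oppr0.
  rewrite -chi0; congr chi; apply/colP => j; rewrite !mxE.
  by case: unlift => *; rewrite ?mxE.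
rewrite -chiD; congr chi; apply/colP => j; rewrite !mxE -scaler_int !mxE.
case: unliftP => [k ->|->]; rewrite ?mxE ?eqxx ?andbT.
  by rewrite eq_sym (negPf (neq_lift _ _)) mulr0 addr0.
by rewrite add0r mulr1 intz.
Qed.

(** * Truncation and density of Laurent polynomials *)

Section CoefficientSums.
Variable A : comPzRingType.

(** The outermost exponent lies between [lam.2] and [- mu.2], and each slice is finite by induction.
    This makes coefficient sums finite and lets finite truncations approximate a series. *)
Lemma inZ_finite n (lam mu : Lam n) :
  exists s : seq 'cV[int]_n, forall l, inZ lam l -> inZ mu (- l) -> l \in s.
Proof.
elim: n lam mu => [|n IHn] lam mu; first by exists [:: 0] => l _ _; rewrite [l]flatmx0 mem_head.
have /choice[S SP] k := IHn (lam.1 k) (mu.1 (- k)).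
exists [seq vcons l k | k <- irange lam.2 (- mu.2), l <- S k] => l [lam2 Zl] [mu2 Zl'].
rewrite mxE in mu2 Zl'; apply/allpairsPdep; exists (l ord_max 0), (row' ord_max l).
split; last by rewrite vcons_eta.
  by apply: mem_irange => //; rewrite lerNr.
by apply: SP => //; rewrite -row'N.
Qed.

Lemma fsum_list (T : choiceType) (F : T -> A) (s : seq T) : uniq s ->
  (forall i, i \notin s -> F i = 0) ->
  \sum_(i \in [set: T]) F i = \sum_(i <- s) F i.
Proof.
move=> us Fs; rewrite -(fsbig_widen [set` s] setT) -?(fsbig_seq _ F us) //.
by move=> i [_ /= /negP /Fs].
Qed.

Lemma coefR_constM m (c : A) (x : iterR m A) k : coefR (termR c 0 * x) k = c * coefR x k.
Proof.
elim: m x k => [|m IHm] x k //.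
have -> : termR c 0 = inner (termR c 0) :> iterR m.+1 A.
  by apply: outer_eq => s; rewrite outer_term outer_inner mxE row'0.
by rewrite coefRS outer_innerM IHm.
Qed.

Lemma vanish_sub m (mu : Lam m) (x y : iterR m A) : vanish mu x -> vanish mu y -> vanish mu (x - y).
Proof. by move=> hx hy l Zl; rewrite coefRB hx // hy // subr0. Qed.

Definition tends0 n m (T : iterR n A -> iterR m A) :=
  forall mu, exists lam, forall h, vanish lam h -> vanish mu (T h).

Lemma tends0_comp n m k (S : iterR n A -> iterR m A) (T : iterR m A -> iterR k A) :
  tends0 S -> tends0 T -> tends0 (T \o S).
Proof.
move=> S0 T0 mu; have [nu nuP] := T0 mu; have [lam lamP] := S0 nu.
by exists lam => h /lamP/nuP.
Qed.

Lemma tends0_sub n m (S T : iterR n A -> iterR m A) :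
  tends0 S -> tends0 T -> tends0 (fun h => S h - T h).
Proof.
move=> S0 T0 mu; have [nu nuP] := T0 mu; have [lam lamP] := S0 mu.
have [le1 le2] := Lam_leI lam nu; exists (LamI lam nu) => h hv.
by apply: vanish_sub; [apply/lamP/(vanish_le le1) | apply/nuP/(vanish_le le2)].
Qed.

Lemma tends0_mul m (b : iterR m A) : tends0 (fun h => h * b).
Proof.
by move=> mu; have [_ /(_ mu)[nu nuP]] := bounded_set1 b; exists nu => h hv; apply: nuP.
Qed.

(** Removing finitely many terms from [h] brings it into U_lam without changing its image, so each
    coefficient of the image is 0. *)
Lemma tends0_eq0 n m (T : iterR n A -> iterR m A) : zmod_morphism T -> tends0 T ->
  (forall c l, T (termR c l) = 0) -> forall h, T h = 0.
Proof.
move=> TB T0 Tterm h; apply: (@coef_inj m A) => k; rewrite /coef coefR0.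
have [mu muk] := inZ_term (- k); have [lam lamP] := T0 mu.
have [nu hnu] := supp_exists h; have [s sP] := inZ_finite nu lam.
pose trunc r := h - \sum_(l <- r) termR (coefR h l) l.
have Ttrunc r : T (trunc r) = T h.
  elim: r => [|l r IHr]; first by rewrite /trunc big_nil subr0.
  by rewrite /trunc big_cons opprD [- _ - _]addrC addrA TB IHr Tterm subr0.
rewrite -(Ttrunc (undup s)); apply: lamP muk => l lamN; rewrite coefRB coefR_sum.
under eq_bigr do rewrite coefR_term.
have [ls|nls] := boolP (l \in undup s).
  rewrite (bigD1_seq l) ?undup_uniq //= eqxx big1 ?addr0 ?subrr // => i.
  by rewrite eq_sym => /negPf->.
rewrite big1_seq => [|i /andP[_ si]]; last by case: eqP nls => // ->; rewrite si.
rewrite subr0; apply: hnu => Zl; move: nls; rewrite mem_undup => /negP; apply.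
exact: sP.
Qed.

End CoefficientSums.

Section Substitution.
Variables (m n : nat) (A : comPzRingType) (f g : 'I_n -> iterR m A).
Hypotheses (fg : forall i, f i * g i = 1) (sfg : summable f g).

Lemma subst_support (h : iterR n A) k : exists s : seq 'cV[int]_n,
  forall l, l \notin s -> coefR h l * coefR (monom f g l) k = 0.
Proof.
have [lam hlam] := supp_exists h; have [mu muk] := inZ_term (- k).
have [_ /(_ mu)[nu nuP]] := sfg; have [s sP] := inZ_finite lam nu.
exists s => l nls; have [Zl|nZl] := pselect (inZ lam l); last by rewrite hlam ?mul0r.
by rewrite (nuP l) ?mulr0 // => Zl'; move/negP: nls; apply; apply: sP.
Qed.

Lemma subst_exists (h : iterR n A) : exists y : iterR m A, forall k,
  coefR y k = \sum_(l \in [set: 'cV[int]_n]) coefR h l * coefR (monom f g l) k.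
Proof.
have [lam hlam] := supp_exists h; have [/(_ lam)[mu muP] _] := sfg.
apply: (@coef_exists _ _ mu) => k nZk; rewrite fsbig1 // => l _.
have [Zl|nZl] := pselect (inZ lam l); last by rewrite hlam ?mul0r.
by rewrite (muP l Zl k nZk) mulr0.
Qed.

(** By [subst_support] the defining sums are finite, so the default value of a sum with infinite
    support never enters. *)
Definition subst (h : iterR n A) : iterR m A := proj1_sig (cid (subst_exists h)).

Lemma coefR_subst h k :
  coefR (subst h) k = \sum_(l \in [set: 'cV[int]_n]) coefR h l * coefR (monom f g l) k.
Proof. exact: (proj2_sig (cid (subst_exists h))). Qed.

Lemma subst_zmod : zmod_morphism subst.
Proof.
move=> h h'; apply: (@coef_inj m A) => k; rewrite /coef coefRB !coefR_subst.
have [s sP] := subst_support h k; have [s' sP'] := subst_support h' k.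
pose r := undup (s ++ s').
have hr l : l \notin r -> l \notin s /\ l \notin s'.
  by rewrite mem_undup mem_cat negb_or => /andP[].
rewrite !(@fsum_list _ _ _ r) ?undup_uniq //.
- by rewrite -sumrB; apply: eq_bigr => l _; rewrite coefRB mulrBl.
- by move=> l /hr[_ /sP'].
- by move=> l /hr[/sP].
- by move=> l /hr[/sP h0 /sP' h'0]; rewrite coefRB mulrBl h0 h'0 subr0.
Qed.

Lemma subst_term c l : subst (termR c l) = termR c 0 * monom f g l.
Proof.
apply: (@coef_inj m A) => k; rewrite /coef coefR_subst coefR_constM.
rewrite (@fsum_list _ _ _ [:: l]) // ?big_seq1 ?coefR_term ?eqxx //.
by move=> i; rewrite inE coefR_term => /negPf->; rewrite mul0r.
Qed.

Lemma subst_tends0 : tends0 subst.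
Proof.
move=> mu; have [_ /(_ mu)[lam lamP]] := sfg; exists lam => h hv k Zk.
rewrite coefR_subst fsbig1 // => l _.
have [Zl|nZl] := pselect (inZ lam (- l)); first by rewrite hv ?mul0r.
by rewrite (lamP l) ?mulr0.
Qed.

Lemma substM h h' : subst (h * h') = subst h * subst h'.
Proof.
(* Continuity is available in one factor at a time: first one factor is a term and the other varies,
   then the first varies too. *)
have termT c l k : subst (termR c l * k) = subst (termR c l) * subst k.
  apply/eqP; rewrite -subr_eq0; apply/eqP.
  pose T k := subst (termR c l * k) - subst (termR c l) * subst k.
  apply: (@tends0_eq0 _ _ _ T) => [x y||d l'].
  - by rewrite /T !mulrBr !subst_zmod; ring.
  - apply: tends0_sub.
      have := tends0_comp (tends0_mul (termR c l)) subst_tends0.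
      by congr tends0; apply: funext => k' /=; rewrite mulrC.
    have := tends0_comp subst_tends0 (tends0_mul (subst (termR c l))).
    by congr tends0; apply: funext => k' /=; rewrite mulrC.
  - by rewrite /T termRM !subst_term monomD // mulrACA termRM addr0 subrr.
apply/eqP; rewrite -subr_eq0; apply/eqP.
pose T h := subst (h * h') - subst h * subst h'.
apply: (@tends0_eq0 _ _ _ T) => [x y||d l'].
- by rewrite /T !mulrBl !subst_zmod mulrBl; ring.
- apply: tends0_sub; first exact: tends0_comp (tends0_mul h') subst_tends0.
  exact: tends0_comp subst_tends0 (tends0_mul (subst h')).
- by rewrite /T termT subrr.
Qed.

Lemma subst1 : subst 1 = 1.
Proof. by rewrite -termR1 subst_term monom0 mulr1 termR1. Qed.

End Substitution.

Lemma tends0_continuous n m (A : comPzRingType) (T : iterL n A -> iterL m A) :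
  zmod_morphism T -> (@tends0 A n m T <-> continuous T).
Proof.
move=> TB; split=> [T0 x S|Tc mu].
  case=> mu _ muS; have [lam lamP] := T0 mu; exists lam => // y lamy.
  by apply: muS; rewrite /= -TB; apply: lamP.
have T0 : T 0 = 0 by rewrite -(subrr 0) TB subrr.
have /(Tc 0)[lam _ lamP] : nbhs (T 0) [set y | U mu y].
  by exists mu => // y; rewrite /= T0 subr0.
by exists lam => h hv; apply: lamP; rewrite /= subr0.
Qed.

Lemma calgHom_eqP n m A (phi psi : calgHom n m A) : calg_fun phi =1 calg_fun psi -> phi = psi.
Proof.
case: phi psi => f f1 f2 f3 f4 [g g1 g2 g3 g4] /= /funext fg.
case: g / fg g1 g2 g3 g4 => g1 g2 g3 g4.
by congr CAlgHom; exact: Prop_irrelevance.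
Qed.

Theorem calgHom_exists m n (A : comPzRingType) (f : 'I_n -> iterL m A) (X : 'M[uZ A]_(m, n)) :
  (forall i, invertible (f i)) -> (forall i p, has_lead p (f i) (mx_at (col i X) p)) ->
  (forall p, echelon (mx_at X p)) -> exists phi : calgHom n m A, forall i, phi (tvar A i) = f i.
Proof.
move=> /choice[g gf] fX eX; have fg i : (f i : iterR m A) * g i = 1 by rewrite mulrC; apply: gf.
have sfg := @summable_echelon m n A f g X fg fX eX.
have sz : zmod_morphism (subst sfg : iterL n A -> iterL m A) by exact: subst_zmod.
have sm : monoid_morphism (subst sfg : iterL n A -> iterL m A).
  by split; [exact: subst1 | exact: substM].
have sc c : (subst sfg : iterL n A -> iterL m A) (const n c) = const m c.
  by rewrite /const /term subst_term monom0 mulr1.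
have st := proj1 (tends0_continuous sz) (@subst_tends0 m n A f g sfg).
exists (CAlgHom sz sm sc st) => i /=.
by rewrite /tvar /mono /term subst_term monom_delta termR1 mul1r.
Qed.

Section HomProperties.
Variables (m n : nat) (A : comPzRingType).

Lemma term_const_mono (c : A) l : termR c l = (termR c 0 : iterR n A) * termR 1 l.
Proof. by rewrite termRM mulr1 add0r. Qed.

Lemma calg_tends0 (phi : calgHom n m A) : @tends0 A n m phi.
Proof. by apply/tends0_continuous; [exact: calg_zmod | exact: calg_continuous]. Qed.

Lemma calgM (phi : calgHom n m A) x y : phi (x * y) = phi x * phi y.
Proof. by case: (calg_monoid phi). Qed.

Lemma calg1 (phi : calgHom n m A) : phi 1 = 1.
Proof. by case: (calg_monoid phi). Qed.

Lemma monoM (l l' : 'cV[int]_n) : mono A (l + l') = mono A l * mono A l'.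
Proof. by rewrite [RHS](termRM 1 1 l l') mulr1. Qed.

Lemma mono0 : mono A (0 : 'cV[int]_n) = 1.
Proof. exact: termR1. Qed.

Lemma invertible_calg (phi : calgHom n m A) l : invertible (phi (mono A l)).
Proof. by exists (phi (mono A (- l))); rewrite -calgM -monoM addNr mono0 calg1. Qed.

Lemma calg_mono (phi : calgHom n m A) l : phi (mono A l) =
  monom (fun i => phi (tvar A i)) (fun i => phi (mono A (- delta_mx i 0))) l.
Proof.
apply: (@monom_char n (iterL m A) (fun l => phi (mono A l))) => [|a b].
  by rewrite mono0 calg1.
by rewrite monoM calgM.
Qed.

Lemma calgHom_unique (phi psi : calgHom n m A) :
  (forall i, phi (tvar A i) = psi (tvar A i)) -> phi = psi.
Proof.
move=> phi_psi; apply: calgHom_eqP => h; apply/eqP; rewrite -subr_eq0; apply/eqP.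
apply: (@tends0_eq0 A n m (fun h => phi h - psi h)) => [x y||c l].
- by rewrite !calg_zmod; ring.
- by apply: tends0_sub; exact: calg_tends0.
have inv_eq (x y z : iterL m A) : x * y = 1 -> x * z = 1 -> y = z.
  by move=> xy xz; rewrite -[y]mulr1 -xz mulrA [y * x]mulrC xy mul1r.
have phi_inv (h' : calgHom n m A) i : h' (tvar A i) * h' (mono A (- delta_mx i 0)) = 1.
  by rewrite -calgM -monoM subrr mono0 calg1.
have phil : phi (mono A l) = psi (mono A l).
  rewrite !calg_mono; apply: monom_ext => i; first exact: phi_psi.
  by apply: inv_eq (phi_inv phi i) _; rewrite phi_psi.
rewrite term_const_mono !calgM.
by rewrite -[phi (termR c 0)]/(phi (const n c)) -[psi (termR c 0)]/(psi (const n c)) !calg_const phil subrr.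
Qed.

End HomProperties.

(** * The echelon condition *)

Section LexPositivity.

Lemma row'Mn n (e : 'cV[int]_n.+1) k : row' ord_max (e *+ k) = row' ord_max e *+ k.
Proof. by apply/colP => j; rewrite mxE !mulmxnE mxE. Qed.

(** The index [i] becomes the pivot of an echelon column. *)
Lemma lexlt_posP n (y : 'cV[int]_n) : lexlt 0 y <->
  exists i, 0 < y i 0 /\ forall j : 'I_n, (i < j)%N -> y j 0 = 0.
Proof.
elim: n y => [|n IHn] y.
  by split=> [[_ []]|[[]//]]; apply/matrixP => -[].
split=> [/lexltS|[i [yi yj]]].
  rewrite mxE row'0 => -[lt|[e /IHn[i [yi yj]]]].
    by exists ord_max; split=> // j; rewrite ltnNge -ltnS ltn_ord.
  exists (lift ord_max i); rewrite !mxE in yi; split=> // j.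
  case: (unliftP ord_max j) => [k ->|-> _]; last by rewrite -e.
  by rewrite !lift_max => /yj; rewrite mxE.
apply/lexltS; rewrite mxE row'0.
case: (unliftP ord_max i) yi yj => [k ->|->] yi yj; last by left.
right; split; first by rewrite yj // lift_max.
by apply/IHn; exists k; rewrite mxE; split=> // j kj; rewrite mxE yj // !lift_max.
Qed.

(** A positive outermost exponent drives the multiples past the bound [lam.2]; if it is 0, all
    multiples stay in slice 0 and the other variables decide. *)
Lemma lex_pos_escapes n (e : 'cV[int]_n) (lam : Lam n) : lexlt 0 e ->
  exists k : nat, ~ inZ lam (- (e *+ k)).
Proof.
elim: n e lam => [|n IHn] e lam; first by case=> _ []; apply/matrixP => -[].
move=> /lexltS; rewrite mxE row'0 => -[lt|[e0 lt]].
  have [K KE] : exists K : int, lam.2 = K by exists lam.2.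
  exists (`|K|.+1)%N => /= -[+ _]; rewrite KE mxE mulmxnE.
  move: lt; move: (e ord_max 0) => x; rewrite -mulr_natr natz; nia.
have [k nk] := IHn _ (lam.1 0) lt; exists k => /= -[_].
by rewrite row'N row'Mn mxE mulmxnE -e0 mul0rn oppr0.
Qed.

(** If the outermost exponent is negative, each slice contains at most one multiple, so [mu] can be
    chosen slice by slice; if it is 0, all multiples share one slice. *)
Lemma lex_nonpos_stays n (e : 'cV[int]_n) : ~ lexlt 0 e ->
  exists mu : Lam n, forall k : nat, inZ mu (- (e *+ k)).
Proof.
elim: n e => [|n IHn] e ne; first by exists tt.
have e0 : e ord_max 0 <= 0.
  by rewrite leNgt; apply/negP => lt; apply: ne; apply/lexltS; left; rewrite mxE.
have maxE k : (- (e *+ k)) ord_max 0 = - (e ord_max 0 *+ k) by rewrite mxE mulmxnE.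
have [z|nz] := eqVneq (e ord_max 0) 0.
  have [|mu muP] := IHn (row' ord_max e).
    by move=> lt; apply: ne; apply/lexltS; right; rewrite mxE row'0.
  exists (fun=> mu, 0) => k /=; rewrite maxE z mul0rn oppr0 row'N row'Mn; split=> //.
have /choice[mu muP] c : exists mu : Lam n, forall k : nat,
    (- (e *+ k)) ord_max 0 = c -> inZ mu (row' ord_max (- (e *+ k))).
  have [[k kc]|no] := pselect (exists k : nat, (- (e *+ k)) ord_max 0 = c); last first.
    by exists (Lam0 n) => k kc; case: no; exists k.
  have [mu muP] := inZ_term (row' ord_max (- (e *+ k))); exists mu => k'.
  rewrite -kc !maxE => /oppr_inj/eqP kk; suff <- : k = k' by [].
  move: kk nz; move: (e ord_max 0) => x; rewrite -![x *+ _]mulr_natr !natz => /eqP; nia.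
exists (mu, 0) => k /=; split; last exact: muP.
by rewrite maxE oppr_ge0 mulrn_wle0.
Qed.

(** If i < i' and the pivot of column i' did not exceed that of column i, then e_i' - N e_i would be
    positive for every N, while for large N its image has a negative leading entry. *)
Lemma positive_echelon m n (L : 'cV[int]_n -> 'cV[int]_m) :
  (forall a b, L (a - b) = L a - L b) -> (forall e, lexlt 0 e -> lexlt 0 (L e)) ->
  echelon (\matrix_(j, i) L (delta_mx i 0) j 0).
Proof.
move=> LB Lpos; have L0 : L 0 = 0 by rewrite -[0 in LHS](subrr 0) LB subrr.
have LD a b : L (a + b) = L a + L b by rewrite -[b in LHS]opprK LB -[- b]sub0r LB L0 sub0r opprK.
have LMn a k : L (a *+ k) = L a *+ k by elim: k => [|k IHk]; rewrite ?mulr0n // !mulrS LD IHk.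
have delta_pos (i : 'I_n) : lexlt 0 (delta_mx i 0 : 'cV[int]_n).
  apply/lexlt_posP; exists i; rewrite mxE !eqxx; split=> // j ij.
  by rewrite mxE andbT (_ : (j == i) = false) //; apply/negP => /eqP ji; rewrite ji ltnn in ij.
have /choice[p pP] i := proj1 (lexlt_posP _) (Lpos _ (delta_pos i)).
exists p; split=> [i i' ii'|i]; last first.
  by have [pi pj] := pP i; rewrite mxE; split=> // j /pj; rewrite mxE.
rewrite ltnNge; apply/negP => pp.
have [pi pj] := pP i; have [pi' pj'] := pP i'.
(* The pivot of column [i] is at least 1, so this multiple outweighs the entry of column [i'] in row
   [p i]. *)
have [N NE] : exists N : nat, N = (absz (L (delta_mx i' 0) (p i) 0)).+1 by eexists.
have neq (a b : 'I_n) : (a < b)%N -> (b == a) = false by move=> ab; rewrite -val_eqE gtn_eqF.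
have /Lpos/lexlt_posP[P [PP Pj]] : lexlt 0 (delta_mx i' 0 - delta_mx i 0 *+ N : 'cV[int]_n).
  apply/lexlt_posP; exists i'; split=> [|j ij].
    by rewrite !mxE mulmxnE mxE !eqxx neq // mul0rn subr0.
  by rewrite !mxE mulmxnE mxE !neq ?mul0rn ?subrr // (ltn_trans ii' ij).
have LE j : L (delta_mx i' 0 - delta_mx i 0 *+ N) j 0 =
    L (delta_mx i' 0) j 0 - L (delta_mx i 0) j 0 *+ N.
  by rewrite LB LMn !mxE mulmxnE.
have neg : L (delta_mx i' 0) (p i) 0 - L (delta_mx i 0) (p i) 0 *+ N < 0.
  rewrite NE; move: pi; move: (L _ (p i) 0) (L _ (p i) 0) => x y.
  rewrite -mulr_natr natz; nia.
case: (ltngtP P (p i)) => [Pp|pP'|/val_inj Pp].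
- by have := Pj _ Pp; rewrite LE => z; rewrite z ltxx in neg.
- by rewrite LE pj // pj' ?(leq_ltn_trans pp) // mul0rn subrr ltxx in PP.
- by rewrite LE Pp in PP; have := lt_trans PP neg; rewrite ltxx.
Qed.

End LexPositivity.

Section UpsilonEchelon.
Variables (m n : nat) (A : comPzRingType) (phi : calgHom n m A).

Lemma invertible_tvar i : invertible (phi (tvar A i)).
Proof. exact: invertible_calg. Qed.

(* Powers of a monomial with positive exponent tend to 0, hence so do those of its
   image, whose leading exponent must then be positive. *)
Lemma calg_lead_pos p e : lexlt 0 e -> lexlt 0 (mx_at (nu (phi (mono A e))) p).
Proof.
move=> e0; apply: contrapT => /lex_nonpos_stays[mu muP].
have [lam lamP] := calg_tends0 phi mu; have [k nk] := lex_pos_escapes lam e0.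
have lead j : has_lead p (phi (mono A (e *+ j))) (mx_at (nu (phi (mono A e))) p *+ j).
  elim: j => [|j IHj]; first by rewrite !mulr0n mono0 calg1 -termR1; apply: has_lead_term.
  rewrite !mulrS monoM calgM; apply: has_leadM => //.
  by apply: nu_lead; apply: invertible_calg.
have [+ _] := lead k; apply; have -> := lamP (mono A (e *+ k)) _ _ (muP k).
  by case: (specP p).
move=> l Zl; rewrite [LHS](coefR_term 1 (e *+ k) l); case: eqP => // le.
by rewrite le in Zl.
Qed.

Lemma Upsilon_echelon p : echelon (mx_at (Upsilon phi) p).
Proof.
have -> : mx_at (Upsilon phi) p =
    \matrix_(j, i) (mx_at (nu (phi (mono A (delta_mx i 0)))) p) j 0.
  by apply/matrixP => j i; rewrite !mxE.
apply: (@positive_echelon _ _ (fun e => mx_at (nu (phi (mono A e))) p)) => [a b|e]; last exact: calg_lead_pos.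
have nuD x y : mx_at (nu (phi (mono A (x + y)))) p =
    mx_at (nu (phi (mono A x))) p + mx_at (nu (phi (mono A y))) p.
  rewrite monoM calgM nuM; [|exact: invertible_calg|exact: invertible_calg].
  by apply/matrixP => i j; rewrite !mxE.
by rewrite -[a in RHS](subrK b) (nuD (a - b) b) addrK.
Qed.

End UpsilonEchelon.

(** * Base change and coordinates *)

Section MonoZ.

Lemma iterL_map_term n (A B : comPzRingType) (u : {rmorphism A -> B}) c l :
  iterL_map n u (term c l) = term (u c) l.
Proof.
apply: coef_inj => k; rewrite Defs.coef_map /coef !coefR_term.
by case: eqP; rewrite ?rmorph0.
Qed.

Lemma iterL_map_mono n (A B : comPzRingType) (u : {rmorphism A -> B}) (l : 'cV[int]_n) :
  iterL_map n u (mono A l) = mono B l.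
Proof. by rewrite iterL_map_term rmorph1. Qed.

Lemma iterL_map_comp n (A B C : comPzRingType) (u : {rmorphism A -> B})
    (w : {rmorphism B -> C}) (f : iterL n A) :
  iterL_map n w (iterL_map n u f) = iterL_map n (w \o u : {rmorphism A -> C}) f.
Proof. by apply: coef_inj => k; rewrite !Defs.coef_map. Qed.

Lemma iterL_dec_inj n (A : comPzRingType) (D : decomposition A) (f g : iterL n A) :
  (forall i, iterL_map n (dec_proj D i) f = iterL_map n (dec_proj D i) g) -> f = g.
Proof.
move=> fg; apply: coef_inj => k; apply: (@Defs.dec_inj A D) => i.
by rewrite -!Defs.coef_map fg.
Qed.

Lemma dec_proj_idem (A : comPzRingType) (D : decomposition A) i j :
  dec_proj D j (dec_idem D i) = (i == j)%:R.
Proof.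
by case: eqP => [<-|/eqP ij]; rewrite ?dec_liftK // dec_lift0 // eq_sym.
Qed.

Lemma is_monoZ_exists n (A : comPzRingType) (v : 'cV[uZ A]_n) : exists g, is_monoZ v g.
Proof.
have [D [l vl]] := loc_const_dec (mx_at_loc_const v).
exists (\sum_i term (dec_idem D i) (l i)), D, l => j; split=> // .
rewrite rmorph_sum (bigD1 j) //= iterL_map_term dec_proj_idem eqxx.
rewrite big1 ?addr0 // => i /negPf ij; rewrite iterL_map_term dec_proj_idem ij.
by apply: coef_inj => k; rewrite /coef coefR_term if_same [RHS]coefR0.
Qed.

Lemma monoZP n (A : comPzRingType) (v : 'cV[uZ A]_n) : is_monoZ v (monoZ v).
Proof. exact: (xgetPex 0 (is_monoZ_exists v)). Qed.

(** The working form of [is_monoZ]: it serves any homomorphism along which [v] becomes constant, not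
    only the projections of the decomposition hidden in the definition, which is pulled back for the
    comparison. *)
Lemma is_monoZ_map n (A B : comPzRingType) (u : {rmorphism A -> B}) (v : 'cV[uZ A]_n) g l :
  is_monoZ v g -> (forall q, mx_at v (Spec_map u q) = l) -> iterL_map n u g = mono B l.
Proof.
case=> D [k gk] vl; apply: (@iterL_dec_inj _ _ (dec_bc u D)) => i.
have [gi vi] := gk i; rewrite iterL_map_mono; apply: coef_inj => j.
have -> : coef (iterL_map n (dec_proj (dec_bc u D) i) (iterL_map n u g)) j =
    dec_bc_map u (coef (iterL_map n (dec_proj D i) g) j).
  by rewrite !Defs.coef_map dec_bcE.
rewrite gi -Defs.coef_map iterL_map_mono.
(* On a factor without primes [k i] and [l] may differ, but there all coefficients are equal. *)
have [[q]|noq] := pselect (inhabited (Spec (dec_ring (dec_bc u D) i))); last first.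
  exact: no_prime_trivial (fun q => noq (inhabits q)) _ _.
suff -> : k i = l by [].
rewrite -(vi (Spec_map (dec_bc_map u (i := i)) q)) -(vl (Spec_map (dec_proj (dec_bc u D) i) q)).
congr mx_at; apply: Spec_eqP; apply/seteqP.
by split=> a /=; rewrite -/(dec_proj (dec_bc u D) i) dec_bcE.
Qed.

Lemma monoZ_unique n (A : comPzRingType) (v : 'cV[uZ A]_n) g : is_monoZ v g -> monoZ v = g.
Proof.
move=> vg; have [D [l vl]] := loc_const_dec (mx_at_loc_const v).
apply: (@iterL_dec_inj _ _ D) => i.
by rewrite (is_monoZ_map vg (vl i)) (is_monoZ_map (monoZP v) (vl i)).
Qed.

Lemma monoZ_map n (A B : comPzRingType) (u : {rmorphism A -> B}) (v : 'cV[uZ A]_n) :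
  iterL_map n u (monoZ v) = monoZ (map_mx (uZ_map u) v).
Proof.
symmetry; apply: monoZ_unique.
have [D [l vl]] := loc_const_dec (mx_at_loc_const (map_mx (uZ_map u) v)).
exists D, l => i; split=> //; rewrite iterL_map_comp; apply: is_monoZ_map (monoZP v) _ => q.
rewrite -(vl i q); apply/matrixP => j k; rewrite !mxE /=.
by congr (v j k _); apply: Spec_eqP.
Qed.

Lemma monoZN n (A : comPzRingType) (v : 'cV[uZ A]_n) : monoZ v * monoZ (- v) = 1.
Proof.
have [D [l vl]] := loc_const_dec (mx_at_loc_const v).
apply: (@iterL_dec_inj _ _ D) => i; rewrite rmorphM rmorph1.
rewrite (is_monoZ_map (monoZP v) (vl i)) (is_monoZ_map (l := - l i) (monoZP (- v))) => [|q].
  by rewrite -monoM subrr mono0.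
by rewrite -(vl i q); apply/matrixP => j k; rewrite !mxE.
Qed.

Lemma monoZ_inv n (A : comPzRingType) (v : 'cV[uZ A]_n) : invertible (monoZ v).
Proof. by exists (monoZ (- v)); rewrite mulrC monoZN. Qed.

Lemma monoZ_lead n (A : comPzRingType) (v : 'cV[uZ A]_n) p : has_lead p (monoZ v) (mx_at v p).
Proof.
have [D [l vl]] := loc_const_dec (mx_at_loc_const v).
have [i [q <-]] := Spec_dec D p.
have := has_lead_term q (l i); rewrite -[termR _ _]/(mono _ (l i)) -(is_monoZ_map (monoZP v) (vl i)) (vl i q).
case=> ml mb; split=> [|l' /mb] /=.
  by move: ml; rewrite -[coefR _ _]/(coef (iterL_map n (dec_proj D i) (monoZ v)) _) Defs.coef_map.
by rewrite -[coefR (iterL_map _ _ _) _]/(coef (iterL_map n (dec_proj D i) (monoZ v)) _) Defs.coef_map.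
Qed.

End MonoZ.

Section BaseChange.
Variables m n : nat.

Lemma nu_map k (A B : comPzRingType) (u : {rmorphism A -> B}) (f : iterL k A) :
  invertible f -> nu (iterL_map k u f) = map_mx (uZ_map u) (nu f).
Proof. by move=> fi; apply/nuE/has_nu_map/has_nu_nu. Qed.

(** The homomorphism over [B] is rebuilt by substitution: invertibility, leading exponents and the
    echelon condition all pass from [A] to [B]. *)
Lemma base_change_exists (A B : comPzRingType) (u : {rmorphism A -> B}) (phi : calgHom n m A) :
  exists psi : calgHom n m B, base_change u phi psi.
Proof.
pose X := MkMplus (Upsilon_echelon phi).
apply: (@calgHom_exists m n B _ (map_mx (uZ_map u) (Upsilon phi))) => [i|i q|q].
- by have [g gf] := invertible_tvar phi i; exists (iterL_map m u g); rewrite -rmorphM gf rmorph1.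
- apply: has_lead_map; have := nu_lead (Spec_map u q) (invertible_tvar phi i).
  by congr has_lead; apply/matrixP => j k; rewrite !mxE [k]ord1.
- exact: (Mplus_map_subproof u X).
Qed.

Definition change_base (A B : comPzRingType) (u : {rmorphism A -> B}) (phi : calgHom n m A) :
  calgHom n m B := proj1_sig (cid (base_change_exists u phi)).

Lemma change_baseE (A B : comPzRingType) (u : {rmorphism A -> B}) (phi : calgHom n m A) i :
  change_base u phi (tvar B i) = iterL_map m u (phi (tvar A i)).
Proof. exact: (proj2_sig (cid (base_change_exists u phi)) i). Qed.

Definition calgHom_on : functor_on (calgHom n m).
Proof.
exists change_base => [A phi|A B C u w phi]; apply: calgHom_unique => i; rewrite !change_baseE.
  by apply: coef_inj => k; rewrite Defs.coef_map.
by rewrite iterL_map_comp.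
Defined.

Lemma base_changeP (A B : comPzRingType) (u : {rmorphism A -> B})
    (phi : calgHom n m A) (psi : calgHom n m B) :
  base_change u phi psi <-> psi = fmap calgHom_on u phi.
Proof.
split=> [bc|-> i]; last exact: change_baseE.
by apply: calgHom_unique => i; rewrite bc change_baseE.
Qed.

Section Coordinates.
Variables (A : comPzRingType) (phi : calgHom n m A).

Lemma angular_inv i : invertible (angular phi i).
Proof. by apply: invertibleM; [exact: invertible_tvar | exact: monoZ_inv]. Qed.

Lemma angular_nu i : has_nu (angular phi i) 0.
Proof.
apply/has_nuP => p; have := has_leadM (nu_lead p (invertible_tvar phi i)) (monoZ_lead (- nu (phi (tvar A i))) p).
by congr has_lead; apply/matrixP => j k; rewrite !mxE subrr.
Qed.

Definition coordinates : targetF m n A :=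
  (MkMplus (Upsilon_echelon phi), fun i => MkLGm0 (angular_inv i) (angular_nu i)).

End Coordinates.

Lemma coordinates_natural : @natural (RingFunctor calgHom_on) (targetF m n) coordinates.
Proof.
move=> A B u phi; have nuE i : nu (change_base u phi (tvar B i)) = map_mx (uZ_map u) (nu (phi (tvar A i))).
  by rewrite change_baseE nu_map //; apply: invertible_tvar.
congr pair; first by apply/Mplus_eqP/matrixP => j i; rewrite !mxE nuE mxE.
apply: funext => i; apply: LGm0_eqP => /=.
rewrite /angular nuE rmorphM monoZ_map -change_baseE; congr (_ * monoZ _).
by apply/matrixP => j k; rewrite !mxE; apply: val_inj.
Qed.

Lemma coordinates_inj A : injective (@coordinates A).
Proof.
move=> phi psi [UE aE]; apply: calgHom_unique => i.
have nuE : nu (phi (tvar A i)) = nu (psi (tvar A i)).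
  by apply/matrixP => j k; have /matrixP/(_ j i) := UE; rewrite !mxE [k]ord1.
have := congr1 (fun F => LGm0_val (F i)) aE; rewrite /= /angular nuE => aE'.
by rewrite -[LHS]mulr1 -(monoZN (- nu (psi (tvar A i)))) mulrA aE' -mulrA monoZN mulr1.
Qed.

Lemma coordinates_surj A (y : targetF m n A) : exists phi, coordinates phi = y.
Proof.
case: y => X F; pose f i := LGm0_val (F i) * monoZ (col i (Mplus_mx X)).
have fi i : invertible (f i) by apply: invertibleM (LGm0_inv _) (monoZ_inv _).
have fl i p : has_lead p (f i) (mx_at (col i (Mplus_mx X)) p).
  have := has_leadM (proj1 (has_nuP _ _) (LGm0_nu (F i)) p) (monoZ_lead (col i (Mplus_mx X)) p).
  by congr has_lead; apply/matrixP => j k; rewrite !mxE add0r.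
have [phi phif] := calgHom_exists fi fl (@MplusP _ _ _ X).
have nuf i : nu (phi (tvar A i)) = col i (Mplus_mx X).
  by apply: nu_unique; [exact: invertible_tvar | move=> p; rewrite phif].
exists phi; congr pair; first by apply/Mplus_eqP/matrixP => j i; rewrite !mxE nuf mxE.
apply: funext => i; apply: LGm0_eqP => /=.
by rewrite /angular nuf phif -mulrA monoZN mulr1.
Qed.

Lemma bijective_of_inj_surj (S T : Type) (h : S -> T) : injective h ->
  (forall y, exists x, h x = y) -> bijective h.
Proof. by move=> hi /choice[k hk]; exists k => // x; apply: hi. Qed.

Lemma coordinates_iso : @nat_iso (RingFunctor calgHom_on) (targetF m n) coordinates.
Proof.
split; first exact: coordinates_natural.
move=> A; apply: bijective_of_inj_surj; [exact: coordinates_inj | exact: coordinates_surj].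
Qed.

End BaseChange.

(** * Ind-representability *)

Section UniversalRing.
Variable G : Type.

Inductive rterm :=
  | RVar of G | RZero | ROne | ROpp of rterm | RAdd of rterm & rterm | RMul of rterm & rterm.

Fixpoint reval (A : comPzRingType) (v : G -> A) (t : rterm) : A :=
  match t with
  | RVar g => v g
  | RZero => 0
  | ROne => 1
  | ROpp s => - reval v s
  | RAdd s s' => reval v s + reval v s'
  | RMul s s' => reval v s * reval v s'
  end.

Lemma reval_map (A B : comPzRingType) (u : {rmorphism A -> B}) (v : G -> A) t :
  u (reval v t) = reval (u \o v) t.
Proof.
elim: t => [g|||s IHs|s IHs s' IHs'|s IHs s' IHs'] //=.
- exact: rmorph0.
- exact: rmorph1.
- by rewrite rmorphN IHs.
- by rewrite rmorphD IHs IHs'.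
- by rewrite rmorphM IHs IHs'.
Qed.

Variable valid : forall A : comPzRingType, (G -> A) -> Prop.

(* Two terms are identified when they agree under all valid valuations in all
   rings: this presents the ring of the valid valuations without spelling out
   their equations. *)
Definition requiv (t s : rterm) : Prop :=
  forall (A : comPzRingType) (v : G -> A), valid v -> reval v t = reval v s.

Record uring := URing {
  uclass : set rterm;
  uclassP : exists t, uclass = requiv t
}.
HB.instance Definition _ := gen_eqMixin uring.
HB.instance Definition _ := gen_choiceMixin uring.

Definition upi (t : rterm) : uring := URing (ex_intro _ t erefl).

Definition urepr (x : uring) : rterm := proj1_sig (cid (uclassP x)).

Lemma urepr_pi t : requiv (urepr (upi t)) t.
Proof. by rewrite /urepr; case: cid => s /= <-. Qed.

Lemma uring_eq (x y : uring) : requiv (urepr x) (urepr y) -> x = y.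
Proof.
rewrite /urepr; case: cid => t xt; case: cid => s ys /= ts.
suff e : uclass x = uclass y.
  case: x y e {xt ys} => c hc [d hd] /= cd; case: d / cd hd => hd.
  by congr URing; exact: Prop_irrelevance.
rewrite xt ys; apply/seteqP; split=> r tr A v vv; last by rewrite ts // tr.
by rewrite -ts // tr.
Qed.

Lemma urepr_piE (A : comPzRingType) (v : G -> A) t : valid v -> reval v (urepr (upi t)) = reval v t.
Proof. exact: urepr_pi. Qed.

Definition uadd x y := upi (RAdd (urepr x) (urepr y)).
Definition uopp x := upi (ROpp (urepr x)).
Definition umul x y := upi (RMul (urepr x) (urepr y)).

Lemma uaddA : associative uadd.
Proof. by move=> x y z; apply: uring_eq => A v vv; do !rewrite urepr_piE //=; rewrite addrA. Qed.
Lemma uaddC : commutative uadd.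
Proof. by move=> x y; apply: uring_eq => A v vv; do !rewrite urepr_piE //=; rewrite addrC. Qed.
Lemma uadd0 : left_id (upi RZero) uadd.
Proof. by move=> x; apply: uring_eq => A v vv; do !rewrite urepr_piE //=; rewrite add0r. Qed.
Lemma uaddN : left_inverse (upi RZero) uopp uadd.
Proof. by move=> x; apply: uring_eq => A v vv; do !rewrite urepr_piE //=; rewrite addNr. Qed.
HB.instance Definition _ := GRing.isZmodule.Build uring uaddA uaddC uadd0 uaddN.

Lemma umulA : associative umul.
Proof. by move=> x y z; apply: uring_eq => A v vv; do !rewrite urepr_piE //=; rewrite mulrA. Qed.
Lemma umulC : commutative umul.
Proof. by move=> x y; apply: uring_eq => A v vv; do !rewrite urepr_piE //=; rewrite mulrC. Qed.
Lemma umul1 : left_id (upi ROne) umul.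
Proof. by move=> x; apply: uring_eq => A v vv; do !rewrite urepr_piE //=; rewrite mul1r. Qed.
Lemma umulDl : left_distributive umul +%R.
Proof.
by move=> x y z; apply: uring_eq => A v vv; do !rewrite urepr_piE //=; rewrite mulrDl.
Qed.
HB.instance Definition _ := GRing.Zmodule_isComPzRing.Build uring umulA umulC umul1 umulDl.

Definition uvar (g : G) : uring := upi (RVar g).

Lemma upi_eval t : upi t = reval uvar t.
Proof.
elim: t => [g|||s IHs|s IHs s' IHs'|s IHs s' IHs'] //=; rewrite -?IHs -?IHs';
  by apply: uring_eq => A v vv; do !rewrite urepr_piE //=.
Qed.

Lemma uring_ind (P : uring -> Prop) : (forall t, P (upi t)) -> forall x, P x.
Proof.
move=> Pt x; suff -> : x = upi (urepr x) by [].
by apply: uring_eq => A v vv; rewrite urepr_piE.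
Qed.

Lemma urmorph_eq (A : comPzRingType) (u w : {rmorphism uring -> A}) :
  (forall g, u (uvar g) = w (uvar g)) -> u =1 w.
Proof.
move=> uw; apply: uring_ind => t; rewrite upi_eval !reval_map.
by congr reval; apply: funext.
Qed.

Section Evaluation.
Variables (A : comPzRingType) (v : G -> A) (vv : valid v).

Definition ueval_of (_ : valid v) (x : uring) : A := reval v (urepr x).

Lemma ueval_zmod : zmod_morphism (ueval_of vv).
Proof. by move=> x y; rewrite /ueval_of; do !rewrite urepr_piE //=. Qed.
Lemma ueval_monoid : monoid_morphism (ueval_of vv).
Proof. by split=> [|x y]; rewrite /ueval_of; do !rewrite urepr_piE //=. Qed.
HB.instance Definition _ := GRing.isZmodMorphism.Build uring A (ueval_of vv) ueval_zmod.
HB.instance Definition _ := GRing.isMonoidMorphism.Build uring A (ueval_of vv) ueval_monoid.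

Definition ueval : {rmorphism uring -> A} := ueval_of vv.

Lemma ueval_var g : ueval (uvar g) = v g.
Proof. exact: urepr_piE. Qed.

End Evaluation.

(** Validity may be tested on any class of homomorphisms that separates the elements of [R], as for
    conditions given by equations. *)
Hypothesis valid_reflect : forall (R : comPzRingType) (v : G -> R),
  (forall x y : R, (forall (A : comPzRingType) (u : {rmorphism R -> A}),
     valid (u \o v) -> u x = u y) -> x = y) -> valid v.

(** By construction of [uring], the evaluations at valid valuations separate its elements. *)
Lemma uvar_valid : valid uvar.
Proof.
apply: valid_reflect => x y xy; apply: uring_eq => A v vv.
apply: (xy A (ueval vv)); suff -> : ueval vv \o uvar = v by [].
by apply: funext => g; apply: ueval_var.
Qed.

End UniversalRing.

(** * Ind-affine schemes from an increasing family of conditions *)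

Section IndRepresentability.
Variables (I : Type) (le : I -> I -> Prop).
Hypotheses (le_refl : forall i, le i i) (le_trans : forall i j k, le i j -> le j k -> le i k).
Hypotheses (I_inh : inhabited I) (I_dir : forall i j, exists k, le i k /\ le j k).
Variables (G : Type) (valid : I -> forall A : comPzRingType, (G -> A) -> Prop).
Hypothesis valid_le : forall i j, le i j ->
  forall (A : comPzRingType) (v : G -> A), valid i v -> valid j v.
Hypothesis valid_map : forall i (A B : comPzRingType) (u : {rmorphism A -> B}) (v : G -> A),
  valid i v -> valid i (u \o v).
Hypothesis valid_reflect : forall i (R : comPzRingType) (v : G -> R),
  (forall x y : R, (forall (A : comPzRingType) (u : {rmorphism R -> A}),
     valid i (u \o v) -> u x = u y) -> x = y) -> valid i v.

Let ring i : comPzRingType := uring (valid i).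
Let var i : G -> ring i := @uvar G (valid i).

Let var_valid i : valid i (var i).
Proof. exact: (uvar_valid (@valid_reflect i)). Qed.

Definition val_tr i j (h : le i j) : {rmorphism ring j -> ring i} :=
  ueval (valid_le h (var_valid i)).

Lemma val_tr_var i j (h : le i j) g : val_tr h (var j g) = var i g.
Proof. exact: ueval_var. Qed.

Lemma val_tr_id i (h : le i i) r : val_tr h r = r.
Proof.
by apply: (@urmorph_eq _ _ _ (val_tr h) (idfun : {rmorphism ring i -> ring i})) => g; apply: val_tr_var.
Qed.

Lemma val_tr_comp i j k (hij : le i j) (hjk : le j k) (hik : le i k) r :
  val_tr hij (val_tr hjk r) = val_tr hik r.
Proof.
apply: (@urmorph_eq _ _ _ (val_tr hij \o val_tr hjk : {rmorphism ring k -> ring i})) => g /=.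
by rewrite !val_tr_var.
Qed.

Definition val_ind : indAffine :=
  IndAffine le_refl le_trans I_inh I_dir val_tr_id val_tr_comp.

(** [codes v x] says that [v] lists coordinates of the point [x]. At each level the valid valuations
    embed into the points of [F], and all levels together exhaust them, so [F] is an increasing
    union of representable functors. *)
Variables (F : ring_functor) (codes : forall A : comPzRingType, (G -> A) -> F A -> Prop).
Hypothesis codes_exists : forall i (A : comPzRingType) (v : G -> A), valid i v -> exists x, codes v x.
Hypothesis codes_fun : forall (A : comPzRingType) (v : G -> A) x y, codes v x -> codes v y -> x = y.
Hypothesis codes_inj : forall i (A : comPzRingType) (v w : G -> A) x,
  valid i v -> valid i w -> codes v x -> codes w x -> v = w.
Hypothesis codes_surj : forall (A : comPzRingType) (x : F A), exists i (v : G -> A), valid i v /\ codes v x.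
Hypothesis codes_map : forall (A B : comPzRingType) (u : {rmorphism A -> B}) (v : G -> A) x,
  codes v x -> codes (u \o v) (fmap (fstr F) u x).

Let point (A : comPzRingType) (x : pre_pt val_ind A) : G -> A := fun g => tagged x (var (tag x) g).

Let point_valid (A : comPzRingType) (x : pre_pt val_ind A) : valid (tag x) (point x).
Proof. exact: (valid_map (tagged x) (var_valid (tag x))). Qed.

Let point_eq (A : comPzRingType) (x y : pre_pt val_ind A) : pt_eq x y -> point x = point y.
Proof.
case=> k [hx [hy xy]]; apply: funext => g.
by have := xy (var k g); rewrite /= !val_tr_var.
Qed.

Let eq_point (A : comPzRingType) (x y : pre_pt val_ind A) : point x = point y -> pt_eq x y.
Proof.
move=> xy; have [k [hx hy]] := I_dir (tag x) (tag y); exists k, hx, hy.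
apply: (@urmorph_eq _ _ _ (tagged x \o val_tr hx : {rmorphism ring k -> A})
  (tagged y \o val_tr hy : {rmorphism ring k -> A})) => g /=.
by rewrite !val_tr_var; apply: (congr1 (fun w => w g) xy).
Qed.

Let value_exists (A : comPzRingType) (c : pts val_ind A) : exists x : F A, forall y, pts_class c y -> codes (point y) x.
Proof.
have [y yc] := pts_classP c; have [x xP] := codes_exists (point_valid y).
by exists x => z; rewrite yc => /point_eq <-.
Qed.

Definition pts_value (A : comPzRingType) (c : pts val_ind A) : F A := proj1_sig (cid (value_exists c)).

Let pts_valueP (A : comPzRingType) (c : pts val_ind A) y : pts_class c y -> codes (point y) (pts_value c).
Proof. exact: (proj2_sig (cid (value_exists c))). Qed.

Lemma val_ind_represents : represents val_ind F.
Proof.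
exists pts_value; split=> [A B u c|A].
  have [x xc] := pts_classP c; have cx : pts_class c x by rewrite xc; apply: pt_eq_refl.
  have ux : pts_class (fmap (fstr (pts_functor val_ind)) u c) (pre_pt_map u x).
    by exists x => //; apply: pt_eq_refl.
  apply: codes_fun (pts_valueP ux) _.
  exact: codes_map (pts_valueP cx).
apply: bijective_of_inj_surj => [c d cd|x]; last first.
  have [i [v [vv vx]]] := codes_surj x.
  pose y : pre_pt val_ind A := Tagged (fun i => {rmorphism ring i -> A}) (ueval vv).
  pose c : pts val_ind A := Pts (ex_intro _ y erefl).
  have cy : pts_class c y by exact: pt_eq_refl.
  exists c; apply: codes_fun (pts_valueP cy) _.
  suff -> : point y = v by [].
  by apply: funext => g; apply: ueval_var.
have [x xc] := pts_classP c; have [y yd] := pts_classP d.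
have cx : pts_class c x by rewrite xc; apply: pt_eq_refl.
have dy : pts_class d y by rewrite yd; apply: pt_eq_refl.
(* The two points may come from different levels, while injectivity of coordinates is available at a
   common one. *)
have [k [hx hy]] := I_dir (tag x) (tag y).
have xy : pt_eq x y.
  apply: eq_point; apply: (@codes_inj k _ _ _ (pts_value c)).
  - exact: valid_le hx _ _ (point_valid x).
  - exact: valid_le hy _ _ (point_valid y).
  - exact: pts_valueP.
  - by rewrite cd; apply: pts_valueP.
apply: pts_eqP; rewrite xc yd; apply/seteqP; split=> z.
  exact/pt_eq_trans/pt_eq_sym.
exact: pt_eq_trans.
Qed.

End IndRepresentability.

Lemma represents_iso (X : indAffine) (F H : ring_functor) (theta : forall A, H A -> F A) :
  nat_iso theta -> represents X F -> represents X H.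
Proof.
move=> [thn thb] [eta [en eb]].
have invE (A : comPzRingType) : exists g : F A -> H A, cancel (theta A) g /\ cancel g (theta A).
  by have [g gK Kg] := thb A; exists g.
pose inv A := proj1_sig (cid (invE A)).
have invP A : cancel (theta A) (inv A) /\ cancel (inv A) (theta A) := proj2_sig (cid (invE A)).
exists (fun A c => inv A (eta A c)); split=> [A B u x|A].
  have [K _] := invP B; have [_ K'] := invP A.
  by rewrite -[RHS]K thn K' en.
apply: bij_comp (eb A); have [K K'] := invP A; by exists (theta A).
Qed.

(** * Coordinates for the target functor *)

Section TargetRepresentable.
Variables m n : nat.

(* Coordinates of a point of the target: the idempotents cutting out the loci
   where the matrix is constant, the coefficients of the series f_i and of their
   inverses, and the inverses of the coefficients of t^0. *)
Inductive gen :=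
  | GE of 'M[int]_(m, n) | Ga of 'I_n & 'cV[int]_m | Gb of 'I_n & 'cV[int]_m | Gc of 'I_n.

(* The matrices that may occur, a bound for the supports of all series, and
   nilpotency exponents for the coefficients below t^0. *)
Definition index : Type :=
  (seq 'M[int]_(m, n) * Lam m * ('I_n -> 'cV[int]_m -> nat))%type.

Definition index_le (i j : index) : Prop :=
  [/\ {subset i.1.1 <= j.1.1}, Lam_le i.1.2 j.1.2 & forall a l, (i.2 a l <= j.2 a l)%N].

(** Letting [valid_sum] range over all larger lists forces the idempotents of the other matrices to
    be 0 and keeps the condition monotone in the index. The series in [valid_mul] exist by
    [valid_supp]. The last two conditions express that [nu] of the series is 0. *)
Record valid_at (i : index) (A : comPzRingType) (v : gen -> A) : Prop := ValidAt {
  valid_idem : forall Y, v (GE Y) * v (GE Y) = v (GE Y);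
  valid_orth : forall Y Z, Y <> Z -> v (GE Y) * v (GE Z) = 0;
  valid_ech : forall Y, ~ echelon Y -> v (GE Y) = 0;
  valid_sum : forall r, uniq r -> {subset i.1.1 <= r} -> \sum_(Y <- r) v (GE Y) = 1;
  valid_supp : forall a l, ~ inZ i.1.2 l -> v (Ga a l) = 0 /\ v (Gb a l) = 0;
  valid_mul : forall a (x y : iterR m A), coefR x =1 (fun l => v (Ga a l)) ->
    coefR y =1 (fun l => v (Gb a l)) -> x * y = 1;
  valid_nil : forall a l, lexlt l 0 -> v (Ga a l) ^+ i.2 a l = 0;
  valid_unit : forall a, v (Ga a 0) * v (Gc a) = 1
}.

Lemma index_le_refl i : index_le i i. Proof. by split=> // l. Qed.

Lemma index_le_trans i j k : index_le i j -> index_le j k -> index_le i k.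
Proof.
move=> [s1 l1 k1] [s2 l2 k2]; split=> [Y /s1/s2//|l /l1/l2//|a l].
exact: leq_trans (k1 a l) (k2 a l).
Qed.

Lemma index_inh : inhabited index.
Proof. exact: (inhabits ([::], Lam0 m, fun _ _ => 0)%N). Qed.

Lemma index_dir i j : exists k, index_le i k /\ index_le j k.
Proof.
have [le1 le2] := Lam_leI i.1.2 j.1.2.
exists (i.1.1 ++ j.1.1, LamI i.1.2 j.1.2, fun a l => maxn (i.2 a l) (j.2 a l)).
split; split=> //= [Y|a l].
- by rewrite mem_cat => ->.
- exact: leq_maxl.
- by rewrite mem_cat => ->; rewrite orbT.
- exact: leq_maxr.
Qed.

Lemma valid_at_le i j : index_le i j -> forall (A : comPzRingType) (v : gen -> A),
  valid_at i v -> valid_at j v.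
Proof.
move=> [ls lZ lk] A v [V1 V2 V3 V4 V5 V6 V7 V8]; split=> //.
- by move=> r ur jr; apply: V4 => // Y /ls/jr.
- by move=> a l Zl; apply: V5 => /lZ.
- by move=> a l l0; rewrite -(subnK (lk a l)) exprD V7 ?mulr0.
Qed.

Lemma valid_series i (A : comPzRingType) (v : gen -> A) a : valid_at i v ->
  exists x y : iterR m A, [/\ coefR x =1 (fun l => v (Ga a l)),
    coefR y =1 (fun l => v (Gb a l)) & x * y = 1].
Proof.
move=> vv.
have [l Zl|x xE] := @coef_exists _ _ i.1.2 (fun l => v (Ga a l)).
  by case: (valid_supp vv a Zl).
have [l Zl|y yE] := @coef_exists _ _ i.1.2 (fun l => v (Gb a l)).
  by case: (valid_supp vv a Zl).
by exists x, y; split=> //; apply: valid_mul vv a x y xE yE.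
Qed.

Lemma valid_at_map i (A B : comPzRingType) (u : {rmorphism A -> B}) (v : gen -> A) :
  valid_at i v -> valid_at i (u \o v).
Proof.
move=> vv; have [V1 V2 V3 V4 V5 V6 V7 V8] := vv; split=> /=.
- by move=> Y; rewrite -rmorphM V1.
- by move=> Y Z YZ; rewrite -rmorphM V2 // rmorph0.
- by move=> Y /V3->; rewrite rmorph0.
- by move=> r ur ir; rewrite -rmorph_sum V4 // rmorph1.
- by move=> a l /(V5 a)[-> ->]; rewrite rmorph0.
- move=> a x y xE yE; have [x0 [y0 [x0E y0E xy0]]] := valid_series a vv.
  have -> : x = iterR_map m u x0.
    by apply: (@coef_inj m B) => l; rewrite [LHS]xE /= -x0E; apply/esym/coef_map.
  have -> : y = iterR_map m u y0.
    by apply: (@coef_inj m B) => l; rewrite [LHS]yE /= -y0E; apply/esym/coef_map.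
  by rewrite -rmorphM xy0 rmorph1.
- by move=> a l l0; rewrite -rmorphXn V7 // rmorph0.
- by move=> a; rewrite -rmorphM V8 rmorph1.
Qed.

Lemma valid_at_reflect i (R : comPzRingType) (v : gen -> R) :
  (forall x y : R, (forall (A : comPzRingType) (u : {rmorphism R -> A}),
     valid_at i (u \o v) -> u x = u y) -> x = y) -> valid_at i v.
Proof.
move=> monic; split.
- by move=> Y; apply: monic => A u [V1 _ _ _ _ _ _ _]; rewrite rmorphM; apply: V1.
- by move=> Y Z YZ; apply: monic => A u [_ V2 _ _ _ _ _ _]; rewrite rmorphM rmorph0; apply: V2.
- by move=> Y nY; apply: monic => A u [_ _ V3 _ _ _ _ _]; rewrite rmorph0; apply: V3.
- by move=> r ur ir; apply: monic => A u [_ _ _ V4 _ _ _ _]; rewrite rmorph_sum rmorph1; apply: V4.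
- by move=> a l Zl; split; apply: monic => A u [_ _ _ _ V5 _ _ _]; rewrite rmorph0; case: (V5 a l Zl).
- move=> a x y xE yE; apply: (@coef_inj m R) => l; apply: monic => A u [_ _ _ _ _ V6 _ _].
  rewrite -!coef_map; congr coef; rewrite [LHS](rmorphM (iterR_map m u)) rmorph1.
  by apply: (V6 a) => k; rewrite /= -?xE -?yE; apply: coef_map.
- by move=> a l l0; apply: monic => A u [_ _ _ _ _ _ V7 _]; rewrite rmorphXn rmorph0; apply: V7.
- by move=> a; apply: monic => A u [_ _ _ _ _ _ _ V8]; rewrite rmorphM rmorph1; apply: V8.
Qed.

(** [GE Y] cuts out the locus where the matrix is Y. For valid valuations the values at [Gb] and
    [Gc] are then forced, being inverses. *)
Definition codes (A : comPzRingType) (v : gen -> A) (x : targetF m n A) : Prop :=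
  (forall Y p, ~ spec_set p (v (GE Y)) <-> mx_at (Mplus_mx x.1) p = Y) /\
  forall i l, coefR (LGm0_val (x.2 i)) l = v (Ga i l).

Lemma codes_exists i (A : comPzRingType) (v : gen -> A) : valid_at i v -> exists x, codes v x.
Proof.
move=> vv; have /choice[F FP] p : exists Y, ~ spec_set p (v (GE Y)).
  apply/existsNP => pv; have [_ _ _ p1 _] := specP p; apply: p1.
  rewrite -(valid_sum vv (undup_uniq i.1.1)); last by move=> Y; rewrite mem_undup.
  by apply: ideal_sum (ideal_spec p) _ => Y _; apply: pv.
have Funiq Y p : ~ spec_set p (v (GE Y)) -> F p = Y.
  move=> pY; apply: contrapT => /(valid_orth vv) FY.
  have [p0 _ _ _ pp] := specP p; case: (pp (v (GE (F p))) (v (GE Y))) => //; last exact: FP.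
  by rewrite FY.
have [X XF] : exists X : 'M[uZ A]_(m, n), forall p, mx_at X p = F p.
  by apply: uZ_matrix => p; exists (v (GE (F p))) => // q /Funiq.
have Xech p : echelon (mx_at X p).
  rewrite XF; apply: contrapT => /(valid_ech vv) E0; apply: (FP p).
  by rewrite E0; case: (specP p).
have /choice[f fP] a : exists f : LGm0 m A, coefR (LGm0_val f) =1 fun l => v (Ga a l).
  have [x [y [xE _ xy]]] := valid_series a vv.
  have xi : invertible (x : iterL m A) by exists y; rewrite mulrC.
  suff xn : has_nu (x : iterL m A) 0 by exists (MkLGm0 xi xn).
  apply/has_nuP => p; have -> : mx_at 0 p = 0 :> 'cV[int]_m by apply/matrixP => j k; rewrite !mxE.
  split=> [|l l0]; rewrite xE.
    have [_ _ pM p1 _] := specP p => pa; apply: p1.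
    by rewrite -(valid_unit vv a) mulrC; apply: pM.
  apply: (@spec_exp _ p _ (i.2 a l)); rewrite (valid_nil vv) //; by case: (specP p).
exists (MkMplus Xech, f); split=> [Y p|a l] /=; last exact: fP.
by rewrite XF; split=> [/Funiq//|<-]; apply: FP.
Qed.

Lemma codes_fun (A : comPzRingType) (v : gen -> A) x y : codes v x -> codes v y -> x = y.
Proof.
case: x y => [X f] [Y g] [vX vf] [vY vg]; congr pair.
  by apply/Mplus_eqP/mx_at_inj => p; symmetry; apply/vY/vX.
apply: funext => i; apply: LGm0_eqP; apply: (@coef_inj m A) => l.
by rewrite [LHS]vf [RHS]vg.
Qed.

(** If every prime avoiding a avoids b, the idempotent a (1 - b) lies in all primes and is therefore
    0. *)
Lemma idem_eq (A : comPzRingType) (e e' : A) : e * e = e -> e' * e' = e' ->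
  (forall p : Spec A, ~ spec_set p e <-> ~ spec_set p e') -> e = e'.
Proof.
move=> ee ee' same.
have half (a b : A) : a * a = a -> b * b = b ->
    (forall p : Spec A, ~ spec_set p a -> ~ spec_set p b) -> a = a * b.
  move=> aa bb ab; apply/eqP; rewrite -subr_eq0 -{1}[a]mulr1 -mulrBr; apply/eqP.
  apply: nilpotent_idem.
    by rewrite mulrACA aa [(1 - b) * (1 - b)]mulrBr mulr1 mulrBl mul1r bb subrr subr0.
  apply/nilpotentP => p; have [p0 _ pM _ pp] := specP p.
  have [pa|/ab pb] := pselect (spec_set p a); first by rewrite mulrC; apply: pM.
  by apply: pM; case: (pp b (1 - b)) => //; rewrite mulrBr mulr1 bb subrr.
rewrite (half e e') // => [|p /same//]; rewrite mulrC -(half e' e) // => p /same//.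
Qed.

Lemma codes_inj i (A : comPzRingType) (v w : gen -> A) x :
  valid_at i v -> valid_at i w -> codes v x -> codes w x -> v = w.
Proof.
move=> vv ww [vX vf] [wX wf].
have ab a l : v (Ga a l) = w (Ga a l) by rewrite -vf -wf.
have inv_eq (R : comPzRingType) (a b c : R) : a * b = 1 -> a * c = 1 -> b = c.
  by move=> ab1 ac1; rewrite -[b]mulr1 -ac1 mulrA [b * a]mulrC ab1 mul1r.
apply: funext => -[Y|a l|a l|a] //.
- apply: idem_eq; [exact: valid_idem vv _|exact: valid_idem ww _|move=> p].
  by split=> [/vX/wX|/wX/vX].
- have [x1 [y1 [x1E y1E xy1]]] := valid_series a vv.
  have [x2 [y2 [x2E y2E xy2]]] := valid_series a ww.
  have xx : x1 = x2 by apply: (@coef_inj m A) => k; rewrite [LHS]x1E [RHS]x2E ab.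
  by rewrite -y1E -y2E (inv_eq _ _ _ _ xy1 (_ : x1 * y2 = 1)) // xx.
- by apply: inv_eq (valid_unit vv a) _; rewrite ab; apply: valid_unit ww a.
Qed.

Lemma codes_surj (A : comPzRingType) (x : targetF m n A) :
  exists i (v : gen -> A), valid_at i v /\ codes v x.
Proof.
case: x => X f; have [D [k Xk]] := loc_const_dec (mx_at_loc_const (Mplus_mx X)).
pose S := [seq k i | i <- enum 'I_(dec_size D)].
have kS i : k i \in S by apply: map_f; rewrite mem_enum.
(* Several factors may carry the same matrix, so their idempotents are added. *)
pose E Y := \sum_(i | k i == Y) dec_idem D i.
have EE j Y : dec_proj D j (E Y) = (k j == Y)%:R.
  rewrite rmorph_sum; under eq_bigr do rewrite dec_proj_idem.
  case: eqP => kj; last first.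
    by rewrite big1 // => i /eqP ki; case: eqP => // ij; case: kj; rewrite -ij.
  rewrite (bigD1 j) ?kj //= eqxx big1 ?addr0 // => i /andP[_ /negPf->] //.
have /choice[g gf] a : exists g : iterR m A, g * LGm0_val (f a) = 1 := LGm0_inv (f a).
have lead a p : has_lead p (LGm0_val (f a)) 0.
  have := proj1 (has_nuP _ _) (LGm0_nu (f a)) p; congr has_lead.
  by apply/matrixP => i j; rewrite !mxE.
have /choice[c cP] a : exists c, c * coefR (LGm0_val (f a) : iterR m A) 0 = 1.
  by apply/invertibleP => p; case: (lead a p).
have /choice[K KP] a : exists K : 'cV[int]_m -> nat, forall l, lexlt l 0 ->
    coefR (LGm0_val (f a) : iterR m A) l ^+ K l = 0.
  have /choice[K KP] l : exists K : nat, lexlt l 0 -> coefR (LGm0_val (f a) : iterR m A) l ^+ K = 0.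
    have [l0|nl0] := pselect (lexlt l 0); last by exists 0%N.
    have [K aK] : nilpotent (coefR (LGm0_val (f a) : iterR m A) l).
      by apply/nilpotentP => p; case: (lead a p) => _; apply.
    by exists K.
  by exists K.
have [lam lamP] : exists lam : Lam m, forall a, a \in enum 'I_n ->
    supp_in lam (LGm0_val (f a) : iterR m A) /\ supp_in lam (g a).
  apply: Lam_collect => [a l1 l2 le12 [h1 h2]|a _]; first by split; apply: supp_in_le le12 _.
  have [l1 h1] := supp_exists (LGm0_val (f a) : iterR m A); have [l2 h2] := supp_exists (g a).
  have [le1 le2] := Lam_leI l1 l2; exists (LamI l1 l2).
  by split; [exact: supp_in_le le1 h1 | exact: supp_in_le le2 h2].
pose v (x : gen) : A := match x with
  | GE Y => E Y
  | Ga a l => coefR (LGm0_val (f a) : iterR m A) l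
  | Gb a l => coefR (g a) l
  | Gc a => c a
  end.
exists (S, lam, K), v; split; last first.
  split=> //= Y p; have [j [q <-]] := Spec_dec D p; rewrite Xk /= EE.
  have [q0 _ _ q1 _] := specP q.
  by case: eqP => // kj; split.
split=> /=.
- by move=> Y; apply: (@Defs.dec_inj A D) => j; rewrite rmorphM EE; case: eqP => _; rewrite ?mulr1 ?mulr0.
- move=> Y Z YZ; apply: (@Defs.dec_inj A D) => j; rewrite rmorphM !EE rmorph0.
  case: eqP => [kY|_]; last by rewrite mul0r.
  by case: eqP => [kZ|_]; rewrite ?mulr0 //; case: YZ; rewrite -kY.
- move=> Y nY; apply: (@Defs.dec_inj A D) => j; rewrite EE rmorph0; case: eqP => // kY.
  (* A factor without primes may carry a matrix that is not echelon; there every equation holds. *)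
  have [[q]|noq] := pselect (inhabited (Spec (dec_ring D j))).
    by case: nY; rewrite -kY -(Xk j q); apply: MplusP.
  exact: no_prime_trivial (fun q => noq (inhabits q)) _ _.
- move=> r ur Sr; apply: (@Defs.dec_inj A D) => j; rewrite rmorph_sum rmorph1.
  under eq_bigr do rewrite EE.
  rewrite (bigD1_seq (k j)) ?Sr //= eqxx big1 ?addr0 // => Y.
  by rewrite eq_sym => /negPf->.
- move=> a l Zl; have [h1 h2] := lamP a (mem_enum _ a).
  by split; [apply: h1 | apply: h2].
- move=> a x y xE yE.
  have -> : x = LGm0_val (f a) by apply: (@coef_inj m A) => l; rewrite [LHS]xE.
  have -> : y = g a by apply: (@coef_inj m A) => l; rewrite [LHS]yE.
  by rewrite mulrC; apply: gf.
- by move=> a l; apply: KP.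
- by move=> a; rewrite mulrC; apply: cP.
Qed.

Lemma codes_map (A B : comPzRingType) (u : {rmorphism A -> B}) (v : gen -> A) x :
  codes v x -> codes (u \o v) (fmap (fstr (targetF m n)) u x).
Proof.
case: x => X f [vX vf]; split=> [Y q|i l] /=; last first.
  by rewrite -vf; apply: coef_map.
have -> : mx_at (map_mx (uZ_map u) (Mplus_mx X)) q = mx_at (Mplus_mx X) (Spec_map u q).
  by apply/matrixP => i j; rewrite !mxE.
exact: (vX Y (Spec_map u q)).
Qed.

Definition target_ind : indAffine :=
  val_ind index_le_refl index_le_trans index_inh index_dir valid_at_le valid_at_reflect.

Lemma target_represented : represents target_ind (targetF m n).
Proof.
exact: (@val_ind_represents _ _ _ _ _ _ _ _ _ valid_at_map _ _ codes
  codes_exists codes_fun codes_inj codes_surj codes_map).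
Qed.

End TargetRepresentable.

(* [base_change] with its equivalence says that base change along u exists, is
   unique, and is the action of the functor H on morphisms. *)
Theorem proposition5p1 (m n : nat) (hm : (0 < m)%N) (hn : (0 < n)%N) :
  exists H : functor_on (calgHom n m),
    (forall (A B : comPzRingType) (u : {rmorphism A -> B})
            (phi : calgHom n m A) (psi : calgHom n m B),
        base_change u phi psi <-> psi = fmap H u phi) /\
    exists Theta : forall A : comPzRingType, calgHom n m A -> targetF m n A,
      [/\ forall (A : comPzRingType) (phi : calgHom n m A),
            Mplus_mx (Theta A phi).1 = Upsilon phi /\
            forall i : 'I_n, LGm0_val ((Theta A phi).2 i) = angular phi i,
          @nat_iso (RingFunctor H) (targetF m n) Theta
        & exists X : indAffine,
            represents X (targetF m n) /\ represents X (RingFunctor H)].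
Proof.
exists (calgHom_on m n); split; first exact: base_changeP.
exists (@coordinates m n); split=> //; first exact: coordinates_iso.
exists (target_ind m n); split; first exact: target_represented.
exact: represents_iso (@coordinates_iso m n) (@target_represented m n).
Qed.
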